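(* Let $\Omega$ be a circular domain of connectivity $g+1$ ($g\ge1$). Suppose that $p_1, \ldots, p_n$ are points in $\Omega$ satisfying $$\sum_{k=1}^n u_j (p_k) = n_j \qquad\text{for all } j=1,\dots , g$$ for positive integers $n_1,\ldots,n_g$. Then up to a multiplicative factor $e^{i\theta}$ ($\theta\in\mathbb{R}$), any proper holomorphic map $f\in\mathcal{P}(\Omega)$ which has zeros $p_1, \ldots, p_n$ (counted with multiplicity) and satisfies $\deg ( f|_{\gamma_j})= n_j$ for $j=1,\ldots,g$ can be written uniquely as $$f(z)= \exp \left( -2 \pi i \sum_{j=1}^{g} n_j v_j (z) \right) \prod_{k=1}^n \eta (z,p_k).$$
   Context: A circular domain of connectivity $g+1$ is $\mathbb{D}$ (the open unit disk) with $g$ mutually disjoint closed disks inside $\mathbb{D}$ removed. $\gamma_0=\partial\mathbb{D}$, and $\gamma_1,\ldots,\gamma_g$ are the other boundary circles; $\gamma_l$ has center $q_l$ and radius $r_l>0$. $\mathcal{P}(\Omega)$ is the set of proper holomorphic maps of $\Omega$ onto $\mathbb{D}$. Each $f\in\mathcal{P}(\Omega)$ extends analytically across $\partial\Omega$ and maps each $\gamma_l$ onto $\partial\mathbb{D}$ as a covering; $\deg(f|_{\gamma_l})$ is its degree ($\gamma_l$ oriented as part of the boundary of $\Omega$), i.e. the number of preimages on $\gamma_l$ of a point of $\partial\mathbb{D}$. $u_l$ is the harmonic function on $\Omega$ with boundary values $u_l|_{\gamma_m}=\delta_{lm}$. A circularly slit disk is the unit disk with circular arcs centered at $0$ removed.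 $\eta(\cdot,p)$ is a conformal map of $\Omega$ onto a circularly slit disk which maps $p$ to $0$ and preserves the unit circle; it is unique up to rotation. Integrals of the first kind: let $\varphi_l(z)=q_l+\frac{r_l^2}{\overline z-\overline{q_l}}$ be the reflection in $\gamma_l$ and $\theta_j=\varphi_j\circ\varphi_0$ ($j=1,\dots,g$). Let $\Omega^*=\Omega\cup\gamma_0\cup\varphi_0(\Omega)$; identifying $\varphi_0(\gamma_j)$ with $\gamma_j$ via $\theta_j$ turns $\overline{\Omega^*}$ into a compact Riemann surface of genus $g$. The $v_1,\ldots,v_g$ are the (additively multivalued) analytic functions whose differentials $dv_j$ are holomorphic differentials on this surface with $\int_{\gamma_i}dv_j=\delta_{ij}$ ($\gamma_i$ counterclockwise); they satisfy $v_j(\theta_i(z))-v_j(z)=\tau_{ij}$ with purely imaginary constants $\tau_{ij}=\tau_{ji}$, and are normalized so that $v_j(\overline z^{-1})=\overline{v_j(z)}$ (so $\mathrm{Im}\,v_j=0$ on $\gamma_0$). With this, $2i\,\mathrm{Im}\,v_j=\sum_{k=1}^g\tau_{jk}u_k$ on $\Omega$. The values of $v_j$ are ambiguous only by integers, so $\exp(-2\pi i n_jv_j)$ is single-valued on $\Omega$. *)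

(* Defs.v *)
From Stdlib Require Import Reals List ZArith.
From Coquelicot Require Import Coquelicot.

Local Open Scope R_scope.

Definition Cexp (z : C) : C :=
  (exp (Re z) * cos (Im z), exp (Re z) * sin (Im z)).

Definition Cprod_n_m (a : nat -> C) (n m : nat) : C :=
  Iter.iter_nat Cmult (RtoC 1) a n m.

Definition holomorphic_at (f : C -> C) (z : C) : Prop :=
  locally z (fun y : C =>
    ex_derive (K := C_AbsRing) (V := C_NormedModule) f y).

Definition holomorphic_on (D : C -> Prop) (f : C -> C) : Prop :=
  forall z, D z -> holomorphic_at f z.

Definition harmonic_on (D : C -> Prop) (u : C -> R) : Prop :=
  let U x y := u (x, y) in
  forall x y, D (x, y) ->
    ex_diff_n U 2 x y /\
    partial_derive 2 0 U x y + partial_derive 0 2 U x y = 0.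

Definition compact_set (K : C -> Prop) : Prop :=
  forall (I : Type) (U : I -> C -> Prop),
    (forall i, open (U i)) ->
    (forall z, K z -> exists i, U i z) ->
    exists l : list I, forall z, K z -> exists i, In i l /\ U i z.

Definition has_card {T : Type} (A : T -> Prop) (m : nat) : Prop :=
  exists l : list T, NoDup l /\ length l = m /\ forall x, In x l <-> A x.

(** [f] vanishes at [z] to order exactly [m] ([m = 0] means [f z <> 0]). *)
Definition zero_order (f : C -> C) (z : C) (m : nat) : Prop :=
  exists h : C -> C, holomorphic_at h z /\ h z <> 0%C /\
    locally z (fun y : C => f y = ((y - z) ^ m * h y)%C).

Definition unit_disk (z : C) : Prop := Cmod z < 1.

(** Circles are indexed by [0, ..., g]; index [0] is the unit circle, encoded
    by [q 0 = 0] and [r 0 = 1] in [circular_domain]. *)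

Definition circle (q : nat -> C) (r : nat -> R) (l : nat) (z : C) : Prop :=
  Cmod (z - q l) = r l.

Definition closed_disk (q : nat -> C) (r : nat -> R) (l : nat) (z : C) : Prop :=
  Cmod (z - q l) <= r l.

Definition circular_domain (g : nat) (q : nat -> C) (r : nat -> R) : Prop :=
  q 0%nat = 0%C /\ r 0%nat = 1 /\
  (forall l, (1 <= l <= g)%nat ->
     0 < r l /\ forall z, closed_disk q r l z -> unit_disk z) /\
  (forall l m, (1 <= l <= g)%nat -> (1 <= m <= g)%nat -> l <> m ->
     forall z, ~ (closed_disk q r l z /\ closed_disk q r m z)).

Definition Omega (g : nat) (q : nat -> C) (r : nat -> R) (z : C) : Prop :=
  unit_disk z /\ forall l, (1 <= l <= g)%nat -> ~ closed_disk q r l z.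

Definition Omega_bar (g : nat) (q : nat -> C) (r : nat -> R) (z : C) : Prop :=
  Omega g q r z \/ exists l, (l <= g)%nat /\ circle q r l z.

Definition harmonic_measures (g : nat) (q : nat -> C) (r : nat -> R)
    (u : nat -> C -> R) : Prop :=
  forall l, (1 <= l <= g)%nat ->
    harmonic_on (Omega g q r) (u l) /\
    continuous_on (Omega_bar g q r) (u l) /\
    forall m z, (m <= g)%nat -> circle q r m z ->
      u l z = if Nat.eq_dec l m then 1 else 0.

Definition proper_onto_disk (D : C -> Prop) (f : C -> C) : Prop :=
  holomorphic_on D f /\
  (forall z, D z -> unit_disk (f z)) /\
  (forall w, unit_disk w -> exists z, D z /\ f z = w) /\
  (forall K : C -> Prop, compact_set K -> (forall w, K w -> unit_disk w) ->
     compact_set (fun z => D z /\ K (f z))).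

Definition zero_list (D : C -> Prop) (f : C -> C) (n : nat) (p : nat -> C)
    : Prop :=
  forall z, D z -> exists m : nat,
    has_card (fun k => (1 <= k <= n)%nat /\ p k = z) m /\ zero_order f z m.

(** [deg (f | gamma_l) = d].  Only the values of [f] on [Omega] matter: [F] is
    the analytic extension of [f] across the boundary, which is unique on
    [Omega_bar]. *)
Definition boundary_degree (g : nat) (q : nat -> C) (r : nat -> R)
    (f : C -> C) (l d : nat) : Prop :=
  exists F : C -> C,
    holomorphic_on (Omega_bar g q r) F /\
    (forall z, Omega g q r z -> F z = f z) /\
    forall w, Cmod w = 1 -> has_card (fun z => circle q r l z /\ F z = w) d.

Definition arc (rho a b : R) (w : C) : Prop :=
  exists t, a <= t <= b /\ w = (rho * cos t, rho * sin t).

Definition circularly_slit_disk (S : C -> Prop) : Prop :=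
  exists (m : nat) (rho a b : nat -> R),
    (forall i, (i < m)%nat -> 0 < rho i < 1 /\ a i < b i < a i + 2 * PI) /\
    (forall i j w, (i < m)%nat -> (j < m)%nat -> i <> j ->
       ~ (arc (rho i) (a i) (b i) w /\ arc (rho j) (a j) (b j) w)) /\
    forall w, S w <->
      unit_disk w /\ forall i, (i < m)%nat -> ~ arc (rho i) (a i) (b i) w.

Definition conformal_onto (D S : C -> Prop) (f : C -> C) : Prop :=
  holomorphic_on D f /\
  (forall z z', D z -> D z' -> f z = f z' -> z = z') /\
  (forall w, S w <-> exists z, D z /\ f z = w).

Definition preserves_unit_circle (D : C -> Prop) (f : C -> C) : Prop :=
  exists F : C -> C,
    continuous_on (fun z => D z \/ Cmod z = 1) F /\
    (forall z, D z -> F z = f z) /\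
    (forall w, Cmod w = 1 <-> exists z, Cmod z = 1 /\ F z = w).

Definition slit_disk_map (D : C -> Prop) (p : C) (f : C -> C) : Prop :=
  (exists S, circularly_slit_disk S /\ conformal_onto D S f) /\
  f p = 0%C /\
  preserves_unit_circle D f.

(** The Riemann sphere; [None] is the point at infinity. *)
Definition sphere : Type := option C.

(** The inverse of the chart [1/z] at infinity. *)
Definition at_infinity (w : C) : sphere :=
  if Ceq_dec w 0 then None else Some (/ w)%C.

Definition sphere_locally (P : sphere) (A : sphere -> Prop) : Prop :=
  match P with
  | Some z => locally z (fun y : C => A (Some y))
  | None => locally (0%C : C) (fun w : C => A (at_infinity w))
  end.

Definition phi (q : nat -> C) (r : nat -> R) (l : nat) (P : sphere) : sphere :=
  match P with
  | None => Some (q l)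
  | Some z =>
      if Ceq_dec z (q l) then None
      else Some (q l + RtoC (r l ^ 2) / (Cconj z - Cconj (q l)))%C
  end.

Definition theta (q : nat -> C) (r : nat -> R) (j : nat) (P : sphere) : sphere :=
  phi q r j (phi q r 0 P).

(** The closure of [Omega* = Omega U gamma_0 U phi_0(Omega)]. *)
Definition Omega_star_bar (g : nat) (q : nat -> C) (r : nat -> R)
    (P : sphere) : Prop :=
  exists z, Omega_bar g q r z /\ (P = Some z \/ P = phi q r 0 (Some z)).

Definition eq_mod_Z (a b : C) : Prop := exists k : Z, (a - b)%C = RtoC (IZR k).

(** A multivalued function whose values are ambiguous by integers is given by
    an arbitrary choice [v] of one value at each point, not assumed
    continuous.  Its differential is the holomorphic differential which is
    [dv z dz] at finite points. *)
Definition integral_of (g : nat) (q : nat -> C) (r : nat -> R)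
    (v : sphere -> C) (dv : C -> C) : Prop :=
  (forall z, Omega_star_bar g q r (Some z) ->
     exists h : C -> C, locally z (fun y : C =>
       is_derive (K := C_AbsRing) (V := C_NormedModule) h y (dv y) /\
       eq_mod_Z (v (Some y)) (h y))) /\
  (Omega_star_bar g q r None ->
     exists h : C -> C, holomorphic_at h 0%C /\
       locally (0%C : C) (fun w : C => eq_mod_Z (v (at_infinity w)) (h w))).

(** [v 1, ..., v g] are the normalized integrals of the first kind, [dv j] is
    the density of the differential of [v j] and [tau] is the period matrix.
    The relation with [theta] is required in a neighbourhood of
    [phi_0(gamma_i)]: it makes the differentials descend to the compact surface
    obtained from [Omega_star_bar] by identifying [phi_0(gamma_i)] with
    [gamma_i] via [theta i]. *)
Record integrals_of_first_kind (g : nat) (q : nat -> C) (r : nat -> R)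
    (v : nat -> sphere -> C) (dv : nat -> C -> C) (tau : nat -> nat -> C)
    : Prop := {
  ifk_analytic : forall j, (1 <= j <= g)%nat -> integral_of g q r (v j) (dv j);
  ifk_periods : forall i j, (1 <= i <= g)%nat -> (1 <= j <= g)%nat ->
    is_RInt (V := C_R_NormedModule)
      (fun t : R =>
         (dv j (q i + RtoC (r i) * Cexp (Ci * RtoC t))
          * (Ci * RtoC (r i) * Cexp (Ci * RtoC t)))%C)
      0 (2 * PI) (RtoC (if Nat.eq_dec i j then 1 else 0));
  ifk_theta : forall i j z, (1 <= i <= g)%nat -> (1 <= j <= g)%nat ->
    circle q r i z ->
    sphere_locally (phi q r 0 (Some z)) (fun P =>
      eq_mod_Z (v j (theta q r i P) - v j P)%C (tau i j));
  ifk_tau_imaginary : forall i j, (1 <= i <= g)%nat -> (1 <= j <= g)%nat ->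
    Re (tau i j) = 0;
  ifk_tau_sym : forall i j, (1 <= i <= g)%nat -> (1 <= j <= g)%nat ->
    tau i j = tau j i;
  ifk_reflection : forall j P, (1 <= j <= g)%nat -> Omega_star_bar g q r P ->
    eq_mod_Z (v j (phi q r 0 P)) (Cconj (v j P))
}.

(* Main.v *)
(** Let [W] be the exponential factor and [H = f / (W * prod_k eta (., p_k))].  The slit maps have simple
    zeros, so [H] extends to a zero-free holomorphic function on [Omega], and [|H|] tends to a constant
    [c_l] at each boundary circle, with [c_0 = 1].  Around [gamma_l] the argument of [f] has variation
    [- 2 PI n_l] (the degree hypothesis), that of [W] has the same variation (the periods of the [v_j]), and
    that of [eta] has none, since near [gamma_l] its values cluster at an arc and so avoid a ray.  Hence the
    flux of [ln |H|] through every circle close to [gamma_l], [l >= 1], vanishes and the mean of [ln |H|] over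
    these circles is constant.  If the largest [c_l] were attained only at some [l >= 1], this mean would be
    equal to the supremum of [ln |H|], so that [|H|] would be constant, equal to [c_0 = 1].  Thus [|H| <= 1];
    the same argument for [1 / H] gives [|H| = 1], and [H] is a unimodular constant.

    The complex analysis behind this (Goursat, Cauchy's formula, removable singularities, maximum modulus,
    open mapping) uses only means over concentric circles, whose independence of the radius comes from
    Goursat's theorem in logarithmic coordinates [z = a + exp w]. *)
Require Import Defs.
From Stdlib Require Import Reals List ZArith Lra Lia ClassicalEpsilon Classical.
From Coquelicot Require Import Coquelicot.

Local Open Scope R_scope.

(** * Plane topology and complex differentiability *)

(** The obstacle is the behaviour at the inner circles: a slit map has a limiting modulus there but
    need not extend continuously, and [v] is an arbitrary choice of values modulo integers. So
    [ln |H|] is never extended across [gamma_l] and [H] gets no global logarithm; boundary data of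
    [H] enter as limits of [|H|], and its argument enters through integrals of [H' / H] over circles
    inside Omega. That these limits are constant on each circle has three sources. For [f] it is
    properness. For [W], the reflection rule and the [theta] rule together give
    [Im v_j = Im tau_lj / 2] on [gamma_l]. For a slit map, values near the boundary leave every
    compact subset of the slit disk; circles about 0 that miss all arcs are such subsets, so the
    modulus must settle at a single radius. The degree is a number of preimages; it becomes a
    variation of argument because [|f| < 1] outside [gamma_l] makes the argument monotone along
    [gamma_l]. The minus sign arises because [gamma_l] is run counterclockwise, against its
    orientation as boundary of Omega. *)

(** Neighbourhoods in [C] are those of the product structure, whose balls are squares; the factor
    [sqrt 2] is the cost of enclosing a square in a disc. *)
Lemma locally_CmodP (z : C) (P : C -> Prop) :
  locally z P <-> exists d, 0 < d /\ forall y, Cmod (y - z) < d -> P y.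
Proof.
split.
- intros [d Hd]; exists d; split; [apply cond_pos|].
  intros y Hy; apply Hd; apply C_NormedModule_mixin_compat1; exact Hy.
- intros [d [Hd H]].
  assert (Hs : 0 < sqrt 2) by (apply sqrt_lt_R0; lra).
  assert (Hd' : 0 < d / sqrt 2) by (apply Rdiv_lt_0_compat; lra).
  exists (mkposreal _ Hd'); intros y Hy; apply H.
  replace d with (sqrt 2 * (d / sqrt 2)) by (field; lra).
  exact (C_NormedModule_mixin_compat2 z y (mkposreal _ Hd') Hy).
Qed.

Lemma continuous_CmodP {T : UniformSpace} (f : T -> C) (x : T) :
  continuous f x <->
  forall e, 0 < e -> locally x (fun y => Cmod (f y - f x) < e).
Proof.
split.
- intros H e He; apply (H (fun w => Cmod (w - f x) < e)).
  apply locally_CmodP; exists e; auto.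
- intros H P HP; apply locally_CmodP in HP; destruct HP as [d [Hd HP]].
  unfold filtermap; generalize (H d Hd); apply filter_imp; intros y Hy; apply HP; exact Hy.
Qed.

Lemma continuous_RP {T : UniformSpace} (f : T -> R) (x : T) :
  continuous f x <->
  forall e, 0 < e -> locally x (fun y => Rabs (f y - f x) < e).
Proof.
split.
- intros H e He; apply (H (fun w => Rabs (w - f x) < e)).
  exists (mkposreal e He); intros y Hy; exact Hy.
- intros H P [d HP].
  unfold filtermap; generalize (H d (cond_pos d)); apply filter_imp; intros y Hy; apply HP; exact Hy.
Qed.

Lemma Cmod_sub_triangle (y x z : C) : Cmod (x - z) <= Cmod (x - y) + Cmod (y - z).
Proof. replace (x - z)%C with (x - y + (y - z))%C by ring; apply Cmod_triangle. Qed.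

Lemma Cmod_sub_sym (x y : C) : Cmod (x - y) = Cmod (y - x).
Proof. rewrite <- Cmod_opp; f_equal; ring. Qed.

Lemma Cmod_sub_0 (y : C) : Cmod (y - 0) = Cmod y.
Proof. f_equal; ring. Qed.

Lemma Cmod_le_sub (c z : C) : Cmod z <= Cmod (z - c) + Cmod c.
Proof. replace z with (z - c + c)%C at 1 by ring; apply Cmod_triangle. Qed.

Section Continuity.
Context {T : UniformSpace}.
Implicit Types (f g : T -> C) (x : T).

Lemma continuous_Re f x : continuous f x -> continuous (fun y => Re (f y)) x.
Proof.
intros H; apply continuous_RP; intros e He.
generalize (proj1 (continuous_CmodP f x) H e He); apply filter_imp.
intros y Hy; eapply Rle_lt_trans; [|exact Hy].
exact (re_le_Cmod (f y - f x)).
Qed.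

Lemma im_le_Cmod (c : C) : Rabs (Im c) <= Cmod c.
Proof. eapply Rle_trans; [apply Rmax_r|apply (Rmax_Cmod c)]. Qed.

Lemma continuous_Im f x : continuous f x -> continuous (fun y => Im (f y)) x.
Proof.
intros H; apply continuous_RP; intros e He.
generalize (proj1 (continuous_CmodP f x) H e He); apply filter_imp.
intros y Hy; eapply Rle_lt_trans; [|exact Hy].
exact (im_le_Cmod (f y - f x)).
Qed.

Lemma Cmod_le_add (c : C) : Cmod c <= Rabs (Re c) + Rabs (Im c).
Proof.
replace c with (RtoC (Re c) + Ci * RtoC (Im c))%C at 1.
- eapply Rle_trans; [apply Cmod_triangle|].
  rewrite Cmod_mult, Cmod_Ci, !Cmod_R; lra.
- destruct c; unfold RtoC, Ci, Cplus, Cmult, Re, Im; simpl; f_equal; ring.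
Qed.

Lemma continuous_ReIm f x :
  continuous (fun y => Re (f y)) x -> continuous (fun y => Im (f y)) x ->
  continuous f x.
Proof.
rewrite !continuous_RP, continuous_CmodP; intros H1 H2 e He.
generalize (filter_and (F := locally x) _ _ (H1 (e / 2) ltac:(lra)) (H2 (e / 2) ltac:(lra))).
apply filter_imp; intros y [A B]; eapply Rle_lt_trans; [apply Cmod_le_add|].
change (Re (f y - f x)%C) with (Re (f y) - Re (f x)).
change (Im (f y - f x)%C) with (Im (f y) - Im (f x)); lra.
Qed.

Lemma continuous_Cplus f g x : continuous f x -> continuous g x ->
  continuous (fun y => f y + g y)%C x.
Proof. intros Hf Hg; exact (continuous_plus (V := C_R_NormedModule) f g x Hf Hg). Qed.

Lemma continuous_Copp f x : continuous f x -> continuous (fun y => - f y)%C x.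
Proof. intros Hf; exact (continuous_opp (V := C_R_NormedModule) f x Hf). Qed.

Lemma continuous_Cminus f g x : continuous f x -> continuous g x ->
  continuous (fun y => f y - g y)%C x.
Proof. intros Hf Hg; apply continuous_Cplus; auto; apply continuous_Copp; auto. Qed.

Lemma continuous_Cmult f g x : continuous f x -> continuous g x ->
  continuous (fun y => f y * g y)%C x.
Proof.
intros Hf Hg.
pose proof (continuous_Re f x Hf) as A; pose proof (continuous_Im f x Hf) as B.
pose proof (continuous_Re g x Hg) as A'; pose proof (continuous_Im g x Hg) as B'.
apply continuous_ReIm.
- exact (continuous_minus _ _ x
    (continuous_mult (K := R_AbsRing) _ _ x A A') (continuous_mult (K := R_AbsRing) _ _ x B B')).
- exact (continuous_plus _ _ x
    (continuous_mult (K := R_AbsRing) _ _ x A B') (continuous_mult (K := R_AbsRing) _ _ x B A')).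
Qed.

Lemma Cmod_sub_le (a b : C) : Rabs (Cmod a - Cmod b) <= Cmod (a - b).
Proof.
apply Rabs_le; split.
- assert (H := Cmod_triangle a (b - a)%C).
  replace (a + (b - a))%C with b in H by ring.
  replace (b - a)%C with (- (a - b))%C in H by ring; rewrite Cmod_opp in H; lra.
- assert (H := Cmod_triangle b (a - b)%C).
  replace (b + (a - b))%C with a in H by ring; lra.
Qed.

Lemma continuous_Cmod f x : continuous f x -> continuous (fun y => Cmod (f y)) x.
Proof.
rewrite continuous_CmodP, continuous_RP; intros H e He.
generalize (H e He); apply filter_imp; intros y Hy.
eapply Rle_lt_trans; [apply Cmod_sub_le|exact Hy].
Qed.

Lemma locally_neq0 f x : continuous f x -> f x <> 0%C -> locally x (fun y => f y <> 0%C).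
Proof.
intros H Hx; apply Cmod_gt_0 in Hx.
generalize (proj1 (continuous_CmodP f x) H _ Hx); apply filter_imp.
intros y Hy E; rewrite E in Hy.
replace (0 - f x)%C with (- f x)%C in Hy by ring; rewrite Cmod_opp in Hy; lra.
Qed.

Lemma continuous_Cinv f x : continuous f x -> f x <> 0%C ->
  continuous (fun y => / f y)%C x.
Proof.
intros H Hx; pose proof Hx as Hx'; apply Cmod_gt_0 in Hx'.
apply continuous_CmodP; intros e He.
set (m := Cmod (f x)) in *.
(* The first bound keeps [Cmod (f y)] above [m / 2]; the second then brings
   [Cmod (f y - f x) / (m * Cmod (f y))] below [e]. *)
set (d := Rmin (m / 2) (e * m * m / 2)).
assert (Hd : 0 < d).
{ apply Rmin_pos; [lra|]; repeat apply Rmult_lt_0_compat; lra. }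
generalize (proj1 (continuous_CmodP f x) H d Hd); apply filter_imp; intros y Hy.
assert (H1 : m / 2 < Cmod (f y)).
{ assert (A := Cmod_sub_le (f y) (f x)); apply Rabs_le_between in A; fold m in A.
  assert (d <= m / 2) by apply Rmin_l; lra. }
assert (Hy0 : f y <> 0%C) by (apply Cmod_gt_0; lra).
replace (/ f y - / f x)%C with (- ((f y - f x) * / (f x * f y)))%C
  by (field; split; assumption).
rewrite Cmod_opp, Cmod_mult, Cmod_inv, Cmod_mult by (apply Cmult_neq_0; assumption).
fold m; set (w := Cmod (f y)) in *; set (k := Cmod (f y - f x)) in *.
assert (d <= e * m * m / 2) by apply Rmin_r.
apply Rmult_lt_reg_r with (m * w); [nra|].
rewrite Rmult_assoc, Rinv_l by nra.
assert (e * m * (m/2) < e * m * w); [|lra].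
apply Rmult_lt_compat_l; [nra|lra].
Qed.

Lemma continuous_Cdiv f g x : continuous f x -> continuous g x -> g x <> 0%C ->
  continuous (fun y => f y / g y)%C x.
Proof. intros; apply continuous_Cmult; auto; apply continuous_Cinv; auto. Qed.

Lemma continuous_RtoC (h : T -> R) x : continuous h x -> continuous (fun y => RtoC (h y)) x.
Proof.
intros H; apply continuous_ReIm; [exact H|exact (continuous_const 0 x)].
Qed.

Lemma continuous_Cexp f x : continuous f x -> continuous (fun y => Cexp (f y)) x.
Proof.
intros H.
assert (A := continuous_comp _ exp x (continuous_Re f x H) (continuous_exp _)).
assert (B := continuous_comp _ cos x (continuous_Im f x H) (continuous_cos _)).
assert (D := continuous_comp _ sin x (continuous_Im f x H) (continuous_sin _)).
apply continuous_ReIm.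
- exact (continuous_mult (K := R_AbsRing) _ _ x A B).
- exact (continuous_mult (K := R_AbsRing) _ _ x A D).
Qed.

Lemma continuous_Cpow f x k : continuous f x -> continuous (fun y => (f y ^ k)%C) x.
Proof.
intros H; induction k; simpl; [apply continuous_const|].
apply continuous_Cmult; assumption.
Qed.

End Continuity.

(** * The complex exponential and the rules of differentiation *)

Lemma Cexp_plus (a b : C) : Cexp (a + b) = (Cexp a * Cexp b)%C.
Proof.
destruct a as [a1 a2], b as [b1 b2]; unfold Cexp, Cmult, Cplus, Re, Im; simpl.
rewrite exp_plus, cos_plus, sin_plus; f_equal; ring.
Qed.

Lemma Cexp_0 : Cexp 0 = 1%C.
Proof. unfold Cexp, RtoC; simpl; rewrite exp_0, cos_0, sin_0; f_equal; ring. Qed.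

Lemma Cmod_Cexp (a : C) : Cmod (Cexp a) = exp (Re a).
Proof.
assert (H : Cmod (Cexp a) ^ 2 = exp (Re a) ^ 2).
{ rewrite Cmod2_alt; unfold Cexp; simpl.
  assert (A := sin2_cos2 (Im a)); unfold Rsqr in A.
  transitivity (exp (Re a) * exp (Re a) * (sin (Im a) * sin (Im a) + cos (Im a) * cos (Im a)));
    [ring|rewrite A; ring]. }
apply Rsqr_inj; [apply Cmod_ge_0|left; apply exp_pos|].
unfold Rsqr; simpl in H; lra.
Qed.

Lemma Cexp_neq_0 (a : C) : Cexp a <> 0%C.
Proof. apply Cmod_gt_0; rewrite Cmod_Cexp; apply exp_pos. Qed.

Lemma Cexp_opp (a : C) : Cexp (- a) = (/ Cexp a)%C.
Proof.
assert (H : (Cexp (- a) * Cexp a = 1)%C).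
{ rewrite <- Cexp_plus, <- Cexp_0; f_equal; ring. }
rewrite <- (Cmult_1_l (/ Cexp a)), <- H; field; apply Cexp_neq_0.
Qed.

Lemma Cexp_periodic_Z (k : Z) : Cexp (Ci * RtoC (2 * PI * IZR k)) = 1%C.
Proof.
assert (N : forall m : nat, Cexp (Ci * RtoC (2 * PI * INR m)) = 1%C).
{ induction m.
  - rewrite <- Cexp_0; f_equal; simpl; rewrite Rmult_0_r; ring.
  - replace (Ci * RtoC (2 * PI * INR (S m)))%C
      with (Ci * RtoC (2 * PI * INR m) + Ci * RtoC (2 * PI))%C.
    + rewrite Cexp_plus, IHm; unfold Cexp, Ci, Cmult, RtoC; simpl.
      replace (0 * (2 * PI) - 1 * 0) with 0 by ring.
      replace (0 * 0 + 1 * (2 * PI)) with (2 * PI) by ring.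
      rewrite exp_0, cos_2PI, sin_2PI; f_equal; ring.
    + rewrite S_INR, Rmult_plus_distr_l, RtoC_plus, Rmult_1_r; ring. }
destruct (Z.le_ge_cases 0 k) as [H|H].
- rewrite <- (Z2Nat.id k H), <- INR_IZR_INZ; apply N.
- replace (Ci * RtoC (2 * PI * IZR k))%C with (- (Ci * RtoC (2 * PI * INR (Z.to_nat (- k)))))%C.
  + rewrite Cexp_opp, N; field; apply C1_nz.
  + rewrite INR_IZR_INZ, Z2Nat.id, opp_IZR by lia.
    rewrite Ropp_mult_distr_r_reverse, RtoC_opp; ring.
Qed.

(* Caratheodory's form of differentiability, for which the sum, product and chain rules are algebraic. *)
Definition cder (f : C -> C) (z l : C) : Prop :=
  exists phi : C -> C, continuous phi z /\ phi z = l /\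
    forall y, f y = (f z + phi y * (y - z))%C.

Definition dif (f : C -> C) (z : C) : Prop := exists l, cder f z l.

Lemma cder_continuous f z l : cder f z l -> continuous f z.
Proof.
intros [phi [Hc [_ H]]].
apply continuous_ext with (fun y => f z + phi y * (y - z))%C; [intros y; symmetry; apply H|].
apply continuous_Cplus; [apply continuous_const|].
apply continuous_Cmult; [exact Hc|].
apply continuous_Cminus; [apply continuous_id|apply continuous_const].
Qed.

Lemma dif_continuous f z : dif f z -> continuous f z.
Proof. intros [l H]; eapply cder_continuous; eauto. Qed.

Lemma cderP f z l : cder f z l <->
  forall e, 0 < e -> locally z (fun y => Cmod (f y - f z - l * (y - z)) <= e * Cmod (y - z)).
Proof.
split.
- intros [phi [Hc [Hl H]]] e He.
  generalize (proj1 (continuous_CmodP _ _) Hc e He); apply filter_imp; intros y Hy.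
  rewrite (H y), <- Hl.
  replace (f z + phi y * (y - z) - f z - phi z * (y - z))%C with ((phi y - phi z) * (y - z))%C by ring.
  rewrite Cmod_mult; apply Rmult_le_compat_r; [apply Cmod_ge_0|lra].
- intros H.
  exists (fun y => if Ceq_dec y z then l else ((f y - f z) / (y - z))%C).
  split; [|split].
  + apply continuous_CmodP; intros e He.
    generalize (H (e / 2) ltac:(lra)); apply filter_imp; intros y Hy.
    destruct (Ceq_dec z z) as [_|]; [|congruence].
    destruct (Ceq_dec y z) as [->|Hn].
    { replace (l - l)%C with (RtoC 0) by ring; rewrite Cmod_0; lra. }
    assert (Hn' : (y - z)%C <> 0%C) by (intros E; apply Hn; replace y with (y - z + z)%C by ring; rewrite E; ring).
    replace ((f y - f z) / (y - z) - l)%C with ((f y - f z - l * (y - z)) / (y - z))%C by (field; exact Hn').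
    rewrite Cmod_div by exact Hn'.
    apply Cmod_gt_0 in Hn'.
    apply Rmult_lt_reg_r with (Cmod (y - z)); [exact Hn'|].
    unfold Rdiv; rewrite Rmult_assoc, Rinv_l, Rmult_1_r by lra; nra.
  + destruct (Ceq_dec z z); congruence.
  + intros y; destruct (Ceq_dec y z) as [->|Hn]; [ring|].
    field; intros E; apply Hn; replace y with (y - z + z)%C by ring; rewrite E; ring.
Qed.

Lemma Csub_neq (y z : C) : y <> z -> (y - z)%C <> 0%C.
Proof. intros Hn E; apply Hn; replace y with (y - z + z)%C by ring; rewrite E; ring. Qed.

Lemma is_derive_cder f z l :
  is_derive (K := C_AbsRing) (V := C_NormedModule) f z l -> cder f z l.
Proof.
intros [_ H]; apply cderP; intros e He.
assert (H' := H z (fun P HP => HP) (mkposreal e He)); simpl in H'.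
apply locally_CmodP.
destruct H' as [d Hd]; exists d; split; [apply cond_pos|].
intros y Hy; specialize (Hd y Hy).
unfold minus, plus, opp, scal in Hd; simpl in Hd; unfold mult in Hd; simpl in Hd.
replace (f y - f z - l * (y - z))%C with (f y + - f z + - ((y + - z) * l))%C by ring.
exact Hd.
Qed.

Lemma ex_derive_dif f z :
  ex_derive (K := C_AbsRing) (V := C_NormedModule) f z -> dif f z.
Proof. intros [l H]; exists l; apply is_derive_cder; exact H. Qed.

Lemma cder_ext_loc f g z l : locally z (fun y => f y = g y) -> cder f z l -> cder g z l.
Proof.
rewrite !cderP; intros Hl H e He.
pose proof (locally_singleton _ _ Hl) as Hz.
generalize (filter_and (F := locally z) _ _ Hl (H e He)); apply filter_imp.
intros y [E Hy]; rewrite <- E, <- Hz; exact Hy.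
Qed.

Lemma dif_ext_loc f g z : locally z (fun y => f y = g y) -> dif f z -> dif g z.
Proof. intros H [l Hl]; exists l; eapply cder_ext_loc; eauto. Qed.

Lemma cder_const c z : cder (fun _ => c) z 0.
Proof.
exists (fun _ => RtoC 0); split; [apply continuous_const|split; [reflexivity|intros; ring]].
Qed.

Lemma cder_id z : cder (fun y => y) z 1.
Proof.
exists (fun _ => RtoC 1); split; [apply continuous_const|split; [reflexivity|intros; ring]].
Qed.

Lemma cder_plus f g z l m : cder f z l -> cder g z m -> cder (fun y => f y + g y)%C z (l + m).
Proof.
intros [p [Hp [Ep Dp]]] [p' [Hp' [Ep' Dp']]].
exists (fun y => p y + p' y)%C; split; [apply continuous_Cplus; auto|split].
- now rewrite Ep, Ep'.
- intros y; rewrite (Dp y), (Dp' y); ring.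
Qed.

Lemma cder_mult f g z l m : cder f z l -> cder g z m ->
  cder (fun y => f y * g y)%C z (l * g z + f z * m).
Proof.
intros [p [Hp [Ep Dp]]] [p' [Hp' [Ep' Dp']]].
exists (fun y => p y * g z + f z * p' y + p y * p' y * (y - z))%C; split; [|split].
- apply continuous_Cplus; [apply continuous_Cplus|].
  + apply continuous_Cmult; [exact Hp|apply continuous_const].
  + apply continuous_Cmult; [apply continuous_const|exact Hp'].
  + apply continuous_Cmult; [apply continuous_Cmult; assumption|].
    apply continuous_Cminus; [apply continuous_id|apply continuous_const].
- rewrite Ep, Ep'; ring.
- intros y; rewrite (Dp y), (Dp' y); ring.
Qed.

Lemma cder_opp f z l : cder f z l -> cder (fun y => - f y)%C z (- l).
Proof.
intros [p [Hp [Ep Dp]]]; exists (fun y => - p y)%C; split; [apply continuous_Copp; auto|split].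
- now rewrite Ep.
- intros y; rewrite (Dp y); ring.
Qed.

Lemma cder_minus f g z l m : cder f z l -> cder g z m -> cder (fun y => f y - g y)%C z (l - m).
Proof. intros Hf Hg; apply cder_plus; [exact Hf|apply cder_opp; exact Hg]. Qed.

Lemma cder_scal c f z l : cder f z l -> cder (fun y => c * f y)%C z (c * l).
Proof.
intros H; replace (c * l)%C with (RtoC 0 * f z + c * l)%C by ring.
apply cder_mult; [apply cder_const|exact H].
Qed.

Lemma cder_inv f z l : cder f z l -> f z <> 0%C -> cder (fun y => / f y)%C z (- l / (f z * f z)).
Proof.
intros H Hz; pose proof (cder_continuous _ _ _ H) as Hc.
assert (Hl := locally_neq0 f z Hc Hz).
assert (Hcz := continuous_Cinv f z Hc Hz).
destruct H as [p [Hp [Ep Dp]]].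
set (k := fun y => (- p y * (/ f y * / f z))%C).
assert (Hk : continuous k z).
{ apply continuous_Cmult; [apply continuous_Copp; exact Hp|].
  apply continuous_Cmult; [exact Hcz|apply continuous_const]. }
apply cder_ext_loc with (fun y => / f z + k y * (y - z))%C.
- generalize Hl; apply filter_imp; intros y Hy; unfold k.
  assert (E : (p y * (y - z) = f y - f z)%C) by (rewrite (Dp y); ring).
  transitivity (/ f z - (p y * (y - z)) * (/ f y * / f z))%C; [ring|].
  rewrite E; field; split; assumption.
- exists k; split; [exact Hk|split].
  + unfold k; rewrite Ep; field; exact Hz.
  + intros y; ring.
Qed.

Lemma cder_div f g z l m : cder f z l -> cder g z m -> g z <> 0%C ->
  cder (fun y => f y / g y)%C z ((l * g z - f z * m) / (g z * g z)).
Proof.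
intros Hf Hg Hz.
replace ((l * g z - f z * m) / (g z * g z))%C with (l * / g z + f z * (- m / (g z * g z)))%C
  by (field; exact Hz).
apply (cder_mult f (fun y => / g y)%C); [exact Hf|apply (cder_inv g); assumption].
Qed.

Lemma cder_comp f g z l m : cder g z m -> cder f (g z) l -> cder (fun y => f (g y)) z (l * m).
Proof.
intros H [p [Hp [Ep Dp]]]; pose proof (cder_continuous _ _ _ H) as Hc.
destruct H as [p' [Hp' [Ep' Dp']]].
exists (fun y => p (g y) * p' y)%C; split; [|split].
- apply continuous_Cmult; [|exact Hp'].
  exact (continuous_comp g p z Hc Hp).
- now rewrite Ep, Ep'.
- intros y; rewrite (Dp (g y)), (Dp' y) at 1.
  replace (g y - g z)%C with (p' y * (y - z))%C by (rewrite (Dp' y) at 1; ring).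
  rewrite Dp' with y; ring.
Qed.

Lemma cder_unique f z l m : cder f z l -> cder f z m -> l = m.
Proof.
rewrite !cderP; intros H1 H2.
apply NNPP; intros Hn; apply Csub_neq, Cmod_gt_0 in Hn.
set (k := Cmod (l - m)) in *.
assert (A := filter_and (F := locally z) _ _ (H1 (k / 4) ltac:(lra)) (H2 (k / 4) ltac:(lra))).
apply locally_CmodP in A; destruct A as [d [Hd A]].
assert (E : (z + RtoC (d / 2) - z)%C = RtoC (d / 2)) by ring.
destruct (A (z + RtoC (d / 2))%C) as [B1 B2].
{ rewrite E, Cmod_R, Rabs_right; lra. }
rewrite E in B1, B2.
assert (T := Cmod_triangle (f (z + RtoC (d / 2)) - f z - m * RtoC (d / 2))%C
   (- (f (z + RtoC (d / 2)) - f z - l * RtoC (d / 2)))%C).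
rewrite Cmod_opp in T.
replace (f (z + RtoC (d / 2)) - f z - m * RtoC (d / 2)
   + - (f (z + RtoC (d / 2)) - f z - l * RtoC (d / 2)))%C with ((l - m) * RtoC (d / 2))%C in T by ring.
rewrite Cmod_mult in T; fold k in T.
rewrite Cmod_R, Rabs_right in * by lra.
nra.
Qed.

Lemma dif_const c z : dif (fun _ => c) z.
Proof. eexists; apply cder_const. Qed.
Lemma dif_id z : dif (fun y => y) z.
Proof. eexists; apply cder_id. Qed.
Lemma dif_plus f g z : dif f z -> dif g z -> dif (fun y => f y + g y)%C z.
Proof. intros [l H] [m H']; eexists; apply cder_plus; eassumption. Qed.
Lemma dif_minus f g z : dif f z -> dif g z -> dif (fun y => f y - g y)%C z.
Proof. intros [l H] [m H']; eexists; apply cder_minus; eassumption. Qed.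
Lemma dif_mult f g z : dif f z -> dif g z -> dif (fun y => f y * g y)%C z.
Proof. intros [l H] [m H']; eexists; apply cder_mult; eassumption. Qed.
Lemma dif_div f g z : dif f z -> dif g z -> g z <> 0%C -> dif (fun y => f y / g y)%C z.
Proof. intros [l H] [m H'] Hz; eexists; apply cder_div; eassumption. Qed.
Lemma dif_comp f g z : dif g z -> dif f (g z) -> dif (fun y => f (g y)) z.
Proof. intros [l H] [m H']; eexists; apply cder_comp; eassumption. Qed.
Lemma dif_sub_const c z : dif (fun y => y - c)%C z.
Proof. apply dif_minus; [apply dif_id|apply dif_const]. Qed.

Lemma derivable_pt_lim_0_bound (h : R -> R) l : derivable_pt_lim h 0 l ->
  forall e, 0 < e -> exists d, 0 < d /\ forall x, Rabs x < d -> Rabs (h x - h 0 - l * x) <= e * Rabs x.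
Proof.
intros H e He; destruct (H e He) as [d Hd]; exists d; split; [apply cond_pos|].
intros x Hx; destruct (Req_dec x 0) as [->|Hn].
{ replace (h 0 - h 0 - l * 0) with 0 by ring; rewrite Rabs_R0; lra. }
assert (A := Hd x Hn Hx); rewrite Rplus_0_l in A.
replace (h x - h 0 - l * x) with (((h x - h 0) / x - l) * x) by (field; exact Hn).
rewrite Rabs_mult; apply Rmult_le_compat_r; [apply Rabs_pos|lra].
Qed.

Lemma cder_Cexp_0 : cder Cexp 0 1.
Proof.
apply cderP; intros e He.
(* With [exp x <= 3] the error is at most [8 * k * c + c * c], where [c = Cmod w < k / 2];
   [k <= e / 16] brings this below [e * c]. *)
set (k := Rmin (e / 16) 1).
assert (Hk : 0 < k) by (apply Rmin_pos; lra).
destruct (derivable_pt_lim_0_bound exp 1) with (e := k) as [d1 [Hd1 H1]]; auto.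
{ rewrite <- exp_0; apply derivable_pt_lim_exp. }
destruct (derivable_pt_lim_0_bound cos 0) with (e := k) as [d2 [Hd2 H2]]; auto.
{ replace 0 with (- sin 0) at 2 by (rewrite sin_0; ring); apply derivable_pt_lim_cos. }
destruct (derivable_pt_lim_0_bound sin 1) with (e := k) as [d3 [Hd3 H3]]; auto.
{ rewrite <- cos_0; apply derivable_pt_lim_sin. }
apply locally_CmodP; exists (Rmin (Rmin d1 d2) (Rmin d3 (k / 2))).
split; [repeat apply Rmin_pos; lra|].
intros [x y] Hw.
replace ((x, y) - RtoC 0)%C with ((x, y) : C) in * by (unfold RtoC, Cminus, Cplus, Copp; simpl; f_equal; ring).
set (w := (x, y) : C) in *.
assert (Hx := re_le_Cmod w); assert (Hy := im_le_Cmod w); simpl in Hx, Hy.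
assert (M1 := Rmin_l (Rmin d1 d2) (Rmin d3 (k / 2))).
assert (M2 := Rmin_r (Rmin d1 d2) (Rmin d3 (k / 2))).
assert (M3 := Rmin_l d1 d2); assert (M4 := Rmin_r d1 d2).
assert (M5 := Rmin_l d3 (k/2)); assert (M6 := Rmin_r d3 (k/2)).
assert (K1 : k <= e / 16) by apply Rmin_l; assert (K2 : k <= 1) by apply Rmin_r.
specialize (H1 x ltac:(lra)); specialize (H2 y ltac:(lra)); specialize (H3 y ltac:(lra)).
rewrite exp_0 in H1; rewrite cos_0 in H2; rewrite sin_0 in H3.
set (c := Cmod w) in *.
assert (Hc : c < k / 2) by lra.
assert (X3 : 0 < exp x <= 3).
{ split; [apply exp_pos|]; apply Rle_trans with (exp 1); [|apply exp_le_3].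
  assert (x <= 1) by (apply Rabs_le_between in Hx; lra).
  destruct (Rle_lt_or_eq_dec x 1); [assumption| |subst; lra]; left; apply exp_increasing; lra. }
eapply Rle_trans; [apply Cmod_le_add|].
replace (Re (Cexp w - Cexp 0 - 1 * w)) with ((exp x - 1 - 1 * x) + exp x * (cos y - 1 - 0 * y)).
2:{ rewrite Cexp_0; unfold w, Cexp, Re, RtoC; simpl; ring. }
replace (Im (Cexp w - Cexp 0 - 1 * w)) with (exp x * (sin y - 0 - 1 * y) + (exp x - 1 - 1 * x) * y + x * y).
2:{ rewrite Cexp_0; unfold w, Cexp, Im, RtoC; simpl; ring. }
assert (Px := Rabs_pos x); assert (Py := Rabs_pos y).
assert (A1 : Rabs ((exp x - 1 - 1 * x) + exp x * (cos y - 1 - 0 * y)) <= k * c + 3 * (k * c)).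
{ eapply Rle_trans; [apply Rabs_triang|]; rewrite Rabs_mult, (Rabs_right (exp x)) by lra.
  apply Rplus_le_compat; [nra|]. apply Rmult_le_compat; try lra; try apply Rabs_pos; nra. }
assert (A2 : Rabs (exp x * (sin y - 0 - 1 * y) + (exp x - 1 - 1 * x) * y + x * y) <= 3 * (k * c) + k * c * c + c * c).
{ eapply Rle_trans; [apply Rabs_triang|].
  apply Rplus_le_compat; [eapply Rle_trans; [apply Rabs_triang|]; apply Rplus_le_compat|].
  - rewrite Rabs_mult, (Rabs_right (exp x)) by lra; apply Rmult_le_compat; try lra; try apply Rabs_pos; nra.
  - rewrite Rabs_mult; apply Rmult_le_compat; try apply Rabs_pos; nra.
  - rewrite Rabs_mult; apply Rmult_le_compat; try apply Rabs_pos; lra. }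
assert (0 <= c) by apply Cmod_ge_0.
assert (k * c <= e / 16 * c) by nra.
assert (k * c * c <= k * c * 1) by (apply Rmult_le_compat_l; nra).
assert (c * c <= k / 2 * c) by nra. 
assert (0 <= e * c) by nra; lra.
Qed.

Lemma cder_Cexp z : cder Cexp z (Cexp z).
Proof.
assert (H : cder (fun y => Cexp z * Cexp (y - z))%C z (Cexp z * (1 * (1 - 0)))).
{ apply cder_scal, cder_comp.
  - apply cder_minus; [apply cder_id|apply cder_const].
  - replace (z - z)%C with (RtoC 0) by ring; apply cder_Cexp_0. }
replace (Cexp z * (1 * (1 - 0)))%C with (Cexp z) in H by ring.
revert H; apply cder_ext_loc; apply filter_forall; intros y; rewrite <- Cexp_plus; f_equal; ring.
Qed.


(** * Compactness of closed bounded sets in the plane *)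

Definition Cclosed (K : C -> Prop) : Prop := forall z, ~ K z -> locally z (fun y => ~ K y).

(** The main tool for passing from local to uniform estimates: [Q y e] is an estimate with a gauge
    [e] that may be shrunk, and finitely many local gauges are replaced by one. Points off [K]
    receive discs that miss [K], so that a whole square containing [K] can be covered. *)
Lemma compact_uniform (K : C -> Prop) (M : R) (Q : C -> R -> Prop) :
  (forall z, K z -> Cmod z <= M) -> Cclosed K ->
  (forall y e e', 0 < e' <= e -> Q y e -> Q y e') ->
  (forall z, K z -> exists e, 0 < e /\ locally z (fun y => K y -> Q y e)) ->
  exists e, 0 < e /\ forall y, K y -> Q y e.
Proof.
intros Hb Hcl Hmon Hloc.
(* The factor 2 is there because [compactness_value_2d] yields squares of half side [delta], whose
   points are at distance less than [2 * delta] from the centre. *)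
assert (D : forall u v, exists d : posreal,
  (K (u, v) -> forall y, Cmod (y - (u, v)) < 2 * d -> K y -> Q y d) /\
  (~ K (u, v) -> forall y, Cmod (y - (u, v)) < 2 * d -> ~ K y)).
{ intros u v; destruct (classic (K (u, v))) as [HK|HK].
  - destruct (Hloc _ HK) as [e [He L]]; apply locally_CmodP in L; destruct L as [d [Hd L]].
    assert (P : 0 < Rmin (d / 2) e) by (apply Rmin_pos; lra).
    exists (mkposreal _ P); simpl; split; [|contradiction].
    intros _ y Hy Ky; apply Hmon with e; [split; [exact P|apply Rmin_r]|].
    apply L; [|exact Ky]; assert (B := Rmin_l (d / 2) e); lra.
  - assert (L := Hcl _ HK); apply locally_CmodP in L; destruct L as [d [Hd L]].
    assert (P : 0 < d / 2) by lra.
    exists (mkposreal _ P); simpl; split; [contradiction|].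
    intros _ y Hy; apply L; lra. }
set (delta := fun u v => proj1_sig (constructive_indefinite_description _ (D u v))).
assert (Hdelta : forall u v,
  (K (u, v) -> forall y, Cmod (y - (u, v)) < 2 * delta u v -> K y -> Q y (delta u v)) /\
  (~ K (u, v) -> forall y, Cmod (y - (u, v)) < 2 * delta u v -> ~ K y))
  by (intros u v; exact (proj2_sig (constructive_indefinite_description _ (D u v)))).
destruct (compactness_value_2d (- M) M (- M) M delta) as [d Hd].
exists d; split; [apply cond_pos|].
intros [x y] Ky; apply NNPP; intros HN.
assert (Bx := re_le_Cmod (x, y)); assert (By := im_le_Cmod (x, y)); simpl in Bx, By.
assert (B := Hb _ Ky).
apply Rabs_le_between in Bx; apply Rabs_le_between in By.
apply (Hd x y); [lra|lra|].
intros [u [v [_ [_ [H1 [H2 H3]]]]]]; apply HN.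
assert (L : Cmod ((x, y) - (u, v)) < 2 * delta u v).
{ eapply Rle_lt_trans; [apply Cmod_le_add|]; simpl.
  unfold Rminus in H1, H2; lra. }
destruct (Hdelta u v) as [A1 A2].
destruct (classic (K (u, v))) as [HK|HK].
- apply Hmon with (delta u v); [split; [apply cond_pos|exact H3]|]; apply A1; assumption.
- exfalso; exact (A2 HK _ L Ky).
Qed.

(** Needed to feed closed discs to the properness hypothesis, whose compactness is by open covers.
    The label [None] is given to discs that miss [K]; they contribute no member of the cover. *)
Lemma closed_bounded_compact (K : C -> Prop) (M : R) :
  (forall z, K z -> Cmod z <= M) -> Cclosed K -> compact_set K.
Proof.
intros Hb Hcl I U HU Hcov.
assert (D : forall t : Tn 2 R, exists d : posreal,
  exists oi : option I, forall y, Cmod (y - (fst t, fst (snd t))) < 2 * d -> K y ->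
    match oi with Some i => U i y | None => False end).
{ intros [u [v []]]; simpl; destruct (classic (K (u, v))) as [HK|HK].
  - destruct (Hcov _ HK) as [i Hi].
    assert (L := HU i _ Hi); apply locally_CmodP in L; destruct L as [d [Hd L]].
    assert (P : 0 < d / 2) by lra.
    exists (mkposreal _ P), (Some i); simpl; intros y Hy _; apply L; lra.
  - assert (L := Hcl _ HK); apply locally_CmodP in L; destruct L as [d [Hd L]].
    assert (P : 0 < d / 2) by lra.
    exists (mkposreal _ P), None; simpl; intros y Hy Ky; apply (L y); [lra|exact Ky]. }
set (delta := fun t => proj1_sig (constructive_indefinite_description _ (D t))).
assert (Hdelta : forall t, exists oi : option I, forall y, Cmod (y - (fst t, fst (snd t))) < 2 * delta t -> K y ->
    match oi with Some i => U i y | None => False end)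
  by (intros t; exact (proj2_sig (constructive_indefinite_description _ (D t)))).
apply NNPP; intros HN.
apply (compactness_list 2 (- M, (- M, tt)) (M, (M, tt)) delta).
intros [l Hl]; apply HN.
assert (IL : forall l' : list (Tn 2 R), exists li : list I, forall t y, In t l' ->
   Cmod (y - (fst t, fst (snd t))) < 2 * delta t -> K y -> exists i, In i li /\ U i y).
{ induction l' as [|t l' [li IH]].
  - exists nil; intros t y [].
  - destruct (Hdelta t) as [[i|] Hi].
    + exists (i :: li); intros t' y [<-|H] H1 H2.
      * exists i; split; [left; reflexivity|exact (Hi y H1 H2)].
      * destruct (IH t' y H H1 H2) as [j [A B]]; exists j; split; [right|]; assumption.
    + exists li; intros t' y [<-|H] H1 H2; [destruct (Hi y H1 H2)|exact (IH t' y H H1 H2)]. }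
destruct (IL l) as [li Hli]; exists li; intros [x y] Ky.
assert (Bx := re_le_Cmod (x, y)); assert (By := im_le_Cmod (x, y)); simpl in Bx, By.
assert (B := Hb _ Ky).
apply Rabs_le_between in Bx; apply Rabs_le_between in By.
destruct (Hl (x, (y, tt))) as [t [Ht [_ Hc]]]; [simpl; repeat split; lra|].
apply (Hli t); [exact Ht| |exact Ky].
destruct t as [u [v []]]; simpl in Hc |- *; destruct Hc as [H1 [H2 _]].
eapply Rle_lt_trans; [apply Cmod_le_add|]; simpl; unfold Rminus in H1, H2; lra.
Qed.

Lemma Cclosed_disk c rho : Cclosed (fun z => Cmod (z - c) <= rho).
Proof.
intros z Hz; apply Rnot_le_lt in Hz; apply locally_CmodP; exists (Cmod (z - c) - rho); split; [lra|].
intros y Hy; apply Rlt_not_le.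
assert (T := Cmod_sub_triangle y z c).
replace (z - y)%C with (- (y - z))%C in T by ring; rewrite Cmod_opp in T; lra.
Qed.

Lemma Cclosed_circle c rho : Cclosed (fun z => Cmod (z - c) = rho).
Proof.
intros z Hz; apply locally_CmodP; exists (Rabs (Cmod (z - c) - rho)); split.
{ apply Rabs_pos_lt; lra. }
intros y Hy E; rewrite <- E in Hy.
assert (A := Cmod_sub_le (z - c) (y - c)).
replace (z - c - (y - c))%C with (- (y - z))%C in A by ring; rewrite Cmod_opp in A; lra.
Qed.

Lemma Cmod_bounded_disk c rho z : Cmod (z - c) <= rho -> Cmod z <= rho + Cmod c.
Proof.
intros H; assert (T := Cmod_le_sub c z); lra.
Qed.

(** * Goursat's theorem for rectangles *)

Definition CInt (f : R -> C) (a b : R) : C :=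
  (RInt (fun t => Re (f t)) a b, RInt (fun t => Im (f t)) a b).

Definition continuous_seg (f : R -> C) (a b : R) : Prop :=
  forall t, a <= t <= b -> continuous f t.

Lemma ex_RInt_seg (h : R -> R) a b : a <= b ->
  (forall t, a <= t <= b -> continuous h t) -> ex_RInt h a b.
Proof.
intros Hab H; apply (ex_RInt_continuous (V := R_CompleteNormedModule)); rewrite Rmin_left, Rmax_right by lra; exact H.
Qed.

Section CIntegral.
Variables (a b : R).
Hypothesis Hab : a <= b.

Lemma ex_RInt_Re f : continuous_seg f a b -> ex_RInt (fun t => Re (f t)) a b.
Proof. intros H; apply ex_RInt_seg; auto; intros t Ht; apply continuous_Re, H, Ht. Qed.

Lemma ex_RInt_Im f : continuous_seg f a b -> ex_RInt (fun t => Im (f t)) a b.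
Proof. intros H; apply ex_RInt_seg; auto; intros t Ht; apply continuous_Im, H, Ht. Qed.

Lemma CInt_ext f g : (forall t, a <= t <= b -> f t = g t) -> CInt f a b = CInt g a b.
Proof.
intros H; unfold CInt; f_equal; apply RInt_ext; rewrite Rmin_left, Rmax_right by lra;
  intros t Ht; rewrite H by lra; reflexivity.
Qed.

Lemma CInt_plus f g : continuous_seg f a b -> continuous_seg g a b ->
  CInt (fun t => f t + g t)%C a b = (CInt f a b + CInt g a b)%C.
Proof.
intros Hf Hg; unfold CInt, Cplus; simpl; f_equal.
- apply (RInt_plus (fun t => Re (f t)) (fun t => Re (g t))); apply ex_RInt_Re; assumption.
- apply (RInt_plus (fun t => Im (f t)) (fun t => Im (g t))); apply ex_RInt_Im; assumption.
Qed.

Lemma CInt_scal c f : continuous_seg f a b ->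
  CInt (fun t => c * f t)%C a b = (c * CInt f a b)%C.
Proof.
intros Hf; pose proof (ex_RInt_Re f Hf) as A; pose proof (ex_RInt_Im f Hf) as B.
assert (S : forall k (h : R -> R), ex_RInt h a b -> RInt (fun t => k * h t) a b = k * RInt h a b)
  by (intros k h Hh; exact (RInt_scal (V := R_CompleteNormedModule) h a b k Hh)).
assert (E : forall k (h : R -> R), ex_RInt h a b -> ex_RInt (fun t => k * h t) a b)
  by (intros k h Hh; exact (ex_RInt_scal (V := R_NormedModule) h a b k Hh)).
unfold CInt, Cmult; simpl; f_equal.
- rewrite <- !S by assumption.
  exact (RInt_minus (V := R_CompleteNormedModule) _ _ a b (E _ _ A) (E _ _ B)).
- rewrite <- !S by assumption.
  exact (RInt_plus (V := R_CompleteNormedModule) _ _ a b (E _ _ B) (E _ _ A)).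
Qed.

Lemma CInt_opp f : continuous_seg f a b -> CInt (fun t => - f t)%C a b = (- CInt f a b)%C.
Proof.
intros H; transitivity (CInt (fun t => - (1) * f t)%C a b).
- apply CInt_ext; intros; ring.
- rewrite CInt_scal by exact H; ring.
Qed.

Lemma continuous_seg_opp f : continuous_seg f a b -> continuous_seg (fun t => - f t)%C a b.
Proof. intros H t Ht; apply continuous_Copp, H, Ht. Qed.

Lemma CInt_minus f g : continuous_seg f a b -> continuous_seg g a b ->
  CInt (fun t => f t - g t)%C a b = (CInt f a b - CInt g a b)%C.
Proof.
intros Hf Hg; unfold Cminus at 2; rewrite <- (CInt_opp g) by exact Hg.
apply CInt_plus; [exact Hf|apply continuous_seg_opp, Hg].
Qed.

Lemma CInt_const c : CInt (fun _ => c) a b = (RtoC (b - a) * c)%C.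
Proof.
unfold CInt; rewrite !RInt_const; unfold scal; simpl; unfold mult; simpl.
destruct c; unfold Cmult, RtoC, Re, Im; simpl; f_equal; ring.
Qed.

Lemma RInt_abs_bound (h : R -> R) M : (forall t, a <= t <= b -> continuous h t) ->
  (forall t, a <= t <= b -> Rabs (h t) <= M) -> Rabs (RInt h a b) <= M * (b - a).
Proof.
intros Hc H; eapply Rle_trans; [apply abs_RInt_le; auto; apply ex_RInt_seg; auto|].
replace (M * (b - a)) with (RInt (fun _ => M) a b)
  by (rewrite RInt_const; unfold scal; simpl; unfold mult; simpl; ring).
apply RInt_le; auto.
- apply ex_RInt_seg; auto; intros t Ht; apply (continuous_comp h Rabs); [auto|apply continuous_Rabs].
- apply ex_RInt_const.
- intros t Ht; apply H; lra.
Qed.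

(** The factor 2 comes from bounding real and imaginary parts separately; the uses below tolerate
    the loss. *)
Lemma CInt_bound f M : continuous_seg f a b -> (forall t, a <= t <= b -> Cmod (f t) <= M) ->
  Cmod (CInt f a b) <= 2 * M * (b - a).
Proof using Hab.
intros Hf H; eapply Rle_trans; [apply Cmod_le_add|]; simpl.
assert (A : Rabs (RInt (fun t => Re (f t)) a b) <= M * (b - a)).
{ apply RInt_abs_bound; [intros t Ht; apply continuous_Re, Hf, Ht|].
  intros t Ht; eapply Rle_trans; [apply re_le_Cmod|auto]. }
assert (B : Rabs (RInt (fun t => Im (f t)) a b) <= M * (b - a)).
{ apply RInt_abs_bound; [intros t Ht; apply continuous_Im, Hf, Ht|].
  intros t Ht; eapply Rle_trans; [apply im_le_Cmod|auto]. }
lra.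
Qed.

End CIntegral.

Lemma CInt_Chasles f a b c : a <= b -> b <= c -> continuous_seg f a c ->
  (CInt f a b + CInt f b c = CInt f a c)%C.
Proof.
intros H1 H2 H.
assert (A : continuous_seg f a b) by (intros t Ht; apply H; lra).
assert (B : continuous_seg f b c) by (intros t Ht; apply H; lra).
unfold CInt, Cplus; simpl; f_equal.
- apply (RInt_Chasles (fun t => Re (f t))); apply ex_RInt_Re; auto.
- apply (RInt_Chasles (fun t => Im (f t))); apply ex_RInt_Im; auto.
Qed.

Lemma RInt_affine al be a b : RInt (fun t => al + be * t) a b = al * (b - a) + be * (b * b - a * a) / 2.
Proof.
apply is_RInt_unique.
replace (al * (b - a) + be * (b * b - a * a) / 2)
  with (minus (al * b + be * (b * b) / 2) (al * a + be * (a * a) / 2))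
  by (unfold minus, plus, opp; simpl; field).
apply (is_RInt_derive (fun t => al * t + be * (t * t) / 2)).
- intros x _; auto_derive; [auto|field].
- intros x _; apply continuity_pt_filterlim; reg.
Qed.

(** The integral of [G dz] counterclockwise around the rectangle with lower left corner [(x, y)]:
    bottom minus top, plus [i] times right minus left. *)
Definition rect_int (G : C -> C) (x y w h : R) : C :=
  (CInt (fun t => G (t, y)) x (x + w) - CInt (fun t => G (t, (y + h)%R)) x (x + w)
   + Ci * (CInt (fun t => G ((x + w)%R, t)) y (y + h) - CInt (fun t => G (x, t)) y (y + h)))%C.

Definition in_rect (x y w h : R) (z : C) : Prop :=
  x <= fst z <= x + w /\ y <= snd z <= y + h.

Lemma continuous_hline y x : continuous (fun t : R => (t, y) : C) x.
Proof. apply continuous_ReIm; [apply continuous_id|exact (continuous_const y x)]. Qed.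

Lemma continuous_vline y x : continuous (fun t : R => (x, t) : C) y.
Proof. apply continuous_ReIm; [exact (continuous_const x y)|apply continuous_id]. Qed.

Lemma continuous_hcomp (G : C -> C) y t : continuous G (t, y) -> continuous (fun t => G (t, y)) t.
Proof. intros H; apply (continuous_comp (fun t : R => (t, y) : C) G); [apply continuous_hline|exact H]. Qed.

Lemma continuous_vcomp (G : C -> C) x t : continuous G (x, t) -> continuous (fun t => G (x, t)) t.
Proof. intros H; apply (continuous_comp (fun t : R => (x, t) : C) G); [apply continuous_vline|exact H]. Qed.


Lemma rect_int_split G x y w h : 0 < w -> 0 < h ->
  (forall z, in_rect x y w h z -> continuous G z) ->
  rect_int G x y w h =
   (rect_int G x y (w/2) (h/2) + rect_int G (x + w/2) y (w/2) (h/2)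
   + rect_int G x (y + h/2) (w/2) (h/2) + rect_int G (x + w/2) (y + h/2) (w/2) (h/2))%C.
Proof.
intros Hw Hh Hc; unfold rect_int.
replace (x + w / 2 + w / 2) with (x + w) by field.
replace (y + h / 2 + h / 2) with (y + h) by field.
assert (Hx : forall y', y <= y' <= y + h -> continuous_seg (fun t => G (t, y')) x (x + w)).
{ intros y' Hy' t Ht; apply continuous_hcomp, Hc; split; simpl; lra. }
assert (Hy : forall x', x <= x' <= x + w -> continuous_seg (fun t => G (x', t)) y (y + h)).
{ intros x' Hx' t Ht; apply continuous_vcomp, Hc; split; simpl; lra. }
rewrite <- (CInt_Chasles (fun t => G (t, y)) x (x + w/2) (x + w)) by (try lra; apply Hx; lra).
rewrite <- (CInt_Chasles (fun t => G (t, y + h)) x (x + w/2) (x + w)) by (try lra; apply Hx; lra).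
rewrite <- (CInt_Chasles (fun t => G (x, t)) y (y + h/2) (y + h)) by (try lra; apply Hy; lra).
rewrite <- (CInt_Chasles (fun t => G (x + w, t)) y (y + h/2) (y + h)) by (try lra; apply Hy; lra).
ring.
Qed.

Lemma CInt_affine_h A B y a b : CInt (fun t => A + B * (t, y))%C a b =
  ((A + B * (0, y)) * RtoC (b - a) + B * RtoC ((b * b - a * a) / 2))%C.
Proof.
destruct A as [A1 A2], B as [B1 B2]; unfold CInt.
rewrite (RInt_ext _ (fun t => (A1 - B2 * y) + B1 * t)) by (intros; unfold Re; simpl; ring).
rewrite (RInt_ext (fun t => Im _) (fun t => (A2 + B1 * y) + B2 * t)) by (intros; unfold Im; simpl; ring).
rewrite !RInt_affine; unfold Cmult, Cplus, RtoC; simpl; f_equal; field.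
Qed.

Lemma CInt_affine_v A B x a b : CInt (fun t => A + B * (x, t))%C a b =
  ((A + B * RtoC x) * RtoC (b - a) + B * Ci * RtoC ((b * b - a * a) / 2))%C.
Proof.
destruct A as [A1 A2], B as [B1 B2]; unfold CInt.
rewrite (RInt_ext _ (fun t => (A1 + B1 * x) + - B2 * t)) by (intros; unfold Re; simpl; ring).
rewrite (RInt_ext (fun t => Im _) (fun t => (A2 + B2 * x) + B1 * t)) by (intros; unfold Im; simpl; ring).
rewrite !RInt_affine; unfold Cmult, Cplus, RtoC; simpl; f_equal; field.
Qed.

Lemma rect_int_affine A B x y w h : rect_int (fun z => A + B * z)%C x y w h = 0%C.
Proof.
unfold rect_int; rewrite !CInt_affine_h, !CInt_affine_v.
destruct A as [A1 A2], B as [B1 B2]; unfold Cmult, Cplus, Cminus, Copp, RtoC, Ci; simpl; f_equal; field.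
Qed.

Lemma rect_int_bound G x y w h M : 0 <= w -> 0 <= h ->
  (forall z, in_rect x y w h z -> continuous G z) ->
  (forall z, in_rect x y w h z -> Cmod (G z) <= M) ->
  Cmod (rect_int G x y w h) <= 4 * M * (w + h).
Proof.
intros Hw Hh Hc HM; unfold rect_int.
assert (Hx : forall y', y <= y' <= y + h -> Cmod (CInt (fun t => G (t, y')) x (x + w)) <= 2 * M * w).
{ intros y' Hy'; replace w with (x + w - x) at 2 by ring; apply CInt_bound; [lra| |].
  - intros t Ht; apply continuous_hcomp, Hc; split; simpl; lra.
  - intros t Ht; apply HM; split; simpl; lra. }
assert (Hy : forall x', x <= x' <= x + w -> Cmod (CInt (fun t => G (x', t)) y (y + h)) <= 2 * M * h).
{ intros x' Hx'; replace h with (y + h - y) at 2 by ring; apply CInt_bound; [lra| |].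
  - intros t Ht; apply continuous_vcomp, Hc; split; simpl; lra.
  - intros t Ht; apply HM; split; simpl; lra. }
eapply Rle_trans; [apply Cmod_triangle|]; rewrite Cmod_mult, Cmod_Ci.
assert (T : forall a b, Cmod (a - b) <= Cmod a + Cmod b).
{ intros a b; eapply Rle_trans; [apply Cmod_triangle|]; rewrite Cmod_opp; lra. }
assert (A := T (CInt (fun t => G (t, y)) x (x + w)) (CInt (fun t => G (t, y + h)) x (x + w))).
assert (B := T (CInt (fun t => G (x + w, t)) y (y + h)) (CInt (fun t => G (x, t)) y (y + h))).
assert (H1 := Hx y ltac:(lra)); assert (H2 := Hx (y + h) ltac:(lra)).
assert (H3 := Hy x ltac:(lra)); assert (H4 := Hy (x + w) ltac:(lra)).
lra.
Qed.

(** Affine functions integrate to 0 around a rectangle, so only the deviation from one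
    contributes. *)
Lemma rect_int_near_affine G x y w h A B M : 0 <= w -> 0 <= h ->
  (forall z, in_rect x y w h z -> continuous G z) ->
  (forall z, in_rect x y w h z -> Cmod (G z - (A + B * z)) <= M) ->
  Cmod (rect_int G x y w h) <= 4 * M * (w + h).
Proof.
intros Hw Hh Hc HM.
set (L := fun z => (A + B * z)%C).
assert (HL : forall z, continuous L z).
{ intros z; unfold L; apply continuous_Cplus; [apply continuous_const|].
  apply continuous_Cmult; [apply continuous_const|apply continuous_id]. }
replace (rect_int G x y w h) with (rect_int G x y w h - rect_int L x y w h)%C
  by (unfold L; rewrite rect_int_affine; ring).
assert (E : rect_int (fun z => G z - L z)%C x y w h = (rect_int G x y w h - rect_int L x y w h)%C).
{ unfold rect_int.
  assert (Hx : forall y', y <= y' <= y + h ->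
    CInt (fun t => G (t, y') - L (t, y'))%C x (x + w) =
    (CInt (fun t => G (t, y')) x (x + w) - CInt (fun t => L (t, y')) x (x + w))%C).
  { intros y' Hy'; apply CInt_minus; [lra| |]; intros t Ht; apply continuous_hcomp; auto;
     apply Hc; split; simpl; lra. }
  assert (Hy : forall x', x <= x' <= x + w ->
    CInt (fun t => G (x', t) - L (x', t))%C y (y + h) =
    (CInt (fun t => G (x', t)) y (y + h) - CInt (fun t => L (x', t)) y (y + h))%C).
  { intros x' Hx'; apply CInt_minus; [lra| |]; intros t Ht; apply continuous_vcomp; auto;
     apply Hc; split; simpl; lra. }
  rewrite !Hx, !Hy by lra; ring. }
rewrite <- E.
apply rect_int_bound; [exact Hw|exact Hh| |exact HM].
intros z Hz; apply continuous_Cminus; auto.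
Qed.

(* Bisection: one quarter carries at least a quarter of the boundary integral. *)
Lemma goursat (G : C -> C) (x y w h : R) : 0 < w -> 0 < h ->
  (forall z, in_rect x y w h z -> dif G z) -> rect_int G x y w h = 0%C.
Proof.
intros Hw Hh Hd.
set (p2 := fun n : nat => (/ 2) ^ n).
assert (P2 : forall n, 0 < p2 n) by (intros; apply pow_lt; lra).
assert (P2S : forall n, p2 (S n) = p2 n / 2) by (intros; unfold p2; simpl; field).
set (K := Cmod (rect_int G x y w h)).
set (In := fun n (p : C) => x <= fst p /\ fst p + w * p2 n <= x + w /\ y <= snd p /\ snd p + h * p2 n <= y + h).
(* [p] is the lower left corner of a rectangle of generation [n] whose boundary integral is at least
   [K / 4 ^ n]; here [p2 n] is [1 / 2 ^ n]. *)
set (Bad := fun n (p : C) => In n p /\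
   K * (p2 n * p2 n) <= Cmod (rect_int G (fst p) (snd p) (w * p2 n) (h * p2 n))).
assert (Step : forall n (p : {p | Bad n p}), exists p' : {p | Bad (S n) p},
   fst (proj1_sig p) <= fst (proj1_sig p') /\
   fst (proj1_sig p') + w * p2 (S n) <= fst (proj1_sig p) + w * p2 n /\
   snd (proj1_sig p) <= snd (proj1_sig p') /\
   snd (proj1_sig p') + h * p2 (S n) <= snd (proj1_sig p) + h * p2 n).
{ intros n [[a b] [HI HB]]; simpl in *.
  unfold In in HI; simpl in HI.
  assert (Hpw : 0 < w * p2 n) by (apply Rmult_lt_0_compat; auto).
  assert (Hph : 0 < h * p2 n) by (apply Rmult_lt_0_compat; auto).
  rewrite rect_int_split in HB; auto.
  2:{ simpl; intros z [Hz1 Hz2]; apply dif_continuous, Hd; split; lra. }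
  set (I1 := rect_int G a b (w * p2 n / 2) (h * p2 n / 2)) in *.
  set (I2 := rect_int G (a + w * p2 n / 2) b (w * p2 n / 2) (h * p2 n / 2)) in *.
  set (I3 := rect_int G a (b + h * p2 n / 2) (w * p2 n / 2) (h * p2 n / 2)) in *.
  set (I4 := rect_int G (a + w * p2 n / 2) (b + h * p2 n / 2) (w * p2 n / 2) (h * p2 n / 2)) in *.
  assert (T := Cmod_triangle (I1 + I2 + I3) I4); assert (T' := Cmod_triangle (I1 + I2) I3).
  assert (T'' := Cmod_triangle I1 I2).
  assert (Ew : w * p2 (S n) = w * p2 n / 2) by (rewrite P2S; field).
  assert (Eh : h * p2 (S n) = h * p2 n / 2) by (rewrite P2S; field).
  assert (EK : K * (p2 (S n) * p2 (S n)) = K * (p2 n * p2 n) / 4) by (rewrite P2S; field).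
  assert (C4 : exists s t, (s = 0 \/ s = w * p2 n / 2) /\ (t = 0 \/ t = h * p2 n / 2) /\
     K * (p2 n * p2 n) / 4 <= Cmod (rect_int G (a + s) (b + t) (w * p2 n / 2) (h * p2 n / 2))).
  { destruct (Rle_lt_dec (K * (p2 n * p2 n) / 4) (Cmod I1)) as [H|H1].
    { exists 0, 0; rewrite !Rplus_0_r; auto. }
    destruct (Rle_lt_dec (K * (p2 n * p2 n) / 4) (Cmod I2)) as [H|H2].
    { exists (w * p2 n / 2), 0; rewrite !Rplus_0_r; auto. }
    destruct (Rle_lt_dec (K * (p2 n * p2 n) / 4) (Cmod I3)) as [H|H3].
    { exists 0, (h * p2 n / 2); rewrite !Rplus_0_r; auto. }
    exists (w * p2 n / 2), (h * p2 n / 2); split; [auto|split;[auto|]]; fold I4; lra. }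
  destruct C4 as [s [t [Hs [Ht HK]]]].
  assert (B' : Bad (S n) (a + s, b + t)).
  { split; [unfold In; simpl; rewrite Ew, Eh; destruct Hs, Ht; subst; lra|].
    simpl; rewrite Ew, Eh, EK; exact HK. }
  exists (exist _ _ B'); simpl; rewrite Ew, Eh; destruct Hs, Ht; subst; lra. }
assert (B0 : Bad 0%nat (x, y)).
{ split; [unfold In, p2; simpl; lra|]; unfold p2; simpl; rewrite !Rmult_1_r; unfold K; lra. }
set (seqp := fix F (n : nat) : {p | Bad n p} :=
  match n with
  | O => exist _ _ B0
  | S m => proj1_sig (constructive_indefinite_description _ (Step m (F m)))
  end).
set (P := fun n => proj1_sig (seqp n)).
assert (HB : forall n, Bad n (P n)) by (intros n; exact (proj2_sig (seqp n))).
assert (HS : forall n, fst (P n) <= fst (P (S n)) /\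
   fst (P (S n)) + w * p2 (S n) <= fst (P n) + w * p2 n /\
   snd (P n) <= snd (P (S n)) /\ snd (P (S n)) + h * p2 (S n) <= snd (P n) + h * p2 n)
  by (intros n; exact (proj2_sig (constructive_indefinite_description _ (Step n (seqp n))))).
(* Nested intervals, applied to the two coordinates of the corners; the resulting point lies in
   every chosen rectangle. *)
assert (Hlim : forall (c : nat -> R) (k : R), 0 < k ->
  (forall n, c n <= c (S n) /\ c (S n) + k * p2 (S n) <= c n + k * p2 n) ->
  exists X, forall n, c n <= X <= c n + k * p2 n).
{ clear - P2; intros c k Hk Hc.
  assert (Mon : forall n m, c n <= c (n + m)%nat /\ c (n + m)%nat + k * p2 (n + m)%nat <= c n + k * p2 n).
  { intros n; induction m; [rewrite Nat.add_0_r; lra|].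
    rewrite Nat.add_succ_r; destruct (Hc (n + m)%nat); lra. }
  assert (Cross : forall n m, c m <= c n + k * p2 n).
  { intros n m; destruct (Nat.le_ge_cases n m) as [H|H].
    - replace m with (n + (m - n))%nat by lia; destruct (Mon n (m - n)%nat) as [_ A].
      assert (B := P2 (n + (m - n))%nat); nra.
    - replace n with (m + (n - m))%nat by lia; destruct (Mon m (n - m)%nat) as [A _].
      assert (B := P2 (m + (n - m))%nat); nra. }
  destruct (completeness (fun v => exists n, v = c n)) as [X [HX1 HX2]].
  - exists (c 0%nat + k * p2 0%nat); intros v [n ->]; apply Cross.
  - exists (c 0%nat); eauto.
  - exists X; intros n; split; [apply HX1; eauto|].
    apply HX2; intros v [m ->]; apply Cross. }
destruct (Hlim (fun n => fst (P n)) w Hw) as [X HX]; [intros n; destruct (HS n); tauto|].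
destruct (Hlim (fun n => snd (P n)) h Hh) as [Y HY]; [intros n; destruct (HS n); tauto|].
assert (Hin : in_rect x y w h (X, Y)).
{ destruct (HB 0%nat) as [HI _]; specialize (HX 0%nat); specialize (HY 0%nat).
  unfold In in HI; unfold in_rect; simpl; lra. }
destruct (Hd _ Hin) as [l Hl].
assert (Main : forall e, 0 < e -> K <= e).
{ intros e He.
  (* Diameter and perimeter both shrink like [p2 n], so the boundary integral is at most
     [4 * e' * (w + h) ^ 2 * p2 n ^ 2]; this choice makes it [e / 2 * p2 n ^ 2], to be compared with
     the lower bound in [Bad]. *)
  set (e' := e / (8 * (w + h) * (w + h))).
  assert (He' : 0 < e') by (apply Rdiv_lt_0_compat; [lra|nra]).
  assert (L := proj1 (cderP _ _ _) Hl e' He'); apply locally_CmodP in L.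
  destruct L as [d [Hd0 L]].
  assert (Hn : exists n, (w + h) * p2 n < d).
  { destruct (pow_lt_1_zero (/2)) with (y := d / (w + h)) as [n Hn].
    - rewrite Rabs_right; lra.
    - apply Rdiv_lt_0_compat; lra.
    - exists n; specialize (Hn n ltac:(lia)); fold (p2 n) in Hn.
      rewrite Rabs_right in Hn by (left; apply P2).
      apply Rmult_lt_compat_l with (r := w + h) in Hn; [|lra].
      replace ((w + h) * (d / (w + h))) with d in Hn by (field; lra); exact Hn. }
  destruct Hn as [n Hn].
  destruct (HB n) as [HI HK]; unfold In in HI.
  assert (Pn := P2 n).
  assert (Hpw : 0 < w * p2 n) by (apply Rmult_lt_0_compat; auto).
  assert (Hph : 0 < h * p2 n) by (apply Rmult_lt_0_compat; auto).
  assert (Bd : Cmod (rect_int G (fst (P n)) (snd (P n)) (w * p2 n) (h * p2 n))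
     <= 4 * (e' * ((w + h) * p2 n)) * (w * p2 n + h * p2 n)).
  { apply rect_int_near_affine with (A := (G (X, Y) - l * (X, Y))%C) (B := l); try lra.
    - intros z [Hz1 Hz2]; apply dif_continuous, Hd; split; lra.
    - intros z [Hz1 Hz2].
      replace (G z - (G (X, Y) - l * (X, Y) + l * z))%C with (G z - G (X, Y) - l * (z - (X, Y)))%C by ring.
      assert (Hz : Cmod (z - (X, Y)) <= (w + h) * p2 n).
      { eapply Rle_trans; [apply Cmod_le_add|]; destruct z as [z1 z2]; simpl in *.
        specialize (HX n); specialize (HY n); simpl in HX, HY.
        rewrite Rmult_plus_distr_r; apply Rplus_le_compat; apply Rabs_le; lra. }
      eapply Rle_trans; [apply L; lra|].
      apply Rmult_le_compat_l; lra. }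
  assert (Q : K * (p2 n * p2 n) <= e / 2 * (p2 n * p2 n)).
  { eapply Rle_trans; [exact HK|]; eapply Rle_trans; [exact Bd|].
    unfold e'; apply Req_le; field; lra. }
  apply Rmult_le_reg_r in Q; [lra|nra]. }
assert (HK : K <= 0) by (apply le_epsilon; intros e He; rewrite Rplus_0_l; apply Main; exact He).
apply Cmod_eq_0; apply Rle_antisym; [exact HK|apply Cmod_ge_0].
Qed.

(** * Circle means and Cauchy's formula *)

Definition cis (t : R) : C := Cexp (Ci * RtoC t).

Lemma cisE t : cis t = (cos t, sin t).
Proof.
unfold cis, Cexp, Ci, Cmult, RtoC, Re, Im; simpl.
replace (0 * t - 1 * 0) with 0 by ring; replace (0 * 0 + 1 * t) with t by ring.
rewrite exp_0; f_equal; ring.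
Qed.

Lemma Cmod_cis t : Cmod (cis t) = 1.
Proof.
unfold cis; rewrite Cmod_Cexp; unfold Ci, Cmult, RtoC, Re; simpl.
replace (0 * t - 1 * 0) with 0 by ring; apply exp_0.
Qed.

Lemma Cexp_pair x t : Cexp (x, t) = (RtoC (exp x) * cis t)%C.
Proof. rewrite cisE; unfold Cexp, Cmult, RtoC, Re, Im; simpl; f_equal; ring. Qed.

Lemma continuous_cis t : continuous cis t.
Proof.
apply (continuous_Cexp (fun t => Ci * RtoC t)%C), continuous_Cmult; [apply continuous_const|].
apply (continuous_RtoC (fun t : R => t)), continuous_id.
Qed.

Lemma Cmod_circle a s t : 0 <= s -> Cmod (a + RtoC s * cis t - a) = s.
Proof.
intros Hs; replace (a + RtoC s * cis t - a)%C with (RtoC s * cis t)%C by ring.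
rewrite Cmod_mult, Cmod_cis, Cmod_R, Rabs_right; lra.
Qed.

Lemma continuous_circle a s t : continuous (fun t => a + RtoC s * cis t)%C t.
Proof.
apply continuous_Cplus; [apply continuous_const|].
apply continuous_Cmult; [apply continuous_const|apply continuous_cis].
Qed.

(** Not divided by [2 * PI]. Since [dz = i * (z - a) * dt] on the circle, this is the contour
    integral of [g z / (i * (z - a))]. *)
Definition avg (g : C -> C) (a : C) (s : R) : C :=
  CInt (fun t => g (a + RtoC s * cis t)%C) 0 (2 * PI).

Lemma twoPI_pos : 0 < 2 * PI.
Proof. assert (H := PI_RGT_0); lra. Qed.
#[local] Hint Resolve twoPI_pos : core.
Lemma twoPI_nonneg : 0 <= 2 * PI.
Proof. left; auto. Qed.
#[local] Hint Resolve twoPI_nonneg : core.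

Lemma circle_seg g a s x y : 0 <= s -> (forall z, Cmod (z - a) = s -> continuous g z) ->
  continuous_seg (fun t => g (a + RtoC s * cis t)%C) x y.
Proof.
intros Hs H t _; apply (continuous_comp (fun t => a + RtoC s * cis t)%C g).
- apply continuous_circle.
- apply H, Cmod_circle, Hs.
Qed.

Lemma avg_ext g g' a s : 0 <= s -> (forall z, Cmod (z - a) = s -> g z = g' z) -> avg g a s = avg g' a s.
Proof. intros Hs H; apply CInt_ext; auto; intros t _; apply H, Cmod_circle, Hs. Qed.

Lemma avg_bound g a s M : 0 <= s -> (forall z, Cmod (z - a) = s -> continuous g z) ->
  (forall z, Cmod (z - a) = s -> Cmod (g z) <= M) -> Cmod (avg g a s) <= 4 * PI * M.
Proof.
intros Hs H HM; unfold avg; eapply Rle_trans.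
- apply CInt_bound with (M := M); auto; [apply circle_seg; auto|].
  intros t _; apply HM, Cmod_circle, Hs.
- lra.
Qed.

Lemma avg_const_lt g a s0 s1 : 0 < s0 < s1 ->
  (forall z, s0 <= Cmod (z - a) <= s1 -> dif g z) -> avg g a s0 = avg g a s1.
Proof.
intros [H0 H1] H.
set (G := fun w => g (a + Cexp w)%C).
assert (Hl : ln s0 < ln s1) by (apply ln_increasing; lra).
assert (R0 : rect_int G (ln s0) 0 (ln s1 - ln s0) (2 * PI) = 0%C).
{ apply goursat; [lra|auto|].
  intros [x y] [Hx _]; simpl in Hx.
  apply (dif_comp g (fun w => a + Cexp w)%C).
  - apply dif_plus; [apply dif_const|]; eexists; apply cder_Cexp.
  - apply H; replace (a + Cexp (x, y) - a)%C with (Cexp (x, y)) by ring.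
    rewrite Cmod_Cexp; simpl; rewrite <- (exp_ln s0), <- (exp_ln s1) by lra.
    split; [destruct (proj1 Hx) as [L|E]|destruct (proj2 Hx) as [L|E]];
      try (left; apply exp_increasing; lra); right; f_equal; lra. }
unfold rect_int in R0.
(* The horizontal sides of the rectangle carry the same integrand, by the period of the exponential,
   and cancel; the vertical sides are the two circle integrals. *)
rewrite (CInt_ext (ln s0) (ln s0 + (ln s1 - ln s0)) ltac:(lra) (fun t => G (t, (0 + 2 * PI)%R)) (fun t => G (t, 0))) in R0.
2:{ intros t _; unfold G; rewrite !Cexp_pair, !cisE, Rplus_0_l, cos_2PI, sin_2PI, cos_0, sin_0; reflexivity. }
replace (ln s0 + (ln s1 - ln s0)) with (ln s1) in R0 by ring.
rewrite Rplus_0_l in R0.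
assert (E : forall s, 0 < s -> CInt (fun t => G (ln s, t)) 0 (2 * PI) = avg g a s).
{ intros s Hs; apply CInt_ext; auto; intros t _; unfold G; rewrite Cexp_pair, exp_ln by exact Hs; reflexivity. }
rewrite !E in R0 by lra.
set (A := CInt _ (ln s0) (ln s1)) in R0.
assert (Z : (avg g a s1 - avg g a s0 = 0)%C).
{ replace (avg g a s1 - avg g a s0)%C with (- Ci * (A - A + Ci * (avg g a s1 - avg g a s0)))%C.
  - rewrite R0; ring.
  - transitivity (- (Ci * Ci) * (avg g a s1 - avg g a s0))%C; [ring|].
    replace (Ci * Ci)%C with (- (1))%C by (unfold Ci, Cmult, Copp, RtoC; simpl; f_equal; ring); ring. }
replace (avg g a s1) with (avg g a s1 - avg g a s0 + avg g a s0)%C by ring.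
rewrite Z; ring.
Qed.

Lemma avg_const g a r R s0 s1 : 0 <= r -> (forall z, r < Cmod (z - a) < R -> dif g z) ->
  r < s0 < R -> r < s1 < R -> avg g a s0 = avg g a s1.
Proof.
intros Hr H H0 H1; destruct (Rtotal_order s0 s1) as [L|[->|L]]; [|reflexivity|symmetry];
  apply avg_const_lt; try lra; intros z Hz; apply H; lra.
Qed.

Lemma circle_uniform g a s e : 0 < s -> (forall z, Cmod (z - a) = s -> continuous g z) -> 0 < e ->
  exists d, 0 < d /\ forall s' z, Cmod (z - a) = s -> Rabs (s' - s) < d ->
    Cmod (g (a + RtoC (s' / s) * (z - a)) - g z)%C < e.
Proof.
intros Hs H He.
destruct (compact_uniform (fun z => Cmod (z - a) = s) (s + Cmod a)
  (fun z d => forall s', Rabs (s' - s) < d -> Cmod (g (a + RtoC (s' / s) * (z - a)) - g z)%C < e))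
  as [d [Hd Q]].
- intros z Hz; apply Cmod_bounded_disk; lra.
- apply Cclosed_circle.
- intros y d d' Hd Q s' Hs'; apply Q; lra.
- intros z Hz.
  destruct (proj1 (locally_CmodP _ _) (proj1 (continuous_CmodP _ _) (H z Hz) (e / 2) ltac:(lra)))
    as [d [Hd L]].
  exists (d / 2); split; [lra|]; apply locally_CmodP; exists (d / 2); split; [lra|].
  intros y Hy Ky s' Hs'.
  assert (A := L y ltac:(lra)).
  assert (B : Cmod (g (a + RtoC (s' / s) * (y - a)) - g z)%C < e / 2).
  { apply L.
    replace (a + RtoC (s' / s) * (y - a) - z)%C with (RtoC ((s' - s) / s) * (y - a) + (y - z))%C.
    - eapply Rle_lt_trans; [apply Cmod_triangle|]; rewrite Cmod_mult, Ky, Cmod_R.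
      rewrite Rabs_div, (Rabs_right s) by lra.
      replace (Rabs (s' - s) / s * s) with (Rabs (s' - s)) by (field; lra); lra.
    - replace ((s' - s) / s) with (s' / s - 1) by (field; lra); rewrite RtoC_minus; ring. }
  replace (g (a + RtoC (s' / s) * (y - a)) - g y)%C
    with (g (a + RtoC (s' / s) * (y - a)) - g z + - (g y - g z))%C by ring.
  eapply Rle_lt_trans; [apply Cmod_triangle|]; rewrite Cmod_opp; lra.
- exists d; split; [exact Hd|]; intros s' z Hz Hs'; exact (Q z Hz s' Hs').
Qed.

(** Only continuity of [g] is asked: this carries the mean across a radius at which
    differentiability may fail at one point of the circle. *)
Lemma avg_continuous g a r R s e : 0 <= r < s -> s < R ->
  (forall z, r < Cmod (z - a) < R -> continuous g z) -> 0 < e ->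
  exists d, 0 < d /\ forall s', r < s' < R -> Rabs (s' - s) < d -> Cmod (avg g a s' - avg g a s) <= e.
Proof.
intros Hr HR H He.
assert (HP := twoPI_pos).
destruct (circle_uniform g a s (e / (4 * PI))) as [d [Hd Q]]; [lra| | |].
{ intros z Hz; apply H; lra. }
{ apply Rdiv_lt_0_compat; lra. }
exists d; split; [exact Hd|]; intros s' Hs' Hd'.
unfold avg; rewrite <- CInt_minus; auto; try (apply circle_seg; [lra|intros z Hz; apply H; lra]).
eapply Rle_trans; [apply CInt_bound with (M := e / (4 * PI)); auto|].
- intros t Ht; apply continuous_Cminus; apply (circle_seg g a _ 0 (2*PI)); auto; try lra;
   intros z Hz; apply H; lra.
- intros t _; left.
  replace (a + RtoC s' * cis t)%C with (a + RtoC (s' / s) * (a + RtoC s * cis t - a))%C.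
  + apply Q; [apply Cmod_circle; lra|exact Hd'].
  + replace (RtoC s') with (RtoC (s' / s) * RtoC s)%C by (rewrite <- RtoC_mult; f_equal; field; lra); ring.
- apply Req_le; field; lra.
Qed.

Lemma Cmod_le_eps (c : C) : (forall e, 0 < e -> Cmod c <= e) -> c = 0%C.
Proof.
intros H; apply Cmod_eq_0, Rle_antisym; [|apply Cmod_ge_0].
apply le_epsilon; intros e He; rewrite Rplus_0_l; apply H, He.
Qed.

(** The mean does not depend on the radius, and the integrand tends uniformly to 1 as the radius
    grows. *)
Lemma avg_kernel a b s : Cmod (b - a) < s -> avg (fun z => (z - a) / (z - b))%C a s = RtoC (2 * PI).
Proof.
intros Hs; assert (HP := twoPI_pos); assert (Hb := Cmod_ge_0 (b - a)).
set (k := fun z => ((z - a) / (z - b))%C).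
assert (Hnz : forall z, Cmod (b - a) < Cmod (z - a) -> (z - b)%C <> 0%C).
{ intros z Hz; apply Csub_neq; intros ->; lra. }
assert (Hk : forall z, Cmod (b - a) < Cmod (z - a) -> dif k z).
{ intros z Hz; apply dif_div; auto using dif_sub_const. }
set (A := avg k a s).
assert (Z : (A - RtoC (2 * PI) = 0)%C).
{ apply Cmod_le_eps; intros e He.
  (* The integrand differs from 1 by at most [Cmod (b - a) / (s' - Cmod (b - a))]; this radius makes
     the resulting error at most [e]. *)
  set (s' := s + 4 * PI * Cmod (b - a) / e).
  assert (Q0 : 0 <= 4 * PI * Cmod (b - a) / e) by (apply Rle_mult_inv_pos; [apply Rmult_le_pos; lra|lra]).
  assert (Hs' : s <= s') by (unfold s'; lra).
  unfold A; rewrite (avg_const k a (Cmod (b - a)) (s' + 1) s s') by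
    (try lra; intros z Hz; apply Hk; lra).
  assert (E : RtoC (2 * PI) = avg (fun _ => RtoC 1) a s').
  { unfold avg; rewrite CInt_const; rewrite Rminus_0_r; ring. }
  rewrite E; unfold avg; rewrite <- CInt_minus; auto.
  2:{ apply circle_seg; [lra|]; intros z Hz; apply dif_continuous, Hk; lra. }
  2:{ intros t _; apply continuous_const. }
  eapply Rle_trans; [apply (avg_bound (fun z => k z - 1)%C a s' (Cmod (b - a) / (s' - Cmod (b - a)))); try lra|].
  - intros z Hz; apply continuous_Cminus; [apply dif_continuous, Hk; lra|apply continuous_const].
  - intros z Hz; unfold k.
    assert (N : (z - b)%C <> 0%C) by (apply Hnz; lra).
    replace ((z - a) / (z - b) - 1)%C with ((b - a) / (z - b))%C by (field; exact N).
    rewrite Cmod_div by exact N.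
    apply Rmult_le_compat_l; [exact Hb|].
    apply Rinv_le_contravar; [lra|].
    assert (T := Cmod_sub_triangle b z a); lra.
  - unfold Rdiv; rewrite <- Rmult_assoc.
    apply Rmult_le_reg_r with (s' - Cmod (b - a)); [lra|].
    rewrite Rmult_assoc, Rinv_l, Rmult_1_r by lra.
    assert (4 * PI * Cmod (b - a) = e * (s' - s)) by (unfold s'; field; lra).
    rewrite H; apply Rmult_le_compat_l; lra. }
fold k; change (avg k a s) with A.
replace A with (A - RtoC (2 * PI) + RtoC (2 * PI))%C by ring; rewrite Z; ring.
Qed.

Section Cauchy.
Variables (f : C -> C) (a : C) (R : R).
Hypothesis Hc : forall z, Cmod (z - a) < R -> continuous f z.
Hypothesis Hd : forall z, 0 < Cmod (z - a) < R -> dif f z.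

(** The mean may be evaluated on arbitrarily small circles, where continuity at the centre makes it
    small. *)
Lemma avg_zero_of_center g s : (forall z, 0 < Cmod (z - a) < s -> dif g z) -> continuous g a -> g a = 0%C ->
  forall s', 0 < s' < s -> avg g a s' = 0%C.
Proof.
intros Hg Hga Ha s' Hs'; apply Cmod_le_eps; intros e He; assert (HP := twoPI_pos).
destruct (proj1 (locally_CmodP _ _) (proj1 (continuous_CmodP _ _) Hga (e / (4 * PI))
  ltac:(apply Rdiv_lt_0_compat; lra))) as [d [Hd0 L]].
set (x := Rmin (d / 2) s').
assert (Hx : 0 < x <= d / 2 /\ x <= s').
{ split; [split; [apply Rmin_pos; lra|apply Rmin_l]|apply Rmin_r]. }
rewrite (avg_const g a 0 s s' x); try lra; [|exact Hg].
replace e with (4 * PI * (e / (4 * PI))) by (field; lra).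
apply avg_bound; [lra| |].
- intros z Hz; apply dif_continuous, Hg; lra.
- intros z Hz; left; assert (B := L z ltac:(lra)); rewrite Ha in B.
  replace (g z) with (g z - 0)%C by ring; exact B.
Qed.

(** The integrand is differentiable off [a] and [b]. For radii below [Cmod (b - a)] the mean is 0 by
    shrinking the circle, for radii above it is constant, and continuity in the radius joins both
    ranges at the circle through [b]. *)
Lemma cauchy_diff_quotient (b : C) (phi : C -> C) s : Cmod (b - a) < s < R -> b <> a -> continuous phi b ->
  (forall y, f y = f b + phi y * (y - b))%C ->
  avg (fun z => phi z * (z - a))%C a s = 0%C.
Proof.
intros Hs Hba Hphi HE.
assert (Hrho : 0 < Cmod (b - a)) by (apply Cmod_gt_0, Csub_neq, Hba).
set (rho := Cmod (b - a)) in *.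
set (g := fun z => (phi z * (z - a))%C).
assert (Hphi' : forall z, z <> b -> phi z = ((f z - f b) / (z - b))%C).
{ intros z Hz; rewrite (HE z) at 1; field; apply Csub_neq, Hz. }
assert (Hloc : forall z, z <> b -> locally z (fun y => ((f y - f b) / (y - b))%C = phi y)).
{ intros z Hz.
  assert (N := locally_neq0 (fun y => y - b)%C z (dif_continuous _ _ (dif_sub_const b z)) (Csub_neq _ _ Hz)).
  generalize N; apply filter_imp; intros y Hy; symmetry; apply Hphi'; intros ->; apply Hy; ring. }
assert (Hgd : forall z, 0 < Cmod (z - a) < R -> z <> b -> dif g z).
{ intros z Hz Hzb; apply dif_mult; [|apply dif_sub_const].
  apply (dif_ext_loc _ _ _ (Hloc z Hzb)).
  apply dif_div; [apply dif_minus; [auto|apply dif_const]|apply dif_sub_const|apply Csub_neq, Hzb]. }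
assert (Hgc : forall z, Cmod (z - a) < R -> continuous g z).
{ intros z Hz; apply continuous_Cmult; [|apply dif_continuous, dif_sub_const].
  destruct (Ceq_dec z b) as [->|Hzb]; [exact Hphi|].
  apply (continuous_ext_loc _ _ _ (Hloc z Hzb)).
  apply continuous_Cdiv; [apply continuous_Cminus; [auto|apply continuous_const]
    |apply dif_continuous, dif_sub_const|apply Csub_neq, Hzb]. }
assert (In0 : forall s', 0 < s' < rho -> avg g a s' = 0%C).
{ apply avg_zero_of_center.
  - intros z Hz; apply Hgd; [lra|]; intros ->; unfold rho in Hz; lra.
  - apply Hgc; replace (a - a)%C with (RtoC 0) by ring; rewrite Cmod_0; lra.
  - unfold g; replace (a - a)%C with (RtoC 0) by ring; ring. }
assert (Cont : forall e, 0 < e -> exists d, 0 < d /\ forall s', 0 < s' < R -> Rabs (s' - rho) < d ->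
   Cmod (avg g a s' - avg g a rho) <= e).
{ intros e He; apply avg_continuous with (r := 0); try lra; intros z Hz; apply Hgc; lra. }
assert (Z1 : avg g a rho = 0%C).
{ apply Cmod_le_eps; intros e He; destruct (Cont e He) as [d [Hd0 L]].
  set (x := Rmin (d / 2) (rho / 2)).
  assert (Hx : 0 < x <= d / 2 /\ x <= rho / 2).
  { split; [split; [apply Rmin_pos; lra|apply Rmin_l]|apply Rmin_r]. }
  assert (B := L (rho - x) ltac:(lra)).
  rewrite In0 in B by lra; replace (0 - avg g a rho)%C with (- avg g a rho)%C in B by ring.
  rewrite Cmod_opp in B; apply B; apply Rabs_def1; lra. }
apply Cmod_le_eps; intros e He; destruct (Cont e He) as [d [Hd0 L]].
set (x := Rmin (d / 2) ((s - rho) / 2)).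
assert (Hx : 0 < x <= d / 2 /\ x <= (s - rho) / 2).
{ split; [split; [apply Rmin_pos; lra|apply Rmin_l]|apply Rmin_r]. }
assert (B := L (rho + x) ltac:(lra)).
rewrite Z1, (avg_const g a rho R (rho + x) s) in B; try lra.
- replace (avg g a s - 0)%C with (avg g a s) in B by ring; apply B; apply Rabs_def1; lra.
- intros z Hz; apply Hgd; [lra|]; intros ->; unfold rho in Hz; lra.
Qed.

(** Subtracting [f b] times the kernel leaves the difference quotient of [f] at [b] times [z - a],
    whose mean is 0. Asking only continuity at [a] makes the formula serve for removable
    singularities too. *)
Lemma cauchy_formula b s : Cmod (b - a) < s < R ->
  avg (fun z => f z * ((z - a) / (z - b)))%C a s = (RtoC (2 * PI) * f b)%C.
Proof.
intros Hs; assert (Hb0 := Cmod_ge_0 (b - a)).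
assert (N : forall z, Cmod (z - a) = s -> (z - b)%C <> 0%C).
{ intros z Hz; apply Csub_neq; intros ->; lra. }
assert (Hk : forall z, Cmod (z - a) = s -> continuous (fun z => (z - a) / (z - b))%C z).
{ intros z Hz; apply continuous_Cdiv; auto using dif_continuous, dif_sub_const. }
assert (Red : forall g : C -> C, (forall z, Cmod (z - a) = s -> continuous g z) -> avg g a s = 0%C ->
   (forall z, Cmod (z - a) = s -> g z = (f z - f b) * ((z - a) / (z - b)))%C ->
   avg (fun z => f z * ((z - a) / (z - b)))%C a s = (RtoC (2 * PI) * f b)%C).
{ intros g Hg H0 E.
  rewrite (avg_ext _ (fun z => g z + f b * ((z - a) / (z - b)))%C) by
    (try lra; intros z Hz; rewrite E by exact Hz; ring).
  unfold avg; rewrite CInt_plus, CInt_scal; auto.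
  - change (avg g a s + f b * avg (fun z => (z - a) / (z - b)) a s = RtoC (2 * PI) * f b)%C.
    rewrite H0, avg_kernel by lra; ring.
  - apply (circle_seg (fun z => (z - a) / (z - b))%C); [lra|exact Hk].
  - apply circle_seg; [lra|exact Hg].
  - intros t Ht; apply continuous_Cmult; [apply continuous_const|].
    apply (circle_seg (fun z => (z - a) / (z - b))%C a s 0 (2 * PI)); [lra|exact Hk|exact Ht]. }
destruct (Ceq_dec b a) as [->|Hba].
- apply (Red (fun z => f z - f a)%C).
  + intros z Hz; apply continuous_Cminus; [apply Hc; lra|apply continuous_const].
  + apply avg_zero_of_center with R; [|apply continuous_Cminus; [apply Hc; lra|apply continuous_const]|ring|lra].
    intros z Hz; apply dif_minus; [auto|apply dif_const].
  + intros z Hz; field; apply N, Hz.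
- destruct (Hd b) as [l [phi [Hphi [_ HE]]]]; [split; [apply Cmod_gt_0, Csub_neq, Hba|lra]|].
  apply (Red (fun z => phi z * (z - a))%C).
  + intros z Hz; apply continuous_Cmult; [|apply dif_continuous, dif_sub_const].
    apply continuous_ext_loc with (fun y => (f y - f b) / (y - b))%C.
    * assert (L := locally_neq0 (fun y => y - b)%C z (dif_continuous _ _ (dif_sub_const b z)) (N z Hz)).
      generalize L; apply filter_imp; intros y Hy; rewrite (HE y) at 1; change (@eq C ((f b + phi y * (y - b) - f b) / (y - b))%C (phi y)); field; exact Hy.
    * apply continuous_Cdiv; [apply continuous_Cminus; [apply Hc; lra|apply continuous_const]
       |apply dif_continuous, dif_sub_const|apply N, Hz].
  + apply cauchy_diff_quotient with b; auto.
  + intros z Hz; rewrite (HE z); field; apply N, Hz.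
Qed.

End Cauchy.

(** * Differentiation under the integral, regularity and orders of zeros *)

Lemma CInt_param_cder (k : R -> C -> C) (k' : R -> C) b A d x y :
  x <= y -> 0 < d -> 0 <= A ->
  (forall b', Cmod (b' - b) < d -> continuous_seg (fun t => k t b') x y) ->
  continuous_seg k' x y ->
  (forall t b', x <= t <= y -> Cmod (b' - b) < d ->
     Cmod (k t b' - k t b - k' t * (b' - b)) <= A * Cmod (b' - b) ^ 2) ->
  cder (fun b => CInt (fun t => k t b) x y) b (CInt k' x y).
Proof.
intros Hxy Hd HA Hc Hc' HB; apply cderP; intros e He.
set (L := 2 * A * (y - x) + 1).
assert (HL : 0 < L) by (unfold L; nra).
apply locally_CmodP; exists (Rmin d (e / L)); split.
{ apply Rmin_pos; [exact Hd|apply Rdiv_lt_0_compat; lra]. }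
intros b' Hb'.
assert (H1 : Cmod (b' - b) < d) by (eapply Rlt_le_trans; [exact Hb'|apply Rmin_l]).
assert (H2 : Cmod (b' - b) < e / L) by (eapply Rlt_le_trans; [exact Hb'|apply Rmin_r]).
assert (Hb : Cmod (b - b) < d) by (replace (b - b)%C with (RtoC 0) by ring; rewrite Cmod_0; exact Hd).
assert (E : (CInt (fun t => k t b') x y - CInt (fun t => k t b) x y - CInt k' x y * (b' - b))%C
  = CInt (fun t => k t b' - k t b - (b' - b) * k' t)%C x y).
{ rewrite (CInt_minus x y Hxy (fun t => k t b' - k t b)%C), (CInt_minus x y Hxy (fun t => k t b')), CInt_scal; auto; [ring| |].
  - intros t Ht; apply continuous_Cminus; [apply (Hc b' H1 t Ht)|apply (Hc b Hb t Ht)].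
  - intros t Ht; apply continuous_Cmult; [apply continuous_const|apply Hc', Ht]. }
rewrite E; eapply Rle_trans.
- apply CInt_bound with (M := A * Cmod (b' - b) ^ 2); [exact Hxy| |].
  + intros t Ht; apply continuous_Cminus; [apply continuous_Cminus; [apply (Hc b' H1 t Ht)|apply (Hc b Hb t Ht)]|].
    apply continuous_Cmult; [apply continuous_const|apply Hc', Ht].
  + intros t Ht; rewrite (Cmult_comm (b' - b)); apply HB; assumption.
- set (c := Cmod (b' - b)) in *; assert (Hc0 : 0 <= c) by apply Cmod_ge_0.
  assert (L * c <= e).
  { apply Rmult_lt_compat_l with (r := L) in H2; [|exact HL].
    replace (L * (e / L)) with e in H2 by (field; lra); lra. }
  replace (2 * (A * c ^ 2) * (y - x)) with ((2 * A * (y - x)) * c * c) by ring.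
  apply Rmult_le_compat_r; [exact Hc0|]; unfold L in *; nra.
Qed.

Section Cauchy_transform.
Variables (K c : R -> C) (x y m M : R) (b : C).
Hypotheses (Hxy : x <= y) (Hm : 0 < m) (HK : continuous_seg K x y) (Hc : continuous_seg c x y)
  (HM : forall t, x <= t <= y -> Cmod (K t) <= M)
  (Hmc : forall t, x <= t <= y -> m <= Cmod (c t - b)).

Lemma transform_far t b' : x <= t <= y -> Cmod (b' - b) < m / 2 -> m / 2 <= Cmod (c t - b').
Proof.
intros Ht Hb; assert (A := Hmc t Ht).
assert (T := Cmod_sub_triangle b' (c t) b); lra.
Qed.

Lemma transform_neq t b' : x <= t <= y -> Cmod (b' - b) < m / 2 -> (c t - b')%C <> 0%C.
Proof. intros Ht Hb; apply Cmod_gt_0; assert (A := transform_far t b' Ht Hb); lra. Qed.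

Lemma transform_cont b' k : Cmod (b' - b) < m / 2 -> continuous_seg (fun t => K t / (c t - b') ^ k)%C x y.
Proof.
intros Hb t Ht; apply continuous_Cdiv; [apply HK, Ht| |].
- apply (continuous_Cpow (fun t => c t - b')%C); apply continuous_Cminus; [apply Hc, Ht|apply continuous_const].
- apply Cpow_nz, transform_neq; assumption.
Qed.

Lemma self_close : Cmod (b - b) < m / 2.
Proof. replace (b - b)%C with (RtoC 0) by ring; rewrite Cmod_0; lra. Qed.

Lemma M_nonneg : 0 <= M.
Proof. eapply Rle_trans; [apply Cmod_ge_0|apply (HM x); lra]. Qed.

Lemma cauchy_transform_cder1 :
  cder (fun b => CInt (fun t => K t / (c t - b) ^ 1)%C x y) b (CInt (fun t => K t / (c t - b) ^ 2)%C x y).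
Proof.
assert (HM0 := M_nonneg).
(* The remainder is exactly [K t * (b' - b) ^ 2 / ((c t - b') * (c t - b) ^ 2)], with denominators
   bounded below through [m / 2] and [m]. *)
apply CInt_param_cder with (A := M * (/ (m / 2) * / m * / m)) (d := m / 2); auto; try lra.
- apply Rmult_le_pos; [exact HM0|]; left; repeat apply Rmult_lt_0_compat; apply Rinv_0_lt_compat; lra.
- intros b' Hb'; apply transform_cont, Hb'.
- apply transform_cont, self_close.
- intros t b' Ht Hb'.
  assert (N := transform_neq t b' Ht Hb'); assert (N0 := transform_neq t b Ht self_close).
  replace (K t / (c t - b') ^ 1 - K t / (c t - b) ^ 1 - K t / (c t - b) ^ 2 * (b' - b))%C
    with (K t * (/ (c t - b') * / (c t - b) * / (c t - b)) * ((b' - b) * (b' - b)))%C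
    by (simpl; field; split; assumption).
  rewrite !Cmod_mult, !Cmod_inv by assumption.
  simpl; rewrite Rmult_1_r.
  apply Rmult_le_compat_r; [apply Rmult_le_pos; apply Cmod_ge_0|].
  assert (I1 : / Cmod (c t - b') <= / (m / 2)) by (apply Rinv_le_contravar; [lra|apply transform_far; auto]).
  assert (I2 : / Cmod (c t - b) <= / m) by (apply Rinv_le_contravar; [lra|apply Hmc, Ht]).
  assert (P1 : 0 < / Cmod (c t - b')) by (apply Rinv_0_lt_compat, Cmod_gt_0, N).
  assert (P2 : 0 < / Cmod (c t - b)) by (apply Rinv_0_lt_compat, Cmod_gt_0, N0).
  apply Rmult_le_compat; [apply Cmod_ge_0| |apply HM, Ht|].
  { left; repeat apply Rmult_lt_0_compat; assumption. }
  apply Rmult_le_compat; [left; apply Rmult_lt_0_compat; assumption|lra| |exact I2].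
  apply Rmult_le_compat; lra.
Qed.

(** Together with [cauchy_transform_cder1] this shows that the derivative of a holomorphic function
    is again differentiable, with no prior continuity of that derivative. *)
Lemma cauchy_transform_dif2 : dif (fun b => CInt (fun t => K t / (c t - b) ^ 2)%C x y) b.
Proof.
assert (HM0 := M_nonneg).
eexists; apply CInt_param_cder with (k' := fun t => (2 * (K t / (c t - b) ^ 3))%C)
   (A := M * (3 * / (m / 2) ^ 2 * / m ^ 2 + 2 * (m / 2) * / (m / 2) ^ 2 * / m ^ 3)) (d := m / 2); auto; try lra.
- assert (0 < m / 2) by lra.
  apply Rmult_le_pos; [exact HM0|]; left; apply Rplus_lt_0_compat;
    repeat apply Rmult_lt_0_compat; try apply Rinv_0_lt_compat; try apply pow_lt; lra.
- intros b' Hb'; apply transform_cont, Hb'.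
- intros t Ht; apply continuous_Cmult; [apply continuous_const|].
  exact (transform_cont b 3 self_close t Ht).
- intros t b' Ht Hb'.
  assert (N := transform_neq t b' Ht Hb'); assert (N0 := transform_neq t b Ht self_close).
  replace (K t / (c t - b') ^ 2 - K t / (c t - b) ^ 2 - 2 * (K t / (c t - b) ^ 3) * (b' - b))%C
    with (K t * (3 * / (c t - b') ^ 2 * / (c t - b) ^ 2 - 2 * (b' - b) * / (c t - b') ^ 2 * / (c t - b) ^ 3)
       * ((b' - b) * (b' - b)))%C
    by (simpl; field; split; assumption).
  set (u := Cmod (c t - b')); set (v := Cmod (c t - b)); set (k := Cmod (b' - b)).
  assert (Hu : m / 2 <= u) by (apply transform_far; auto).
  assert (Hv : m <= v) by (apply Hmc, Ht).
  rewrite !Cmod_mult; fold k; replace (k ^ 2) with (k * k) by ring.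
  apply Rmult_le_compat_r; [apply Rmult_le_pos; apply Cmod_ge_0|].
  apply Rmult_le_compat; try apply Cmod_ge_0; [apply HM, Ht|].
  eapply Rle_trans; [apply Cmod_triangle|]; rewrite Cmod_opp.
  rewrite !Cmod_mult, !Cmod_inv, !Cmod_pow, !Cmod_R by (apply Cpow_nz; assumption).
  fold u v k; rewrite !Rabs_right by lra.
  assert (I1 : / u ^ 2 <= / (m / 2) ^ 2).
  { apply Rinv_le_contravar; [apply pow_lt; lra|apply pow_incr; lra]. }
  assert (I2 : / v ^ 2 <= / m ^ 2).
  { apply Rinv_le_contravar; [apply pow_lt; lra|apply pow_incr; lra]. }
  assert (I3 : / v ^ 3 <= / m ^ 3).
  { apply Rinv_le_contravar; [apply pow_lt; lra|apply pow_incr; lra]. }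
  assert (P1 : 0 < / u ^ 2) by (apply Rinv_0_lt_compat, pow_lt; lra).
  assert (P2 : 0 < / v ^ 2) by (apply Rinv_0_lt_compat, pow_lt; lra).
  assert (P3 : 0 < / v ^ 3) by (apply Rinv_0_lt_compat, pow_lt; lra).
  assert (Hk : 0 <= k <= m / 2) by (split; [apply Cmod_ge_0|unfold k; lra]).
  apply Rplus_le_compat; (apply Rmult_le_compat; [| |apply Rmult_le_compat|]); try lra; try nra.
Qed.

End Cauchy_transform.

(** The bound is encoded as the reciprocal of the gauge, since [compact_uniform] wants an estimate
    that survives when the gauge shrinks. *)
Lemma compact_bounded (K : C -> Prop) B (f : C -> C) :
  (forall z, K z -> Cmod z <= B) -> Cclosed K -> (forall z, K z -> continuous f z) ->
  exists M, forall z, K z -> Cmod (f z) <= M.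
Proof.
intros HB HK Hf.
destruct (compact_uniform K B (fun z e => Cmod (f z) <= / e) HB HK) as [e [He H]].
- intros y e e' He H; eapply Rle_trans; [exact H|]; apply Rinv_le_contravar; lra.
- intros z Hz; set (m := Cmod (f z) + 1).
  assert (Hm : 0 < m) by (unfold m; assert (A := Cmod_ge_0 (f z)); lra).
  exists (/ m); split; [apply Rinv_0_lt_compat, Hm|].
  generalize (proj1 (continuous_CmodP _ _) (Hf z Hz) 1 ltac:(lra)); apply filter_imp.
  intros y Hy _; rewrite Rinv_inv.
  assert (A := Cmod_sub_le (f y) (f z)); apply Rabs_le_between in A; unfold m; lra.
- exists (/ e); exact H.
Qed.

Lemma compact_away_zero (K : C -> Prop) B (f : C -> C) :
  (forall z, K z -> Cmod z <= B) -> Cclosed K -> (forall z, K z -> continuous f z) ->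
  (forall z, K z -> f z <> 0%C) -> exists m, 0 < m /\ forall z, K z -> m <= Cmod (f z).
Proof.
intros HB HK Hf Hz0.
apply (compact_uniform K B (fun z e => e <= Cmod (f z)) HB HK).
- intros y e e' He H; lra.
- intros z Hz; set (m := Cmod (f z)).
  assert (Hm : 0 < m) by (apply Cmod_gt_0, Hz0, Hz).
  exists (m / 2); split; [lra|].
  generalize (proj1 (continuous_CmodP _ _) (Hf z Hz) (m / 2) ltac:(lra)); apply filter_imp.
  intros y Hy _.
  assert (A := Cmod_sub_le (f y) (f z)); apply Rabs_le_between in A; fold m in A; lra.
Qed.

Lemma circle_bounded f a s : 0 <= s -> (forall z, Cmod (z - a) = s -> continuous f z) ->
  exists M, forall z, Cmod (z - a) = s -> Cmod (f z) <= M.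
Proof.
intros Hs Hf; apply (compact_bounded (fun z => Cmod (z - a) = s) (s + Cmod a)); auto.
- intros z Hz; apply Cmod_bounded_disk; lra.
- apply Cclosed_circle.
Qed.

(** Up to a factor, [f] and its derivative are the Cauchy transforms over the circle of radius
    [3 * R / 4], which stays at distance [R / 4] from the disc of radius [R / 2]. The centre is only
    a point of continuity, so that removability comes along. *)
Lemma hol_regular f a R : 0 < R -> (forall z, Cmod (z - a) < R -> continuous f z) ->
  (forall z, 0 < Cmod (z - a) < R -> dif f z) ->
  exists f1, forall b, Cmod (b - a) < R / 2 -> cder f b (f1 b) /\ dif f1 b.
Proof.
intros HR Hc Hd.
set (s := 3 * R / 4); assert (HP := twoPI_pos).
set (c := fun t => (a + RtoC s * cis t)%C).
set (K := fun t => (f (c t) * (RtoC s * cis t) / RtoC (2 * PI))%C).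
assert (P0 : RtoC (2 * PI) <> 0%C) by (intros E; apply RtoC_inj in E; lra).
assert (Hcc : continuous_seg c 0 (2 * PI)) by (intros t _; apply continuous_circle).
assert (HfK : continuous_seg (fun t => f (c t)) 0 (2 * PI)).
{ apply circle_seg; [unfold s; lra|]; intros z Hz; apply Hc; unfold s in Hz; lra. }
assert (HK : continuous_seg K 0 (2 * PI)).
{ intros t Ht; apply continuous_Cmult; [|apply continuous_const].
  apply continuous_Cmult; [apply HfK, Ht|].
  apply continuous_Cmult; [apply continuous_const|apply continuous_cis]. }
assert (HM : exists M, forall t, 0 <= t <= 2 * PI -> Cmod (K t) <= M).
{ destruct (circle_bounded f a s) as [M HM]; [unfold s; lra|intros z Hz; apply Hc; unfold s in Hz; lra|].
  exists (M * s / (2 * PI)); intros t _; unfold K; rewrite Cmod_div, !Cmod_mult, Cmod_cis, !Cmod_R by exact P0.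
  rewrite (Rabs_right s), (Rabs_right (2 * PI)) by (unfold s; lra).
  unfold Rdiv; apply Rmult_le_compat_r; [left; apply Rinv_0_lt_compat; lra|].
  rewrite Rmult_1_r; apply Rmult_le_compat_r; [unfold s; lra|].
  apply HM, Cmod_circle; unfold s; lra. }
destruct HM as [M HM].
exists (fun b => CInt (fun t => K t / (c t - b) ^ 2)%C 0 (2 * PI)).
intros b Hb.
assert (Far : forall b, Cmod (b - a) < R / 2 -> forall t, 0 <= t <= 2 * PI -> R / 4 <= Cmod (c t - b)).
{ intros b0 Hb0 t _; assert (A : Cmod (c t - a) = s) by (apply Cmod_circle; unfold s; lra).
  assert (T := Cmod_sub_triangle b0 (c t) a); unfold s in A; lra. }
split.
- apply cder_ext_loc with (fun b => CInt (fun t => K t / (c t - b) ^ 1)%C 0 (2 * PI)).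
  + apply locally_CmodP; exists (R / 2 - Cmod (b - a)); split; [lra|]; intros b' Hb'.
    assert (T := Cmod_sub_triangle b b' a).
    assert (Hb'' : Cmod (b' - a) < R / 2) by lra.
    assert (F := cauchy_formula f a R Hc Hd b' s ltac:(unfold s; lra)).
    transitivity (/ RtoC (2 * PI) * (RtoC (2 * PI) * f b'))%C; [|field; exact P0].
    rewrite <- F; unfold avg; rewrite <- CInt_scal; auto.
    * apply CInt_ext; auto; intros t Ht.
      assert (N : (c t - b')%C <> 0%C) by (apply Cmod_gt_0; assert (A := Far b' Hb'' t Ht); lra).
      unfold K; fold (c t); replace (c t - a)%C with (RtoC s * cis t)%C by (unfold c; ring).
      simpl; field; split; assumption.
    * intros t Ht; apply continuous_Cmult; [apply HfK, Ht|].
      assert (N : (c t - b')%C <> 0%C) by (apply Cmod_gt_0; assert (A := Far b' Hb'' t Ht); lra).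
      apply continuous_Cdiv; [apply continuous_Cminus|apply continuous_Cminus|exact N];
        auto using continuous_const.
  + apply cauchy_transform_cder1 with (m := R / 4) (M := M); auto; lra.
- apply cauchy_transform_dif2 with (m := R / 4) (M := M); auto; lra.
Qed.

(** Continuity at [a], rather than boundedness near [a], is the assumption that Caratheodory
    quotients and continuous inverse maps provide. *)
Lemma removable f a R : 0 < R -> (forall z, 0 < Cmod (z - a) < R -> dif f z) ->
  continuous f a -> dif f a.
Proof.
intros HR Hd Hc; destruct (hol_regular f a R HR) as [f1 H]; auto.
- intros z Hz; destruct (Ceq_dec z a) as [->|Hn]; [exact Hc|].
  apply dif_continuous, Hd; split; [apply Cmod_gt_0, Csub_neq, Hn|exact Hz].
- exists (f1 a); apply H; replace (a - a)%C with (RtoC 0) by ring; rewrite Cmod_0; lra.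
Qed.

(** A choice, with an arbitrary value where [f] is not differentiable. *)
Definition Der (f : C -> C) (z : C) : C := epsilon (inhabits (RtoC 0)) (cder f z).

Lemma Der_spec f z : dif f z -> cder f z (Der f z).
Proof. intros H; exact (epsilon_spec (inhabits (RtoC 0)) (cder f z) H). Qed.

Lemma Der_eq f z l : cder f z l -> Der f z = l.
Proof. intros H; eapply cder_unique; [apply Der_spec; exists l|]; exact H. Qed.

Lemma Der_ext_loc f g z : dif f z -> locally z (fun y => f y = g y) -> Der g z = Der f z.
Proof. intros H L; apply Der_eq; eapply cder_ext_loc; [exact L|apply Der_spec, H]. Qed.

Lemma Cmod_center a : Cmod (a - a) = 0.
Proof. replace (a - a)%C with (RtoC 0) by ring; apply Cmod_0. Qed.

Lemma dif_Der f z : locally z (dif f) -> dif (Der f) z.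
Proof.
intros L; apply locally_CmodP in L; destruct L as [R [HR L]].
destruct (hol_regular f z R HR) as [f1 H].
- intros y Hy; apply dif_continuous, L, Hy.
- intros y Hy; apply L; lra.
- apply dif_ext_loc with f1.
  + apply locally_CmodP; exists (R / 2); split; [lra|].
    intros y Hy; symmetry; apply Der_eq, H, Hy.
  + apply H; rewrite Cmod_center; lra.
Qed.

Lemma locally_disk a R z : Cmod (z - a) < R -> locally z (fun y : C => Cmod (y - a) < R).
Proof.
intros Hz; apply locally_CmodP; exists (R - Cmod (z - a)); split; [lra|]; intros y Hy.
assert (T := Cmod_sub_triangle z y a); lra.
Qed.

Lemma dif_on_disk_locally f a R z : (forall y, Cmod (y - a) < R -> dif f y) -> Cmod (z - a) < R ->
  locally z (dif f).
Proof. intros H Hz; generalize (locally_disk a R z Hz); apply filter_imp; exact H. Qed.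

Lemma locally_neq z a : z <> a -> locally z (fun y : C => y <> a).
Proof.
intros H; generalize (locally_neq0 (fun y => y - a)%C z (dif_continuous _ _ (dif_sub_const a z)) (Csub_neq _ _ H)).
apply filter_imp; intros y Hy ->; apply Hy; ring.
Qed.

(** The Caratheodory quotient of [f] at [a] is the cofactor: differentiable off [a] as a quotient,
    continuous at [a], hence differentiable there. *)
Lemma factor_root f a R : (forall z, Cmod (z - a) < R -> dif f z) -> 0 < R -> f a = 0%C ->
  exists h, (forall z, Cmod (z - a) < R -> dif h z) /\ forall z, f z = ((z - a) * h z)%C.
Proof.
intros Hd HR Ha.
destruct (Hd a) as [l [h [Hh [_ E]]]]; [rewrite Cmod_center; exact HR|].
exists h.
assert (Off : forall z, z <> a -> Cmod (z - a) < R -> dif h z).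
{ intros z Hn Hz; apply dif_ext_loc with (fun y => f y / (y - a))%C.
  - generalize (locally_neq z a Hn); apply filter_imp; intros y Hy; rewrite (E y), Ha.
    change (((0 + h y * (y - a)) / (y - a))%C = h y :> C); field; apply Csub_neq, Hy.
  - apply dif_div; [apply Hd, Hz|apply dif_sub_const|apply Csub_neq, Hn]. }
split; [|intros z; rewrite (E z), Ha; ring].
intros z Hz; destruct (Ceq_dec z a) as [->|Hn]; [|apply Off; assumption].
apply removable with R; [exact HR| |exact Hh].
intros y Hy; apply Off; [|lra]; intros ->; rewrite Cmod_center in Hy; lra.
Qed.

(** Cauchy's formula for the cofactor of [(z - a) ^ k], on a circle of radius [s] beyond [b], gives
    [Cmod (f b) <= B * (Cmod (b - a) / s) ^ k] with [B] independent of [k]. *)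
Lemma zero_of_infinite_order f a R : 0 < R -> (forall z, Cmod (z - a) < R -> dif f z) ->
  (forall k, exists h, (forall z, Cmod (z - a) < R -> dif h z) /\ forall z, f z = ((z - a) ^ k * h z)%C) ->
  forall z, Cmod (z - a) < R -> f z = 0%C.
Proof.
intros HR Hd Hk b Hb; assert (HP := twoPI_pos); assert (Hb0 := Cmod_ge_0 (b - a)).
set (s := (Cmod (b - a) + R) / 2); set (rho := Cmod (b - a)) in *.
assert (Hs : rho < s < R) by (unfold s; lra).
destruct (circle_bounded f a s) as [M HM]; [lra|intros z Hz; apply dif_continuous, Hd; lra|].
assert (HM0 : 0 <= M).
{ eapply Rle_trans; [apply Cmod_ge_0|]; apply (HM (a + RtoC s * cis 0)%C), Cmod_circle; lra. }
set (B := 2 * (M * (s / (s - rho)))).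
assert (HB : 0 <= B).
{ apply Rmult_le_pos; [lra|]; apply Rmult_le_pos; [lra|]; apply Rle_mult_inv_pos; lra. }
assert (Est : forall k, Cmod (f b) <= B * (rho / s) ^ k).
{ intros k; destruct (Hk k) as [h [Hh E]].
  assert (Hsk : 0 < s ^ k) by (apply pow_lt; lra).
  assert (F := cauchy_formula h a R (fun z Hz => dif_continuous _ _ (Hh z Hz))
     (fun z Hz => Hh z (proj2 Hz)) b s Hs).
  assert (N : forall z, Cmod (z - a) = s -> (z - b)%C <> 0%C).
  { intros z Hz; apply Csub_neq; intros ->; fold rho in Hz; lra. }
  assert (Bd : Cmod (avg (fun z => h z * ((z - a) / (z - b)))%C a s) <= 4 * PI * (M / s ^ k * (s / (s - rho)))).
  { apply avg_bound; [lra| |].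
    - intros z Hz; apply continuous_Cmult; [apply dif_continuous, Hh; lra|].
      apply continuous_Cdiv; auto using dif_continuous, dif_sub_const.
    - intros z Hz; rewrite Cmod_mult, Cmod_div, Hz by (apply N, Hz).
      apply Rmult_le_compat; [apply Cmod_ge_0| | |].
      + apply Rle_mult_inv_pos; [lra|apply Cmod_gt_0, N, Hz].
      + assert (A := HM z Hz); rewrite (E z), Cmod_mult, Cmod_pow, Hz in A.
        apply Rmult_le_reg_l with (s ^ k); [exact Hsk|]; replace (s ^ k * (M / s ^ k)) with M by (field; lra); exact A.
      + apply Rmult_le_compat_l; [lra|]; apply Rinv_le_contravar; [lra|].
        assert (T := Cmod_sub_triangle b z a).
        fold rho in T; lra. }
  rewrite F, Cmod_mult, Cmod_R, Rabs_right in Bd by lra.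
  assert (Hhb : Cmod (h b) <= B / s ^ k).
  { apply Rmult_le_reg_l with (2 * PI); [lra|].
    eapply Rle_trans; [exact Bd|]; apply Req_le; unfold B; field; split; lra. }
  rewrite (E b), Cmod_mult, Cmod_pow; fold rho.
  unfold Rdiv at 1; rewrite Rpow_mult_distr, pow_inv.
  replace (B * (rho ^ k * / s ^ k)) with (rho ^ k * (B / s ^ k)) by (field; lra).
  apply Rmult_le_compat_l; [apply pow_le; exact Hb0|exact Hhb]. }
apply Cmod_le_eps; intros e He.
assert (Hq : Rabs (rho / s) < 1).
{ rewrite Rabs_right by (apply Rle_ge, Rle_mult_inv_pos; lra).
  apply Rmult_lt_reg_r with s; [lra|]; unfold Rdiv; rewrite Rmult_assoc, Rinv_l; lra. }
destruct (pow_lt_1_zero _ Hq (e / (B + 1))) as [n Hn]; [apply Rdiv_lt_0_compat; lra|].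
specialize (Hn n (le_n n)); apply Rabs_def2 in Hn.
assert (A := Est n).
assert (0 <= (rho / s) ^ n) by (apply pow_le, Rle_mult_inv_pos; lra).
assert ((B + 1) * (rho / s) ^ n <= e).
{ apply Rmult_le_reg_r with (/ (B + 1)); [apply Rinv_0_lt_compat; lra|].
  replace ((B + 1) * (rho / s) ^ n * / (B + 1)) with ((rho / s) ^ n) by (field; lra); unfold Rdiv in Hn; unfold Rdiv; lra. }
lra.
Qed.

(** Roots at [a] are divided out one at a time; if this never stopped, [f] would vanish on the
    disc. *)
Lemma finite_order f a R : 0 < R -> (forall z, Cmod (z - a) < R -> dif f z) ->
  (exists z, Cmod (z - a) < R /\ f z <> 0%C) ->
  exists k h, (forall z, Cmod (z - a) < R -> dif h z) /\ h a <> 0%C /\ forall z, f z = ((z - a) ^ k * h z)%C.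
Proof.
intros HR Hd [z0 [Hz0 Hne]]; apply NNPP; intros HN; apply Hne.
apply (zero_of_infinite_order f a R HR Hd); [|exact Hz0].
induction k as [|k [h [Hh E]]].
- exists f; split; [exact Hd|]; intros z; simpl; ring.
- destruct (Ceq_dec (h a) 0) as [Ha|Ha].
  + destruct (factor_root h a R Hh HR Ha) as [h' [Hh' E']].
    exists h'; split; [exact Hh'|]; intros z; rewrite (E z), (E' z); simpl; ring.
  + exfalso; apply HN; exists k, h; auto.
Qed.

(** * Maximum modulus and open mapping *)

Lemma RInt_nonneg_zero (h : R -> R) x y : x < y ->
  (forall t, x <= t <= y -> continuous h t) -> (forall t, x <= t <= y -> 0 <= h t) ->
  RInt h x y <= 0 -> forall t, x <= t <= y -> h t = 0.
Proof.
intros Hxy Hc H0 HI t Ht; apply NNPP; intros Hn.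
assert (Hp : 0 < h t) by (destruct (H0 t Ht) as [|E]; [assumption|congruence]).
destruct (proj1 (continuous_RP _ _) (Hc t Ht) (h t / 2) ltac:(lra)) as [d L].
assert (Hd := cond_pos d).
set (u := Rmax x (t - d / 2)); set (v := Rmin y (t + d / 2)).
assert (U : x <= u <= t /\ t - d / 2 <= u).
{ split; [split; [apply Rmax_l|apply Rmax_lub; lra]|apply Rmax_r]. }
assert (V : t <= v <= y /\ v <= t + d / 2).
{ split; [split; [apply Rmin_glb; lra|apply Rmin_l]|apply Rmin_r]. }
assert (UV : u < v).
{ unfold u, v; apply Rmax_lub_lt; apply Rmin_glb_lt; lra. }
assert (Ex : forall a b, x <= a -> a <= b -> b <= y -> ex_RInt h a b).
{ intros a b Ha Hab Hb; apply ex_RInt_seg; [exact Hab|]; intros s Hs; apply Hc; lra. }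
assert (C1 := RInt_Chasles h x u y (Ex x u ltac:(lra) ltac:(lra) ltac:(lra)) (Ex u y ltac:(lra) ltac:(lra) ltac:(lra))).
assert (C2 := RInt_Chasles h u v y (Ex u v ltac:(lra) ltac:(lra) ltac:(lra)) (Ex v y ltac:(lra) ltac:(lra) ltac:(lra))).
unfold plus in C1, C2; simpl in C1, C2.
assert (P1 : 0 <= RInt h x u) by (apply RInt_ge_0; [lra|apply Ex; lra|intros; apply H0; lra]).
assert (P3 : 0 <= RInt h v y) by (apply RInt_ge_0; [lra|apply Ex; lra|intros; apply H0; lra]).
assert (P2 : (h t / 2) * (v - u) <= RInt h u v).
{ replace ((h t / 2) * (v - u)) with (RInt (fun _ => h t / 2) u v)
    by (rewrite RInt_const; unfold scal; simpl; unfold mult; simpl; ring).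
  apply RInt_le; [lra|apply ex_RInt_const|apply Ex; lra|].
  intros s Hs; assert (A : Rabs (h s - h t) < h t / 2).
  { apply L; unfold ball; simpl; unfold AbsRing_ball, abs, minus, plus, opp; simpl; apply Rabs_def1; lra. }
  apply Rabs_def2 in A; lra. }
assert (0 < (h t / 2) * (v - u)) by (apply Rmult_lt_0_compat; lra).
lra.
Qed.

Lemma cis_surj w : Cmod w = 1 -> exists t, 0 <= t < 2 * PI /\ w = cis t.
Proof.
intros Hw; destruct w as [x y].
assert (E := Cmod2_alt (x, y)); rewrite Hw in E; simpl in E.
assert (E' : x * x + y * y = 1) by lra.
assert (Hx : -1 <= x <= 1) by nra.
assert (B := acos_bound x); assert (HP := PI_RGT_0).
assert (S : sin (acos x) = Rabs y).
{ rewrite sin_acos by exact Hx; rewrite <- sqrt_Rsqr_abs; f_equal; unfold Rsqr; lra. }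
destruct (Rle_lt_dec 0 y) as [Hy|Hy].
- exists (acos x); split; [lra|]; rewrite cisE, cos_acos, S, Rabs_right by lra; reflexivity.
- exists (2 * PI - acos x).
  assert (0 < acos x).
  { destruct (proj1 B) as [|E0]; [assumption|]; exfalso.
    rewrite <- E0, sin_0 in S; rewrite Rabs_left in S by exact Hy; lra. }
  split; [lra|]; rewrite cisE; f_equal.
  + rewrite cos_minus, cos_2PI, sin_2PI, cos_acos by exact Hx; ring.
  + rewrite sin_minus, cos_2PI, sin_2PI, S, Rabs_left by exact Hy; ring.
Qed.

Lemma polar (z a : C) : exists t, 0 <= t < 2 * PI /\ z = (a + RtoC (Cmod (z - a)) * cis t)%C.
Proof.
assert (HP := twoPI_pos).
destruct (Ceq_dec z a) as [->|Hn].
- exists 0; split; [lra|]; rewrite Cmod_center; ring.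
- assert (N := Csub_neq _ _ Hn); assert (P := proj1 (Cmod_gt_0 _) N).
  assert (P' : RtoC (Cmod (z - a)) <> 0%C) by (intros E; apply RtoC_inj in E; lra).
  destruct (cis_surj ((z - a) / RtoC (Cmod (z - a)))) as [t [Ht E]].
  + rewrite Cmod_div, Cmod_R, Rabs_right by (assumption || lra); field; lra.
  + exists t; split; [exact Ht|]; rewrite <- E; field; exact P'.
Qed.

Lemma avg_center f a R s : (forall z, Cmod (z - a) < R -> dif f z) -> 0 < s < R ->
  avg f a s = (RtoC (2 * PI) * f a)%C.
Proof.
intros Hd Hs; rewrite <- (cauchy_formula f a R (fun z Hz => dif_continuous _ _ (Hd z Hz))
   (fun z Hz => Hd z (proj2 Hz)) a s) by (rewrite Cmod_center; lra).
apply avg_ext; [lra|]; intros z Hz; field; apply Cmod_gt_0; lra.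
Qed.

Lemma Re_conj_mult (u w : C) : Re (Cconj u * w) <= Cmod u * Cmod w.
Proof.
rewrite <- (Cmod_conj u), <- Cmod_mult; eapply Rle_trans; [apply Rle_abs|apply re_le_Cmod].
Qed.

(** After multiplication by the conjugate of [f a], the real part is at most [m ^ 2] and has mean
    [m ^ 2] over each circle, hence equals [m ^ 2] everywhere on it; the bound on the modulus then
    leaves no room for an imaginary part. *)
Lemma max_modulus f a R : (forall z, Cmod (z - a) < R -> dif f z) ->
  (forall z, Cmod (z - a) < R -> Cmod (f z) <= Cmod (f a)) ->
  forall z, Cmod (z - a) < R -> f z = f a.
Proof.
intros Hd Hm z Hz.
destruct (Ceq_dec z a) as [->|Hn]; [reflexivity|].
assert (Hs : 0 < Cmod (z - a)) by (apply Cmod_gt_0, Csub_neq, Hn).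
set (s := Cmod (z - a)) in *; assert (HP := twoPI_pos).
set (m := Cmod (f a)); assert (Hm0 : 0 <= m) by apply Cmod_ge_0.
set (g := fun z => (Cconj (f a) * f z)%C).
assert (Hga : g a = RtoC (m ^ 2)) by (unfold g, m; rewrite Cmod2_conj; ring).
assert (Hg : forall z, Cmod (z - a) < R -> dif g z).
{ intros y Hy; apply dif_mult; [apply dif_const|auto]. }
assert (A := avg_center g a R s Hg ltac:(lra)).
assert (Hseg : continuous_seg (fun t => g (a + RtoC s * cis t)%C) 0 (2 * PI)).
{ apply circle_seg; [lra|]; intros y Hy; apply dif_continuous, Hg; lra. }
set (h := fun t => m ^ 2 - Re (g (a + RtoC s * cis t)%C)).
assert (HI : RInt h 0 (2 * PI) = 0).
{ unfold h; transitivity (RInt (fun _ => m ^ 2) 0 (2 * PI) - RInt (fun t => Re (g (a + RtoC s * cis t)%C)) 0 (2 * PI)).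
  - apply (RInt_minus (V := R_CompleteNormedModule)); [apply ex_RInt_const|apply ex_RInt_Re; auto].
  - change (RInt (fun t => Re (g (a + RtoC s * cis t)%C)) 0 (2 * PI)) with (Re (avg g a s)).
    rewrite A, Hga, RInt_const; unfold scal; simpl; unfold mult, Re; simpl; ring. }
destruct (polar z a) as [t [Ht Et]]; fold s in Et.
assert (Z : h t = 0).
{ apply RInt_nonneg_zero with 0 (2 * PI); auto; try lra.
  - intros x Hx; apply (continuous_minus (V := R_NormedModule)); [apply continuous_const|].
    apply continuous_Re, Hseg, Hx.
  - intros x _; unfold h; assert (B := Re_conj_mult (f a) (f (a + RtoC s * cis x)%C)).
    assert (B' := Hm (a + RtoC s * cis x)%C ltac:(rewrite Cmod_circle; lra)); fold m in B, B'.
    unfold g; nra. }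
unfold h in Z; rewrite <- Et in Z.
destruct (Req_dec m 0) as [Em|Em].
{ assert (B := Hm z Hz); fold m in B; rewrite (Cmod_eq_0 (f a) Em).
  apply Cmod_eq_0, Rle_antisym; [lra|apply Cmod_ge_0]. }
assert (Hmod : Cmod (g z) <= m ^ 2).
{ unfold g; rewrite Cmod_mult, Cmod_conj; fold m.
  assert (B := Hm z Hz); fold m in B; simpl; rewrite Rmult_1_r; apply Rmult_le_compat_l; lra. }
assert (Im0 : Im (g z) = 0).
{ assert (B := Cmod2_alt (g z)); assert (Cmod (g z) ^ 2 <= (m ^ 2) ^ 2) by (apply pow_incr; split; [apply Cmod_ge_0|exact Hmod]).
  replace (Re (g z)) with (m ^ 2) in B by lra; apply Rsqr_0_uniq; unfold Rsqr; nra. }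
assert (E : g z = g a).
{ rewrite Hga; destruct (g z) as [g1 g2]; unfold Re, Im in *; simpl in *; subst g2; unfold RtoC; f_equal; lra. }
assert (N : Cconj (f a) <> 0%C).
{ apply Cmod_gt_0; rewrite Cmod_conj; fold m; lra. }
unfold g in E.
replace (f z) with (/ Cconj (f a) * (Cconj (f a) * f z))%C by (field; exact N).
rewrite E; field; exact N.
Qed.

Lemma max_modulus_locally f a : locally a (dif f) ->
  locally a (fun z => Cmod (f z) <= Cmod (f a)) -> locally a (fun z => f z = f a).
Proof.
intros H1 H2; assert (L := filter_and (F := locally a) _ _ H1 H2).
apply locally_CmodP in L; destruct L as [R [HR L]].
apply locally_CmodP; exists R; split; [exact HR|].
apply max_modulus; apply L.
Qed.

(** If [w] were omitted, [1 / (f - w)] would be holomorphic with a value at the centre too large for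
    its values on the circle of radius [s / 2]. *)
Lemma open_mapping f a R s : (forall z, Cmod (z - a) < R -> dif f z) ->
  (forall z, Cmod (z - a) < R -> f z = f a -> z = a) -> 0 < s < R ->
  exists e, 0 < e /\ forall w, Cmod (w - f a) < e -> exists z, Cmod (z - a) < s /\ f z = w.
Proof.
intros Hd Hi Hs; assert (HP := twoPI_pos).
destruct (compact_away_zero (fun z => Cmod (z - a) = s / 2) (s / 2 + Cmod a) (fun z => f z - f a)%C)
  as [m [Hm H]].
- intros z Hz; apply Cmod_bounded_disk; lra.
- apply Cclosed_circle.
- intros z Hz; apply continuous_Cminus; [apply dif_continuous, Hd; lra|apply continuous_const].
- intros z Hz; apply Csub_neq; intros E; apply Hi in E; [|lra]; subst z; rewrite Cmod_center in Hz; lra.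
(* On the circle [Cmod (f z - w)] is at least [3 * m / 4]; the radius [m / 4] also absorbs the
   factor 2 lost in [avg_bound], as [2 * (4 / (3 * m)) < 4 / m]. *)
- exists (m / 4); split; [lra|]; intros w Hw; apply NNPP; intros HN.
  assert (Hne : forall z, Cmod (z - a) < s -> (f z - w)%C <> 0%C).
  { intros z Hz; apply Csub_neq; intros E; apply HN; eauto. }
  set (g := fun z => (1 / (f z - w))%C).
  assert (Hg : forall z, Cmod (z - a) < s -> dif g z).
  { intros z Hz; apply dif_div; [apply dif_const| |apply Hne, Hz].
    apply dif_minus; [apply Hd; lra|apply dif_const]. }
  assert (A := avg_center g a s (s / 2) Hg ltac:(lra)).
  assert (B : Cmod (avg g a (s / 2)) <= 4 * PI * (4 / (3 * m))).
  { apply avg_bound; [lra| |].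
    - intros z Hz; apply dif_continuous, Hg; lra.
    - intros z Hz; unfold g; rewrite Cmod_div, Cmod_1 by (apply Hne; lra).
      assert (T := Cmod_sub_triangle w (f z) (f a)).
      assert (T2 := H z Hz).
      replace (4 / (3 * m)) with (1 / (3 * m / 4)) by (field; lra).
      unfold Rdiv at 1 3; apply Rmult_le_compat_l; [lra|]; apply Rinv_le_contravar; lra. }
  assert (Hne0 : (f a - w)%C <> 0%C) by (apply Hne; rewrite Cmod_center; lra).
  rewrite A, Cmod_mult, Cmod_R, Rabs_right in B by lra.
  unfold g in B; rewrite Cmod_div, Cmod_1 in B by exact Hne0.
  replace (f a - w)%C with (- (w - f a))%C in B, Hne0 by ring; rewrite Cmod_opp in B.
  apply Cmod_gt_0 in Hne0; rewrite Cmod_opp in Hne0.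
  set (k := Cmod (w - f a)) in *.
  assert (4 / m < 1 / k).
  { replace (4 / m) with (1 / (m / 4)) by (field; lra).
    apply Rmult_lt_compat_l; [lra|]; apply Rinv_lt_contravar; [nra|lra]. }
  assert (B' : 1 / k <= 2 * (4 / (3 * m))) by (apply Rmult_le_reg_l with (2 * PI); lra).
  assert (2 * (4 / (3 * m)) < 4 / m).
  { apply Rmult_lt_reg_r with (3 * m); [lra|].
    replace (2 * (4 / (3 * m)) * (3 * m)) with 8 by (field; lra).
    replace (4 / m * (3 * m)) with 12 by (field; lra); lra. }
  lra.
Qed.

Lemma open_mapping_inj f a R s z0 : (forall z, Cmod (z - a) < R -> dif f z) ->
  (forall z z', Cmod (z - a) < R -> Cmod (z' - a) < R -> f z = f z' -> z = z') ->
  Cmod (z0 - a) < R -> 0 < s ->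
  exists e, 0 < e /\ forall w, Cmod (w - f z0) < e ->
    exists z, Cmod (z - z0) < s /\ Cmod (z - a) < R /\ f z = w.
Proof.
intros Hd Hi Hz0 Hs.
set (R' := R - Cmod (z0 - a)).
assert (In : forall z, Cmod (z - z0) < R' -> Cmod (z - a) < R).
{ intros z Hz; assert (T := Cmod_sub_triangle z0 z a); unfold R' in Hz; lra. }
assert (HR' : 0 < R') by (unfold R'; lra).
destruct (open_mapping f z0 R' (Rmin s (R' / 2))) as [e [He H]].
- intros z Hz; apply Hd, In, Hz.
- intros z Hz E; apply Hi; auto.
- split; [apply Rmin_pos; lra|]; eapply Rle_lt_trans; [apply Rmin_r|lra].
- exists e; split; [exact He|]; intros w Hw; destruct (H w Hw) as [z [Hz E]]; exists z.
  assert (Rmin s (R' / 2) <= s) by apply Rmin_l; assert (Rmin s (R' / 2) <= R' / 2) by apply Rmin_r.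
  split; [lra|split; [apply In; lra|exact E]].
Qed.

(* Otherwise [a] would be an isolated zero of [f']; the inverse of [f], being continuous, would have a
   removable singularity at [f a], and the chain rule would give [f' a <> 0]. *)
Lemma injective_Der_neq0 f a R : 0 < R -> (forall z, Cmod (z - a) < R -> dif f z) ->
  (forall z z', Cmod (z - a) < R -> Cmod (z' - a) < R -> f z = f z' -> z = z') ->
  Der f a <> 0%C.
Proof.
intros HR Hd Hi HD.
assert (Haa : Cmod (a - a) < R) by (rewrite Cmod_center; exact HR).
destruct (finite_order (fun z => f z - f a)%C a R HR) as [k [h [Hh [Ha E]]]].
{ intros z Hz; apply dif_minus; [auto|apply dif_const]. }
{ exists (a + RtoC (R / 2))%C.
  assert (A : Cmod (a + RtoC (R / 2) - a) = R / 2).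
  { replace (a + RtoC (R / 2) - a)%C with (RtoC (R / 2)) by ring; rewrite Cmod_R, Rabs_right; lra. }
  split; [lra|]; apply Csub_neq; intros Ef.
  assert (Ea : (a + RtoC (R / 2) = a)%C) by (apply Hi; auto; lra).
  rewrite Ea, Cmod_center in A; lra. }
destruct k as [|k].
{ assert (A := E a); simpl in A; apply Ha; replace (h a) with (1 * h a)%C by ring; rewrite <- A; ring. }
(* The second factor takes the nonzero value [INR (S k) * h a] at [a], so that [Der f] has no zero
   near [a] other than [a]. *)
assert (Hf' : forall z, Cmod (z - a) < R -> Der f z = ((z - a) ^ k * (RtoC (INR (S k)) * h z + (z - a) * Der h z))%C).
{ intros z Hz; apply Der_eq.
  assert (Pw : forall j, cder (fun y => ((y - a) ^ j)%C) z (RtoC (INR j) * (z - a) ^ (pred j))%C).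
  { induction j as [|j IH].
    - simpl; replace (0 * 1)%C with (RtoC 0) by ring; apply cder_const.
    - replace (RtoC (INR (S j)) * (z - a) ^ pred (S j))%C
        with ((1 - 0) * (z - a) ^ j + (z - a) * (RtoC (INR j) * (z - a) ^ pred j))%C.
      + apply (cder_mult (fun y => y - a)%C (fun y => (y - a) ^ j)%C); [|exact IH].
        apply cder_minus; [apply cder_id|apply cder_const].
      + rewrite S_INR, RtoC_plus; simpl; destruct j; simpl; ring. }
  apply cder_ext_loc with (fun y => (y - a) ^ (S k) * h y + f a)%C.
  - apply filter_forall; intros y; rewrite <- (E y); ring.
  - replace ((z - a) ^ k * (RtoC (INR (S k)) * h z + (z - a) * Der h z))%C
      with ((RtoC (INR (S k)) * (z - a) ^ (pred (S k))) * h z + (z - a) ^ S k * Der h z + 0)%C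
      by (simpl pred; cbn [Cpow]; ring).
    apply cder_plus; [apply cder_mult; [apply Pw|apply Der_spec, Hh, Hz]|apply cder_const]. }
assert (Near : exists r, 0 < r < R /\ forall z, 0 < Cmod (z - a) < r -> Der f z <> 0%C).
{ set (u := fun z => (RtoC (INR (S k)) * h z + (z - a) * Der h z)%C).
  assert (Hu : continuous u a).
  { apply dif_continuous, dif_plus; (apply dif_mult; [auto using dif_const, dif_sub_const|]); [auto|].
    apply dif_Der, (dif_on_disk_locally h a R); auto. }
  assert (L := locally_neq0 u a Hu).
  destruct (proj1 (locally_CmodP _ _) (L ltac:(unfold u; replace (a - a)%C with (RtoC 0) by ring;
    rewrite Cmult_0_l, Cplus_0_r; apply Cmult_neq_0; [|exact Ha];
    intros E0; apply RtoC_inj in E0; apply (not_0_INR (S k)); [lia|exact E0]))) as [d [Hd0 Hd1]].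
  exists (Rmin d (R / 2)); split.
  - split; [apply Rmin_pos; lra|]; eapply Rle_lt_trans; [apply Rmin_r|lra].
  - intros z Hz; assert (Rmin d (R / 2) <= d) by apply Rmin_l; assert (Rmin d (R / 2) <= R / 2) by apply Rmin_r.
    rewrite Hf' by lra; apply Cmult_neq_0; [apply Cpow_nz, Cmod_gt_0; lra|apply Hd1; lra]. }
destruct Near as [r [Hr Hne]].
assert (Sub : forall z, Cmod (z - a) < r -> Cmod (z - a) < R) by (intros; lra).
(* The local inverse of [f]: its values exist by the open mapping property and are determined by
   injectivity. *)
set (g := fun w => epsilon (inhabits a) (fun z => Cmod (z - a) < r /\ f z = w)).
destruct (open_mapping_inj f a r r a) as [e0 [He0 Hon]]; auto; try (rewrite Cmod_center; lra); try lra.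
assert (Hg : forall w, Cmod (w - f a) < e0 -> Cmod (g w - a) < r /\ f (g w) = w).
{ intros w Hw; apply (epsilon_spec (inhabits a) (fun z => Cmod (z - a) < r /\ f z = w)).
  destruct (Hon w Hw) as [z [_ Hz]]; exists z; exact Hz. }
assert (Hgf : forall z, Cmod (z - a) < r -> Cmod (f z - f a) < e0 -> g (f z) = z).
{ intros z Hz Hfz; destruct (Hg (f z) Hfz) as [A B]; apply Hi; auto. }
assert (Hgc : forall w, Cmod (w - f a) < e0 -> continuous g w).
{ intros w Hw; destruct (Hg w Hw) as [A B]; apply continuous_CmodP; intros s Hs.
  destruct (open_mapping_inj f a r s (g w)) as [e [He H]]; auto; try lra.
  rewrite B in H.
  generalize (locally_disk (f a) e0 w Hw); intros L.
  assert (L2 : locally w (fun y : C => Cmod (y - w) < e)) by (apply locally_CmodP; exists e; auto).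
  generalize (filter_and (F := locally w) _ _ L L2); apply filter_imp; intros y [Y1 Y2].
  destruct (H y Y2) as [z [Z1 [Z2 Z3]]].
  replace (g y) with z; [exact Z1|]; subst y; symmetry; apply Hgf; assumption. }
assert (Hgd : forall w, 0 < Cmod (w - f a) < e0 -> dif g w).
{ intros w [Hw0 Hw]; destruct (Hg w Hw) as [A B].
  assert (Hna : g w <> a) by (intros E0; rewrite E0 in B; subst w; rewrite Cmod_center in Hw0; lra).
  assert (N : Der f (g w) <> 0%C) by (apply Hne; split; [apply Cmod_gt_0, Csub_neq, Hna|exact A]).
  destruct (Der_spec f (g w) (Hd _ (Sub _ A))) as [p [Hp [Ep Dp]]].
  rewrite <- Ep in N.
  assert (Hpg : continuous (fun y => p (g y)) w) by (apply (continuous_comp g p); [apply Hgc, Hw|exact Hp]).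
  exists (/ p (g w))%C.
  apply cder_ext_loc with (fun y => g w + / p (g y) * (y - w))%C.
  - generalize (filter_and (F := locally w) _ _ (locally_disk (f a) e0 w Hw) (locally_neq0 _ w Hpg N)).
    apply filter_imp; intros y [Y1 Y2].
    destruct (Hg y Y1) as [_ Fy].
    assert (Ey := Dp (g y)); rewrite Fy, B in Ey.
    replace (y - w)%C with (p (g y) * (g y - g w))%C by (rewrite Ey at 3; ring); field; exact Y2.
  - exists (fun y => / p (g y))%C; split; [apply continuous_Cinv; assumption|split; [reflexivity|]].
    intros y; ring. }
assert (Hga : dif g (f a)).
{ apply removable with e0; auto; apply Hgc; rewrite Cmod_center; exact He0. }
assert (Comp : cder (fun z => g (f z)) a (Der g (f a) * Der f a)).
{ apply cder_comp; apply Der_spec; auto. }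
assert (Id : cder (fun z => g (f z)) a 1).
{ apply cder_ext_loc with (fun z => z); [|apply cder_id].
  assert (L1 : locally a (fun z : C => Cmod (z - a) < r)) by (apply locally_disk; rewrite Cmod_center; lra).
  assert (L2 := proj1 (continuous_CmodP _ _) (dif_continuous _ _ (Hd a Haa)) e0 He0).
  generalize (filter_and (F := locally a) _ _ L1 L2); apply filter_imp.
  intros z [Z1 Z2]; symmetry; apply Hgf; assumption. }
assert (F := cder_unique _ _ _ _ Comp Id); rewrite HD in F; apply C1_nz; rewrite <- F; ring.
Qed.

(** * Logarithmic derivatives along circles *)

Lemma is_derive_caratheodory (f : R -> R) x l : is_derive f x l <->
  exists p : R -> R, continuous p x /\ p x = l /\ forall y, f y = f x + p y * (y - x).
Proof.
rewrite is_derive_Reals; split.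
- intros H; exists (fun y => if Req_EM_T y x then l else (f y - f x) / (y - x)).
  split; [|split].
  + apply continuous_RP; intros e He; destruct (H e He) as [d Hd]; exists d; intros y Hy.
    destruct (Req_EM_T x x); [|congruence]; destruct (Req_EM_T y x) as [->|Hn].
    { rewrite Rminus_diag, Rabs_R0; exact He. }
    replace y with (x + (y - x)) at 1 by ring; apply Hd; [lra|exact Hy].
  + destruct (Req_EM_T x x); congruence.
  + intros y; destruct (Req_EM_T y x) as [->|Hn]; [ring|field; lra].
- intros [p [Hp [E D]]] e He.
  destruct (proj1 (continuous_RP _ _) Hp e He) as [d L]; exists d; intros h Hh0 Hh.
  rewrite (D (x + h)); replace ((f x + p (x + h) * (x + h - x) - f x) / h) with (p (x + h)) by (field; exact Hh0).
  rewrite <- E; apply L; unfold ball; simpl; unfold AbsRing_ball, abs, minus, plus, opp; simpl.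
  replace (x + h + - x) with h by ring; exact Hh.
Qed.

Definition rder (c : R -> C) (t : R) (l : C) : Prop :=
  exists p : R -> C, continuous p t /\ p t = l /\ forall y, c y = (c t + p y * RtoC (y - t))%C.

Lemma rder_ReIm c t l :
  rder c t l <-> is_derive (fun y => Re (c y)) t (Re l) /\ is_derive (fun y => Im (c y)) t (Im l).
Proof.
rewrite !is_derive_caratheodory; split.
- intros [p [Hp [E D]]]; split.
  + exists (fun y => Re (p y)); split; [apply continuous_Re, Hp|split; [rewrite E; reflexivity|]].
    intros y; rewrite (D y); unfold Re, RtoC; simpl; ring.
  + exists (fun y => Im (p y)); split; [apply continuous_Im, Hp|split; [rewrite E; reflexivity|]].
    intros y; rewrite (D y); unfold Im, RtoC; simpl; ring.
- intros [[p1 [H1 [E1 D1]]] [p2 [H2 [E2 D2]]]].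
  exists (fun y => (p1 y, p2 y)); split; [apply continuous_ReIm; assumption|split].
  + rewrite E1, E2; destruct l; reflexivity.
  + intros y; specialize (D1 y); specialize (D2 y); destruct (c y) as [a b].
    unfold Re, Im in *; simpl in *; rewrite D1, D2; destruct (c t); unfold Cplus, Cmult, RtoC; simpl; f_equal; ring.
Qed.

Lemma rder_comp K c t l m : rder c t l -> cder K (c t) m -> rder (fun y => K (c y)) t (m * l).
Proof.
intros [p [Hp [Ep Dp]]] [k [Hk [Ek Dk]]].
assert (Hc : continuous c t).
{ apply continuous_ext with (fun y => c t + p y * RtoC (y - t))%C; [intros; symmetry; apply Dp|].
  apply continuous_Cplus; [apply continuous_const|apply continuous_Cmult; [exact Hp|]].
  apply (continuous_RtoC (fun y : R => y - t)), (continuous_minus (V := R_NormedModule));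
    [apply continuous_id|apply continuous_const]. }
exists (fun y => k (c y) * p y)%C; split; [|split].
- apply continuous_Cmult; [apply (continuous_comp c k); assumption|exact Hp].
- rewrite Ek, Ep; reflexivity.
- intros y; rewrite (Dk (c y)); replace (c y - c t)%C with (p y * RtoC (y - t))%C by (rewrite (Dp y); ring); ring.
Qed.

Lemma rder_mult c c' t l l' : rder c t l -> rder c' t l' ->
  rder (fun y => c y * c' y)%C t (l * c' t + c t * l').
Proof.
intros [p [Hp [Ep Dp]]] [k [Hk [Ek Dk]]].
exists (fun y => p y * c' t + c t * k y + p y * k y * RtoC (y - t))%C; split; [|split].
- assert (continuous (fun y : R => RtoC (y - t)) t).
  { apply (continuous_RtoC (fun y : R => y - t)), (continuous_minus (V := R_NormedModule));
    [apply continuous_id|apply continuous_const]. }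
  apply continuous_Cplus; [apply continuous_Cplus|].
  + apply continuous_Cmult; [exact Hp|apply continuous_const].
  + apply continuous_Cmult; [apply continuous_const|exact Hk].
  + apply continuous_Cmult; [apply continuous_Cmult; assumption|assumption].
- rewrite Ep, Ek, Rminus_diag; ring.
- intros y; rewrite (Dp y), (Dk y); ring.
Qed.

Lemma rder_line a w t : rder (fun y => a + RtoC y * w)%C t w.
Proof.
exists (fun _ => w); split; [apply continuous_const|split; [reflexivity|]].
intros y; rewrite RtoC_minus; ring.
Qed.

Lemma rder_circle a s t : rder (fun y => a + RtoC s * cis y)%C t (Ci * (RtoC s * cis t)).
Proof.
assert (H : rder (fun y => Cexp (0 + RtoC y * Ci)) t (Cexp (0 + RtoC t * Ci) * Ci)).
{ apply rder_comp; [apply rder_line|apply cder_Cexp]. }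
assert (E : forall y, Cexp (0 + RtoC y * Ci) = cis y) by (intros; unfold cis; f_equal; ring).
destruct H as [p [Hp [Ep Dp]]]; rewrite E in Ep.
exists (fun y => RtoC s * p y)%C; split; [apply continuous_Cmult; [apply continuous_const|exact Hp]|split].
- rewrite Ep; ring.
- intros y; assert (D := Dp y); rewrite !E in D; rewrite D; ring.
Qed.

Lemma is_derive_ln_Cmod K c t l m : rder c t l -> cder K (c t) m -> K (c t) <> 0%C ->
  is_derive (fun y => ln (Cmod (K (c y)))) t (Re (m / K (c t) * l)).
Proof.
intros Hc HK Hne; assert (H := rder_comp _ _ _ _ _ Hc HK).
apply rder_ReIm in H; destruct H as [H1 H2].
set (w := K (c t)) in *.
assert (Hp : 0 < Re w ^ 2 + Im w ^ 2) by (rewrite <- Cmod2_alt; apply pow_lt, Cmod_gt_0, Hne).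
set (n := fun y => Re (K (c y)) ^ 2 + Im (K (c y)) ^ 2).
assert (Hn : is_derive n t (2 * Re w * Re (m * l)%C + 2 * Im w * Im (m * l)%C)).
{ evar_last.
  - apply (is_derive_plus (fun y => Re (K (c y)) ^ 2) (fun y => Im (K (c y)) ^ 2));
      [exact (is_derive_pow _ 2 _ _ H1)|exact (is_derive_pow _ 2 _ _ H2)].
  - unfold plus; simpl; fold w; ring. }
assert (Hln : is_derive ln (n t) (/ n t)) by (apply is_derive_Reals, derivable_pt_lim_ln; exact Hp).
assert (HD := is_derive_scal _ _ (/ 2) _ (is_derive_comp ln n t _ _ Hln Hn)).
(* The identity is needed for all [y]; where [K] vanishes both sides are 0, the default value of
   [ln] at 0. *)
assert (Hl : forall y, / 2 * ln (n y) = ln (Cmod (K (c y)))).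
{ intros y; assert (Hy : n y = Cmod (K (c y)) ^ 2) by (unfold n; rewrite Cmod2_alt; reflexivity).
  rewrite Hy; destruct (Ceq_dec (K (c y)) 0) as [E|E].
  + rewrite E, Cmod_0; unfold ln; destruct (Rlt_dec 0 (0 ^ 2)) as [L|_]; [exfalso; simpl in L; lra|].
    destruct (Rlt_dec 0 0) as [L|_]; [exfalso; exact (Rlt_irrefl _ L)|ring].
  + apply Cmod_gt_0 in E; simpl; rewrite Rmult_1_r, ln_mult by exact E; field. }
apply (is_derive_ext _ _ _ _ Hl).
replace (Re (m / w * l)%C) with (/ 2 * ((2 * Re w * Re (m * l)%C + 2 * Im w * Im (m * l)%C) * / n t)); [exact HD|].
  replace (m / w * l)%C with (m * l / w)%C by (field; exact Hne).
  assert (En : n t = Re w ^ 2 + Im w ^ 2) by reflexivity; rewrite En; clear - Hp.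
  generalize (m * l)%C; intros k; destruct w as [w1 w2], k as [k1 k2].
  unfold Cdiv, Cinv, Cmult, Re, Im in *; simpl in *; field; lra.
Qed.

(** Differentiability is asked in a neighbourhood so that [Der K] is itself differentiable at [z],
    which makes the logarithmic derivative continuous there. *)
Definition reg (K : C -> C) (z : C) : Prop := locally z (dif K) /\ K z <> 0%C.

Lemma reg_dif K z : reg K z -> dif K z.
Proof. intros [H _]; exact (locally_singleton _ _ H). Qed.

Lemma reg_continuous_log_Der K z : reg K z -> continuous (fun z => Der K z / K z)%C z.
Proof.
intros H; apply continuous_Cdiv; [apply dif_continuous, dif_Der, H|apply dif_continuous, reg_dif, H|apply H].
Qed.

Lemma reg_mult K L z : reg K z -> reg L z -> reg (fun y => K y * L y)%C z.
Proof.
intros [H1 N1] [H2 N2]; split; [|apply Cmult_neq_0; assumption].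
generalize (filter_and (F := locally z) _ _ H1 H2); apply filter_imp; intros y [A B]; apply dif_mult; assumption.
Qed.

Lemma reg_locally K z : reg K z -> locally z (reg K).
Proof.
intros [H N]; assert (H' := locally_locally z _ H).
generalize (filter_and (F := locally z) _ _ H'
  (locally_neq0 K z (dif_continuous _ _ (locally_singleton _ _ H)) N)).
apply filter_imp; intros y [A B]; split; assumption.
Qed.


(** The contour integral of [K' / K] divided by [i]. Its real part is the variation of the argument
    of [K] around the circle, and also [s] times the derivative of [ln_mean] in [s]. *)
Definition flux (K : C -> C) (q : C) (s : R) : C :=
  avg (fun z => (z - q) * (Der K z / K z))%C q s.

Definition ln_mean (K : C -> C) (q : C) (s : R) : R :=
  RInt (fun t => ln (Cmod (K (q + RtoC s * cis t)%C))) 0 (2 * PI).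

Lemma locally_annulus q r R z : r < Cmod (z - q) < R -> locally z (fun y : C => r < Cmod (y - q) < R).
Proof.
intros H.
assert (Hc : continuous (fun y => Cmod (y - q)) z).
{ apply (continuous_Cmod (fun y => y - q)%C), dif_continuous, dif_sub_const. }
set (e := Rmin (Cmod (z - q) - r) (R - Cmod (z - q))).
assert (He : 0 < e) by (apply Rmin_pos; lra).
assert (E1 : e <= Cmod (z - q) - r) by apply Rmin_l.
assert (E2 : e <= R - Cmod (z - q)) by apply Rmin_r.
generalize (proj1 (continuous_RP _ _) Hc e He); apply filter_imp; intros y Hy.
apply Rabs_def2 in Hy; lra.
Qed.

Lemma flux_const K q r R s0 s1 : 0 <= r ->
  (forall z, r < Cmod (z - q) < R -> dif K z /\ K z <> 0%C) ->
  r < s0 < R -> r < s1 < R -> flux K q s0 = flux K q s1.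
Proof.
intros Hr H H0 H1; apply avg_const with r R; auto.
intros z Hz; apply dif_mult; [apply dif_sub_const|].
apply dif_div; [|apply H, Hz|apply H, Hz].
apply dif_Der; generalize (locally_annulus q r R z Hz); apply filter_imp; intros y Hy; apply H, Hy.
Qed.

Lemma flux_ext K L q s : 0 <= s -> (forall z, Cmod (z - q) = s -> dif K z /\ locally z (fun y => K y = L y)) ->
  flux K q s = flux L q s.
Proof.
intros Hs H; apply avg_ext; [exact Hs|]; intros z Hz; destruct (H z Hz) as [D E].
rewrite (Der_ext_loc K L z D E), (locally_singleton _ _ E); reflexivity.
Qed.

Lemma continuous_flux_integrand K q s z : (forall z, Cmod (z - q) = s -> reg K z) -> Cmod (z - q) = s ->
  continuous (fun z => (z - q) * (Der K z / K z))%C z.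
Proof.
intros H Hz; apply continuous_Cmult; [apply dif_continuous, dif_sub_const|].
apply reg_continuous_log_Der, H, Hz.
Qed.

Lemma flux_mult K L q s : 0 <= s -> (forall z, Cmod (z - q) = s -> reg K z) ->
  (forall z, Cmod (z - q) = s -> reg L z) ->
  flux (fun z => K z * L z)%C q s = (flux K q s + flux L q s)%C.
Proof.
intros Hs HK HL; unfold flux, avg; rewrite <- CInt_plus; auto.
- apply CInt_ext; auto; intros t _.
  set (z := (q + RtoC s * cis t)%C); assert (Hz : Cmod (z - q) = s) by (apply Cmod_circle, Hs).
  rewrite (Der_eq (fun z => K z * L z)%C z (Der K z * L z + K z * Der L z)).
  + field; split; [apply HL|apply HK]; exact Hz.
  + apply cder_mult; apply Der_spec, reg_dif; auto.
- apply (circle_seg (fun z => (z - q) * (Der K z / K z))%C); auto.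
  intros z Hz; apply continuous_flux_integrand with s; auto.
- apply (circle_seg (fun z => (z - q) * (Der L z / L z))%C); auto.
  intros z Hz; apply continuous_flux_integrand with s; auto.
Qed.

Lemma flux_const_fun (c q : C) s : c <> 0%C -> flux (fun _ => c) q s = 0%C.
Proof.
intros Hc; unfold flux, avg; rewrite (CInt_ext 0 (2 * PI) ltac:(auto) _ (fun _ => RtoC 0)).
- rewrite CInt_const; ring.
- intros t _; rewrite (Der_eq (fun _ => c) _ 0 (cder_const c _)); field; exact Hc.
Qed.

Lemma reg_div K L z : reg K z -> reg L z -> reg (fun y => K y / L y)%C z.
Proof.
intros HK HL; split.
- generalize (filter_and (F := locally z) _ _ (reg_locally K z HK) (reg_locally L z HL)).
  apply filter_imp; intros y [A B]; apply dif_div; [apply reg_dif, A|apply reg_dif, B|apply B].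
- intros E; apply (proj2 HK); replace (K z) with (K z / L z * L z)%C by (field; apply HL).
  rewrite E; ring.
Qed.

Lemma flux_div K L q s : 0 <= s -> (forall z, Cmod (z - q) = s -> reg K z) ->
  (forall z, Cmod (z - q) = s -> reg L z) ->
  flux (fun z => K z / L z)%C q s = (flux K q s - flux L q s)%C.
Proof.
intros Hs HK HL.
assert (E := flux_mult (fun z => K z / L z)%C L q s Hs (fun z Hz => reg_div K L z (HK z Hz) (HL z Hz)) HL).
rewrite <- (flux_ext K) in E; [rewrite E; ring|exact Hs|].
intros z Hz; split; [apply reg_dif; auto|].
generalize (reg_locally L z (HL z Hz)); apply filter_imp; intros y [_ Hy].
change ((K y = K y / L y * L y)%C); field; exact Hy.
Qed.

(** * Lifting the argument along a circle *)

Lemma eq_of_zero_derivative (c : R -> C) a b : (forall t, rder c t 0) -> c a = c b.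
Proof.
intros H.
assert (A : forall (h : R -> R), (forall t, is_derive h t 0) -> h a = h b).
{ intros h Hh; destruct (Rtotal_order a b) as [L|[->|L]]; [|reflexivity|symmetry];
    apply (eq_is_derive h); auto. }
assert (E1 := A (fun t => Re (c t)) (fun t => proj1 (proj1 (rder_ReIm _ _ _) (H t)))).
assert (E2 := A (fun t => Im (c t)) (fun t => proj2 (proj1 (rder_ReIm _ _ _) (H t)))).
simpl in *; destruct (c a), (c b); unfold Re, Im in *; simpl in *; congruence.
Qed.

Lemma rder_CInt f t : (forall t, continuous f t) -> rder (fun y => CInt f 0 y) t (f t).
Proof.
intros H; apply rder_ReIm; split.
- apply (is_derive_RInt (fun y => Re (f y)) (fun y => RInt (fun y => Re (f y)) 0 y) 0).
  + apply filter_forall; intros y; apply (RInt_correct (V := R_CompleteNormedModule)).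
    apply (ex_RInt_continuous (V := R_CompleteNormedModule)); intros; apply continuous_Re, H.
  + apply continuous_Re, H.
- apply (is_derive_RInt (fun y => Im (f y)) (fun y => RInt (fun y => Im (f y)) 0 y) 0).
  + apply filter_forall; intros y; apply (RInt_correct (V := R_CompleteNormedModule)).
    apply (ex_RInt_continuous (V := R_CompleteNormedModule)); intros; apply continuous_Im, H.
  + apply continuous_Im, H.
Qed.

Section Lift.
Variables (K : C -> C) (q : C) (s : R).
Hypotheses (Hs : 0 <= s) (HK : forall z, Cmod (z - q) = s -> reg K z).

(** A branch of [- i * log K] along the circle, normalised to vanish at [t = 0]: its real part is
    the change of argument and minus its imaginary part the change of log-modulus. *)
Definition lift (t : R) : C :=
  CInt (fun t => let z := (q + RtoC s * cis t)%C in (z - q) * (Der K z / K z))%C 0 t.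

Lemma lift_integrand_continuous t :
  continuous (fun t => let z := (q + RtoC s * cis t)%C in (z - q) * (Der K z / K z))%C t.
Proof.
apply (circle_seg (fun z => (z - q) * (Der K z / K z))%C q s t t Hs); [|lra].
intros z Hz; apply continuous_flux_integrand with s; auto.
Qed.

Lemma lift_0 : lift 0 = 0%C.
Proof. unfold lift, CInt; rewrite !RInt_point; reflexivity. Qed.

Lemma lift_spec t : K (q + RtoC s * cis t)%C = (K (q + RtoC s * cis 0)%C * Cexp (Ci * lift t))%C.
Proof.
(* Dividing [K] by the exponential of its candidate logarithm gives a curve with zero derivative. *)
set (E := fun t => (K (q + RtoC s * cis t) * Cexp (0 - Ci * lift t))%C).
assert (HE : E t = E 0).
{ apply eq_of_zero_derivative; clear t; intros t.
  set (z := (q + RtoC s * cis t)%C).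
  assert (Hz : Cmod (z - q) = s) by (apply Cmod_circle, Hs).
  replace (RtoC 0) with
    ((Der K z * (Ci * (RtoC s * cis t))) * Cexp (0 - Ci * lift t)
      + K z * (Cexp (0 - Ci * lift t) * ((0 - Ci) * ((z - q) * (Der K z / K z)))))%C.
  - apply (rder_mult (fun t => K (q + RtoC s * cis t)%C) (fun t => Cexp (0 - Ci * lift t))).
    + apply (rder_comp K (fun t => q + RtoC s * cis t)%C); [apply rder_circle|].
      apply Der_spec, reg_dif, HK, Hz.
    + apply (rder_comp Cexp (fun t => 0 - Ci * lift t)%C); [|apply cder_Cexp].
      apply (rder_comp (fun w => 0 - Ci * w)%C lift).
      * apply (rder_CInt _ t lift_integrand_continuous).
      * replace (0 - Ci)%C with (0 - Ci * 1)%C by ring.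
        apply cder_minus; [apply cder_const|apply cder_scal, cder_id].
  - replace (RtoC s * cis t)%C with (z - q)%C by (unfold z; ring).
    field; apply HK, Hz. }
assert (E0 : E 0 = K (q + RtoC s * cis 0)%C).
{ unfold E; rewrite lift_0.
  replace (0 - Ci * 0)%C with (RtoC 0) by ring; rewrite Cexp_0; ring. }
rewrite <- E0, <- HE; unfold E; rewrite <- Cmult_assoc, <- Cexp_plus.
replace (0 - Ci * lift t + Ci * lift t)%C with (RtoC 0) by ring; rewrite Cexp_0; ring.
Qed.

Lemma lift_2PI : lift (2 * PI) = flux K q s.
Proof. reflexivity. Qed.

Lemma rder_lift t : let z := (q + RtoC s * cis t)%C in rder lift t ((z - q) * (Der K z / K z)).
Proof. apply (rder_CInt _ t lift_integrand_continuous). Qed.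

Lemma continuous_Re_lift t : continuous (fun t => Re (lift t)) t.
Proof.
destruct (proj1 (rder_ReIm _ _ _) (rder_lift t)) as [H _].
apply (ex_derive_continuous (V := R_NormedModule)); eexists; exact H.
Qed.

End Lift.

Lemma cis_eq_1 x : cis x = 1%C -> exists k : Z, x = 2 * PI * IZR k.
Proof.
rewrite cisE; intros E; injection E as E _.
replace x with (2 * (x / 2)) in E by field; rewrite cos_2a_sin in E.
assert (S : sin (x / 2) = 0) by nra.
destruct (sin_eq_0_0 _ S) as [k Hk]; exists k; lra.
Qed.

Lemma cis_plus x y : cis (x + y) = (cis x * cis y)%C.
Proof. unfold cis; rewrite <- Cexp_plus, RtoC_plus; f_equal; ring. Qed.

Lemma Cexp_Ci_mult (c : C) : Cexp (Ci * c) = (RtoC (exp (- Im c)) * cis (Re c))%C.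
Proof.
rewrite <- Cexp_pair; f_equal; destruct c; unfold Ci, Cmult, Re, Im; simpl; f_equal; ring.
Qed.

Lemma IVT_continuous (h : R -> R) a b y : (forall t, continuous h t) -> a <= b ->
  Rmin (h a) (h b) <= y <= Rmax (h a) (h b) -> exists x, a <= x <= b /\ h x = y.
Proof.
intros Hc Hab Hy; destruct (IVT_gen h a b y) as [x [Hx E]]; [|exact Hy|].
- intros t; apply continuity_pt_filterlim, Hc.
- exists x; rewrite Rmin_left, Rmax_right in Hx by exact Hab; auto.
Qed.

(** The lifted argument, measured from the ray, is continuous and never a multiple of [2 * PI], yet
    it changes by a multiple of [2 * PI] over the circle; by the intermediate value theorem that
    change is 0. *)
Lemma flux_avoiding_ray K q s be : 0 <= s -> (forall z, Cmod (z - q) = s -> reg K z) ->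
  (forall z rho, Cmod (z - q) = s -> 0 < rho -> K z <> (RtoC rho * cis be)%C) ->
  Re (flux K q s) = 0.
Proof.
intros Hs HK Hray.
set (K0 := K (q + RtoC s * cis 0)%C).
assert (HK0 : 0 < Cmod K0) by (apply Cmod_gt_0, HK, Cmod_circle, Hs).
destruct (polar K0 0) as [al [_ Eal]].
replace (K0 - 0)%C with K0 in Eal by ring.
set (th := fun t => al + Re (lift K q s t) - be).
assert (Hth : forall t, continuous th t).
{ intros t; apply (continuous_minus (V := R_NormedModule)); [|apply continuous_const].
  apply (continuous_plus (V := R_NormedModule)); [apply continuous_const|apply continuous_Re_lift; assumption]. }
assert (Hno : forall t (k : Z), th t <> 2 * PI * IZR k).
{ intros t k E.
  apply (Hray (q + RtoC s * cis t)%C (Cmod K0 * exp (- Im (lift K q s t)))).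
  - apply Cmod_circle, Hs.
  - apply Rmult_lt_0_compat; [exact HK0|apply exp_pos].
  - rewrite lift_spec by assumption; fold K0; rewrite Cexp_Ci_mult, Eal at 1.
    replace (Re (lift K q s t)) with (be + 2 * PI * IZR k + - al) by (rewrite <- E; unfold th; ring).
    rewrite !cis_plus, RtoC_mult.
    replace (cis (2 * PI * IZR k)) with (RtoC 1) by (symmetry; apply Cexp_periodic_Z).
    assert (I : (cis al * cis (- al) = 1)%C).
    { rewrite <- cis_plus, Rplus_opp_r, cisE, cos_0, sin_0; reflexivity. }
    transitivity (RtoC (Cmod K0) * RtoC (exp (- Im (lift K q s t))) * cis be * (cis al * cis (- al)))%C; [ring|].
    rewrite I; ring. }
assert (Hk : exists k : Z, Re (flux K q s) = 2 * PI * IZR k).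
{ apply cis_eq_1.
  assert (E := lift_spec K q s Hs HK (2 * PI)).
  replace (cis (2 * PI)) with (cis 0) in E by (rewrite !cisE, cos_2PI, sin_2PI, cos_0, sin_0; reflexivity).
  fold K0 in E; rewrite lift_2PI, Cexp_Ci_mult in E.
  assert (N : K0 <> 0%C) by (apply Cmod_gt_0, HK0).
  assert (E1 : (RtoC (exp (- Im (flux K q s))) * cis (Re (flux K q s)) = 1)%C).
  { transitivity (/ K0 * (K0 * (RtoC (exp (- Im (flux K q s))) * cis (Re (flux K q s)))))%C; [field; exact N|].
    rewrite <- E; field; exact N. }
  assert (M : Cmod (RtoC (exp (- Im (flux K q s))) * cis (Re (flux K q s))) = 1) by (rewrite E1; apply Cmod_1).
  rewrite Cmod_mult, Cmod_cis, Cmod_R, Rabs_right, Rmult_1_r in M by (left; apply exp_pos).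
  rewrite M in E1; rewrite <- E1; ring. }
destruct Hk as [k Hk].
assert (T0 : th (2 * PI) = th 0 + 2 * PI * IZR k).
{ unfold th; rewrite lift_2PI, lift_0, Hk; unfold Re, RtoC; simpl; ring. }
destruct (Z.eq_dec k 0) as [->|Hk0]; [rewrite Hk; ring|exfalso].
assert (HP := twoPI_pos).
set (x := th 0 / (2 * PI)); destruct (archimed x) as [A1 A2].
assert (Ex : th 0 = 2 * PI * x) by (unfold x; field; lra).
(* The end values differ by at least [2 * PI], so a multiple of [2 * PI] lies between them: the
   largest one not above [th 0] if [k < 0], the first one above [th 0] otherwise. *)
assert (P : exists j : Z, Rmin (th 0) (th (2 * PI)) <= 2 * PI * IZR j <= Rmax (th 0) (th (2 * PI))).
{ rewrite T0, Ex; destruct (Z_lt_le_dec k 0) as [L|L].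
  - exists (up x - 1)%Z; rewrite minus_IZR.
    assert (IZR k <= -1) by (apply IZR_le; lia).
    rewrite Rmin_right, Rmax_left by nra; nra.
  - exists (up x); assert (1 <= IZR k) by (apply IZR_le; lia).
    rewrite Rmin_left, Rmax_right by nra; nra. }
destruct P as [j Hj].
destruct (IVT_continuous th 0 (2 * PI) _ Hth twoPI_nonneg Hj) as [t [_ Et]].
exact (Hno t j Et).
Qed.

(** * Logarithmic means and boundary degrees *)

Section LogMean.
Variables (K : C -> C) (q : C) (r R : R).
Hypotheses (Hr : 0 <= r) (HK : forall z, r < Cmod (z - q) < R -> dif K z /\ K z <> 0%C).

Lemma annulus_reg z : r < Cmod (z - q) < R -> reg K z.
Proof.
intros Hz; split; [|apply HK, Hz].
generalize (locally_annulus q r R z Hz); apply filter_imp; intros y Hy; apply HK, Hy.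
Qed.

Let G (s t : Rdefinitions.R) : Rdefinitions.R :=
  let z := (q + RtoC s * cis t)%C in Re (Der K z / K z * cis t).

Lemma ln_Cmod_radial_derive s t : r < s < R ->
  is_derive (fun u => ln (Cmod (K (q + RtoC u * cis t)%C))) s (G s t).
Proof.
intros Hs; assert (Hz : reg K (q + RtoC s * cis t)%C).
{ apply annulus_reg; rewrite Cmod_circle; lra. }
apply (is_derive_ln_Cmod K (fun u => q + RtoC u * cis t)%C); [apply rder_line|apply Der_spec, reg_dif, Hz|apply Hz].
Qed.

Lemma ln_mean_derive s : r < s < R ->
  is_derive (ln_mean K q) s (RInt (fun t => G s t) 0 (2 * PI)).
Proof.
intros Hs.
assert (Loc : locally s (fun u : Rdefinitions.R => r < u < R)).
{ set (e := Rmin (s - r) (R - s)); assert (He : 0 < e) by (apply Rmin_pos; lra).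
  assert (e <= s - r) by apply Rmin_l; assert (e <= R - s) by apply Rmin_r.
  exists (mkposreal e He); intros y Hy; unfold ball in Hy; simpl in Hy.
  unfold AbsRing_ball, abs, minus, plus, opp in Hy; simpl in Hy; apply Rabs_def2 in Hy; lra. }
assert (D : forall u t, r < u < R -> Derive (fun u => ln (Cmod (K (q + RtoC u * cis t)%C))) u = G u t)
  by (intros u t Hu; apply is_derive_unique, ln_Cmod_radial_derive, Hu).
rewrite (RInt_ext (fun t => G s t) (fun t => Derive (fun u => ln (Cmod (K (q + RtoC u * cis t)%C))) s))
  by (intros t _; symmetry; apply D, Hs).
apply (is_derive_RInt_param (fun u t => ln (Cmod (K (q + RtoC u * cis t)%C)))).
- generalize Loc; apply filter_imp; intros u Hu t _; eexists; apply ln_Cmod_radial_derive, Hu.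
- intros t _; apply continuity_2d_pt_ext_loc with G.
  + destruct Loc as [d Hd]; exists d; intros u v Hu _; symmetry; apply D, Hd, Hu.
  + apply continuity_2d_pt_filterlim.
    change (continuous (fun p : Rdefinitions.R * Rdefinitions.R => G (fst p) (snd p)) (s, t)).
    apply (continuous_Re (fun p : Rdefinitions.R * Rdefinitions.R =>
      let z := (q + RtoC (fst p) * cis (snd p))%C in Der K z / K z * cis (snd p))%C).
    assert (Hci : continuous (fun p : Rdefinitions.R * Rdefinitions.R => cis (snd p)) (s, t)).
    { apply (continuous_comp snd cis); [apply continuous_snd|apply continuous_cis]. }
    apply continuous_Cmult; [|exact Hci].
    apply (continuous_comp (fun p : Rdefinitions.R * Rdefinitions.R => q + RtoC (fst p) * cis (snd p))%C (fun z => Der K z / K z)%C).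
    * apply continuous_Cplus; [apply continuous_const|apply continuous_Cmult; [|exact Hci]].
      apply (continuous_RtoC (fun p : Rdefinitions.R * Rdefinitions.R => fst p)), continuous_fst.
    * apply reg_continuous_log_Der, annulus_reg; simpl; rewrite Cmod_circle; lra.
- generalize Loc; apply filter_imp; intros u Hu.
  apply ex_RInt_seg; auto; intros t _.
  apply (continuous_comp (fun t => Cmod (K (q + RtoC u * cis t)%C)) ln).
  + apply continuous_Cmod, (circle_seg K q u t t); [lra| |lra].
    intros z Hz; apply dif_continuous, reg_dif, annulus_reg; lra.
  + apply continuity_pt_filterlim, derivable_continuous_pt; exists (/ Cmod (K (q + RtoC u * cis t)%C)).
    apply derivable_pt_lim_ln, Cmod_gt_0, annulus_reg; rewrite Cmod_circle; lra.
Qed.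

(** The derivative of [ln_mean] at radius [s] is the real part of the flux divided by [s]. *)
Lemma ln_mean_const s0 s1 : (forall s, r < s < R -> Re (flux K q s) = 0) ->
  r < s0 < R -> r < s1 < R -> ln_mean K q s0 = ln_mean K q s1.
Proof.
intros HF H0 H1.
assert (Z : forall s, r < s < R -> is_derive (ln_mean K q) s 0).
{ intros s Hs; evar_last; [apply ln_mean_derive, Hs|].
  assert (E : Re (flux K q s) = s * RInt (fun t => G s t) 0 (2 * PI)).
  { unfold flux, avg, CInt, Re at 1; simpl.
    transitivity (RInt (fun t => scal s (G s t)) 0 (2 * PI)).
    - apply RInt_ext; intros t _; unfold G, scal; simpl; unfold mult; simpl.
      replace (q + RtoC s * cis t - q)%C with (RtoC s * cis t)%C by ring.
      generalize (Der K (q + RtoC s * cis t) / K (q + RtoC s * cis t))%C (cis t); intros [a b] [c d].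
      unfold Cmult, Re, RtoC; simpl; ring.
    - enough (Hex : ex_RInt (fun t => G s t) 0 (2 * PI))
        by exact (RInt_scal (V := R_CompleteNormedModule) _ 0 (2 * PI) s Hex).
      apply ex_RInt_seg; auto; intros t _.
      apply (continuous_Re (fun t => let z := (q + RtoC s * cis t)%C in Der K z / K z * cis t)%C).
      apply continuous_Cmult; [|apply continuous_cis].
      apply (circle_seg (fun z => Der K z / K z)%C q s t t); [lra| |lra].
      intros z Hz; apply reg_continuous_log_Der, annulus_reg; lra. }
  rewrite (HF s Hs) in E; apply Rmult_eq_reg_l with s; [|lra]; rewrite <- E; ring. }
destruct (Rtotal_order s0 s1) as [L|[->|L]]; [|reflexivity|symmetry];
  apply (eq_is_derive (ln_mean K q)); auto; intros s Hs; apply Z; lra.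
Qed.

End LogMean.

Lemma derive_nonpos_of_max (h : R -> R) x l e : 0 < e -> is_derive h x l ->
  (forall y, x < y < x + e -> h y <= h x) -> l <= 0.
Proof.
intros He Hd Hmax; apply Rnot_lt_le; intros Hl.
apply is_derive_Reals in Hd; destruct (Hd (l / 2) ltac:(lra)) as [d Hd'].
assert (Hd0 := cond_pos d).
set (k := Rmin (d / 2) (e / 2)).
assert (Hk : 0 < k) by (apply Rmin_pos; lra).
assert (k <= d / 2) by apply Rmin_l; assert (k <= e / 2) by apply Rmin_r.
assert (A := Hd' k ltac:(lra) ltac:(rewrite Rabs_right; lra)).
apply Rabs_def2 in A; assert (B := Hmax (x + k) ltac:(lra)).
assert ((h (x + k) - h x) / k <= 0).
{ apply Rmult_le_reg_r with k; [exact Hk|]; unfold Rdiv; rewrite Rmult_assoc, Rinv_l; lra. }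
lra.
Qed.

Lemma NoDup_map_on {A B : Type} (h : A -> B) (l : list A) :
  (forall x y, In x l -> In y l -> h x = h y -> x = y) -> NoDup l -> NoDup (map h l).
Proof.
intros Hi Hl; induction Hl as [|x l Hx Hl IH]; simpl; constructor.
- intros Hin; apply in_map_iff in Hin; destruct Hin as [y [E Hy]].
  apply Hx; replace x with y; [exact Hy|]; apply Hi; simpl; auto.
- apply IH; intros y z Hy Hz; apply Hi; simpl; auto.
Qed.

Lemma cis_inj t t' : 0 <= t < 2 * PI -> 0 <= t' < 2 * PI -> cis t = cis t' -> t = t'.
Proof.
intros Ht Ht' E; assert (HP := twoPI_pos).
assert (E1 : cis (t - t') = 1%C).
{ unfold Rminus; rewrite cis_plus, E, <- cis_plus, Rplus_opp_r, cisE, cos_0, sin_0; reflexivity. }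
destruct (cis_eq_1 _ E1) as [k Hk].
assert (-1 < IZR k < 1) by nra.
assert (k = 0)%Z by (destruct H as [A B]; apply (lt_IZR (-1)) in A; apply (lt_IZR _ 1) in B; lia).
subst k; lra.
Qed.

Section Degree.
Variables (F : C -> C) (q : C) (r e : R) (d : nat).
Hypotheses (Hr : 0 < r) (He : 0 < e)
  (HF : forall z, Cmod (z - q) = r -> reg F z /\ Cmod (F z) = 1)
  (Hout : forall z, r < Cmod (z - q) < r + e -> Cmod (F z) <= 1)
  (Hcard : forall w, Cmod w = 1 -> has_card (fun z => Cmod (z - q) = r /\ F z = w) d).

Let c t := (q + RtoC r * cis t)%C.
Let a t := Re (lift F q r t).
Let w0 := F (c 0).

Lemma circle_c t : Cmod (c t - q) = r.
Proof. apply Cmod_circle; lra. Qed.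

Lemma HFreg z : Cmod (z - q) = r -> reg F z.
Proof. intros Hz; apply HF, Hz. Qed.

Lemma c_inj t t' : 0 <= t < 2 * PI -> 0 <= t' < 2 * PI -> c t = c t' -> t = t'.
Proof.
intros Ht Ht' E; apply cis_inj; auto.
assert (N : RtoC r <> 0%C) by (intros E0; apply RtoC_inj in E0; lra).
unfold c in E; replace (cis t) with ((q + RtoC r * cis t - q) / RtoC r)%C by (field; exact N).
rewrite E; field; exact N.
Qed.

(** [Cmod (F z) = 1] on the circle forces the lift to be real, so [F] only rotates its starting
    value, by the angle [a t]. *)
Lemma F_on_circle t : F (c t) = (w0 * cis (a t))%C.
Proof.
assert (E := lift_spec F q r ltac:(lra) HFreg t); fold (c t) in E; fold (c 0) w0 in E.
rewrite Cexp_Ci_mult in E; fold (a t) in E.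
assert (M : Cmod (F (c t)) = 1) by apply HF, circle_c.
assert (M0 : Cmod w0 = 1) by apply HF, circle_c.
rewrite E, !Cmod_mult, M0, Cmod_cis, Cmod_R, Rabs_right in M by (left; apply exp_pos).
replace (exp (- Im (lift F q r t))) with 1 in E by lra.
rewrite E; ring.
Qed.

(* Cauchy-Riemann: since [|F| <= 1] outside the circle, the argument of [F] is nonincreasing along it. *)
Lemma a_derive_nonpos t : exists l, is_derive a t l /\ l <= 0.
Proof.
assert (H := rder_lift F q r ltac:(lra) HFreg t); cbv zeta in H; fold (c t) in H.
apply rder_ReIm in H; destruct H as [H _]; eexists; split; [exact H|].
assert (Hz := circle_c t); assert (Hreg := HFreg _ Hz).
assert (D : is_derive (fun u => ln (Cmod (F (q + RtoC u * cis t)%C))) r (Re (Der F (c t) / F (c t) * cis t))).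
{ apply (is_derive_ln_Cmod F (fun u => q + RtoC u * cis t)%C); [apply rder_line|apply Der_spec, reg_dif, Hreg|apply Hreg]. }
assert (N : Re (Der F (c t) / F (c t) * cis t) <= 0).
{ apply derive_nonpos_of_max with (1 := He) (2 := D); intros y Hy.
  fold (c t); rewrite (proj2 (HF _ Hz)), ln_1.
  assert (B := Hout (q + RtoC y * cis t)%C ltac:(rewrite Cmod_circle; lra)).
  destruct (Rle_lt_dec (Cmod (F (q + RtoC y * cis t)%C)) 0) as [L|L].
  - unfold ln; destruct (Rlt_dec 0 _) as [L'|_]; [exfalso; lra|apply Rle_refl].
  - rewrite <- ln_1; destruct B as [B|B]; [left; apply ln_increasing; assumption|rewrite B; lra]. }
replace (Re ((c t - q) * (Der F (c t) / F (c t)))) with (r * Re (Der F (c t) / F (c t) * cis t)); [nra|].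
unfold c at 3; replace (q + RtoC r * cis t - q)%C with (RtoC r * cis t)%C by ring.
generalize (Der F (c t) / F (c t))%C (cis t); intros [x y] [x' y']; unfold Cmult, RtoC, Re; simpl; ring.
Qed.

Lemma a_decr t t' : t <= t' -> a t' <= a t.
Proof.
intros H.
set (da := fun t => proj1_sig (constructive_indefinite_description _ (a_derive_nonpos t))).
assert (Hda : forall t, is_derive a t (da t) /\ da t <= 0)
  by (intros x; exact (proj2_sig (constructive_indefinite_description _ (a_derive_nonpos x)))).
destruct H as [H| ->]; [|lra].
destruct (MVT_gen a t t' da) as [x [_ E]].
- intros x _; apply Hda.
- intros x _; apply continuity_pt_filterlim, (ex_derive_continuous (V := R_NormedModule)); eexists; apply Hda.
- assert (B := proj2 (Hda x)); nra.
Qed.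

Lemma fibre_list : exists l, NoDup l /\ length l = d /\ forall z, In z l <-> Cmod (z - q) = r /\ F z = w0.
Proof. apply Hcard, HF, circle_c. Qed.

(** Constancy at a multiple of [2 * PI] on an interval would put [d + 1] distinct points into a
    fibre of [d] points. With monotonicity this makes each such level be attained at most once. *)
Lemma a_not_constant u v k : 0 <= u -> u < v -> v <= 2 * PI -> a u = 2 * PI * IZR k -> a v = a u -> False.
Proof.
intros Hu Huv Hv Eu Ev.
destruct fibre_list as [l [_ [Hl Hin]]].
set (s := fun i => u + (v - u) * (INR i / INR (d + 1))).
assert (HD : 0 < INR (d + 1)) by (apply lt_0_INR; lia).
assert (Hs : forall i, (i < d + 1)%nat -> u <= s i < v).
{ intros i Hi; apply lt_INR in Hi; assert (A := pos_INR i).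
  assert (0 <= INR i / INR (d + 1) < 1).
  { split; [apply Rle_mult_inv_pos; lra|]; apply Rmult_lt_reg_r with (INR (d + 1)); [exact HD|].
    unfold Rdiv; rewrite Rmult_assoc, Rinv_l; lra. }
  unfold s; nra. }
set (L := map (fun i => c (s i)) (seq 0 (d + 1))).
assert (ND : NoDup L).
{ apply NoDup_map_on; [|apply seq_NoDup].
  intros i j Hi Hj E; apply in_seq in Hi; apply in_seq in Hj.
  assert (A := Hs i ltac:(lia)); assert (B := Hs j ltac:(lia)).
  apply c_inj in E; [|lra|lra]; unfold s in E.
  apply INR_eq; apply Rmult_eq_reg_r with (/ INR (d + 1)); [|apply Rinv_neq_0_compat; lra].
  apply Rmult_eq_reg_l with (v - u); [unfold Rdiv in E; lra|lra]. }
assert (Incl : incl L l).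
{ intros z Hz; apply in_map_iff in Hz; destruct Hz as [i [<- Hi]]; apply in_seq in Hi.
  assert (A := Hs i ltac:(lia)); apply Hin; split; [apply circle_c|].
  rewrite F_on_circle.
  assert (a (s i) = 2 * PI * IZR k).
  { assert (B1 := a_decr u (s i) ltac:(lra)); assert (B2 := a_decr (s i) v ltac:(lra)); lra. }
  rewrite H; unfold cis; rewrite Cexp_periodic_Z; ring. }
assert (N := NoDup_incl_length ND Incl).
unfold L in N; rewrite length_map, length_seq in N; lia.
Qed.

(** The angle [a] decreases from 0 to some [- 2 * PI * m]. The fibre through the starting point
    consists of the points where [a] is a multiple of [2 * PI]; each level [- 2 * PI * j] with
    [j < m] is attained exactly once on [[0, 2 * PI)], whence [m = d]. *)
Lemma degree_flux : Re (flux F q r) = - (2 * PI * INR d).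
Proof.
assert (HP := twoPI_pos).
assert (W0 : w0 <> 0%C) by (apply HFreg, circle_c).
assert (a0 : a 0 = 0) by (unfold a; rewrite lift_0; reflexivity).
assert (EndZ : forall t, F (c t) = w0 -> exists k : Z, a t = 2 * PI * IZR k).
{ intros t E; rewrite F_on_circle in E; apply cis_eq_1.
  transitivity (/ w0 * (w0 * cis (a t)))%C; [field; exact W0|rewrite E; field; exact W0]. }
destruct (EndZ (2 * PI)) as [k Hk].
{ unfold w0, c; rewrite !cisE, cos_2PI, sin_2PI, cos_0, sin_0; reflexivity. }
assert (Hk0 : (k <= 0)%Z).
{ assert (A := a_decr 0 (2 * PI) ltac:(lra)); apply le_IZR.
  rewrite Hk, a0 in A; nra. }
set (m := Z.to_nat (- k)).
assert (Em : a (2 * PI) = - (2 * PI * INR m)).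
{ rewrite Hk; unfold m; rewrite INR_IZR_INZ, Z2Nat.id, opp_IZR by lia; ring. }
change (Re (flux F q r)) with (a (2 * PI)); rewrite Em.
replace d with m; [reflexivity|].
assert (Times : forall j, exists t, (j < m)%nat -> 0 <= t < 2 * PI /\ a t = - (2 * PI * INR j)).
{ intros j; destruct (le_lt_dec m j) as [Hj|Hj]; [exists 0; lia|].
  apply lt_INR in Hj; assert (Pj := pos_INR j).
  destruct (IVT_continuous a 0 (2 * PI) (- (2 * PI * INR j))) as [t [Ht Et]].
  - intros t; destruct (a_derive_nonpos t) as [l [Hl _]].
    apply (ex_derive_continuous (V := R_NormedModule)); eexists; exact Hl.
  - lra.
  - rewrite a0, Em, Rmin_right, Rmax_left by nra; nra.
  - exists t; intros _; split; [|exact Et]; split; [lra|].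
    destruct (proj2 Ht) as [|E]; [assumption|]; subst t; exfalso; nra. }
set (T := fun j => proj1_sig (constructive_indefinite_description _ (Times j))).
assert (HT : forall j, (j < m)%nat -> 0 <= T j < 2 * PI /\ a (T j) = - (2 * PI * INR j))
  by (intros j; exact (proj2_sig (constructive_indefinite_description _ (Times j)))).
set (L := map (fun j => c (T j)) (seq 0 m)).
assert (ND : NoDup L).
{ apply NoDup_map_on; [|apply seq_NoDup].
  intros i j Hi Hj E; apply in_seq in Hi; apply in_seq in Hj.
  destruct (HT i ltac:(lia)) as [A A']; destruct (HT j ltac:(lia)) as [B B'].
  apply c_inj in E; [|exact A|exact B]; rewrite E, B' in A'.
  apply INR_eq; nra. }
destruct fibre_list as [l [Hl1 [Hl2 Hin]]].
assert (I1 : incl L l).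
{ intros z Hz; apply in_map_iff in Hz; destruct Hz as [j [<- Hj]]; apply in_seq in Hj.
  destruct (HT j ltac:(lia)) as [A A']; apply Hin; split; [apply circle_c|].
  rewrite F_on_circle, A'.
  replace (- (2 * PI * INR j)) with (2 * PI * IZR (- Z.of_nat j)) by (rewrite opp_IZR, <- INR_IZR_INZ; ring).
  unfold cis; rewrite Cexp_periodic_Z; ring. }
assert (I2 : incl l L).
{ intros z Hz; apply Hin in Hz; destruct Hz as [Hz Ez].
  destruct (polar z q) as [t [Ht Et]]; rewrite Hz in Et; fold (c t) in Et; subst z.
  destruct (EndZ t Ez) as [k' Hk'].
  assert (B1 := a_decr 0 t ltac:(lra)); assert (B2 := a_decr t (2 * PI) ltac:(lra)).
  assert (K0 : (k' <= 0)%Z) by (apply le_IZR; rewrite a0, Hk' in B1; nra).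
  set (j := Z.to_nat (- k')).
  assert (Ej : a t = - (2 * PI * INR j)).
  { rewrite Hk'; unfold j; rewrite INR_IZR_INZ, Z2Nat.id, opp_IZR by lia; ring. }
  assert (Hjm : (j <= m)%nat) by (apply INR_le; rewrite Em, Ej in B2; nra).
  destruct (le_lt_eq_dec _ _ Hjm) as [Hj|Hj].
  - destruct (HT j Hj) as [A A'].
    assert (T j = t).
    { destruct (Rtotal_order (T j) t) as [X|[X|X]]; [exfalso|exact X|exfalso].
      - apply (a_not_constant (T j) t k'); lra.
      - apply (a_not_constant t (T j) k'); lra. }
    rewrite <- H; apply (in_map (fun j => c (T j))), in_seq; lia.
  (* Level [m] is already that of the endpoint [2 * PI], which is the same point of the circle as
     [t = 0]; an earlier time at this level would make [a] constant in between. *)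
  - exfalso; apply (a_not_constant t (2 * PI) k'); try lra; rewrite Em, Ej, Hj; reflexivity. }
assert (N1 := NoDup_incl_length ND I1); assert (N2 := NoDup_incl_length Hl1 I2).
unfold L in N1, N2; rewrite length_map, length_seq in N1, N2; lia.
Qed.

End Degree.

(** * Circular domains *)

Lemma finite_uniform (g : nat) (Q : nat -> R -> Prop) :
  (forall l e e', 0 < e' <= e -> Q l e -> Q l e') ->
  (forall l, (l <= g)%nat -> exists e, 0 < e /\ Q l e) ->
  exists e, 0 < e /\ forall l, (l <= g)%nat -> Q l e.
Proof.
intros Hm; induction g as [|g IH]; intros H.
- destruct (H 0%nat (le_n _)) as [e [He HQ]]; exists e; split; [exact He|].
  intros l Hl; replace l with 0%nat by lia; exact HQ.
- destruct IH as [e [He HQ]]; [intros l Hl; apply H; lia|].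
  destruct (H (S g) (le_n _)) as [e' [He' HQ']].
  assert (P : 0 < Rmin e e') by (apply Rmin_pos; assumption).
  exists (Rmin e e'); split; [exact P|]; intros l Hl.
  destruct (le_lt_eq_dec _ _ Hl) as [L| ->].
  + apply Hm with e; [split; [exact P|apply Rmin_l]|apply HQ; lia].
  + apply Hm with e'; [split; [exact P|apply Rmin_r]|exact HQ'].
Qed.

Lemma finite_max (g : nat) (c : nat -> R) : exists l, (l <= g)%nat /\ forall m, (m <= g)%nat -> c m <= c l.
Proof.
induction g as [|g [l [Hl H]]].
- exists 0%nat; split; [lia|]; intros m Hm; replace m with 0%nat by lia; lra.
- destruct (Rle_lt_dec (c (S g)) (c l)) as [L|L].
  + exists l; split; [lia|]; intros m Hm; destruct (le_lt_eq_dec _ _ Hm) as [L'| ->]; [apply H; lia|exact L].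
  + exists (S g); split; [lia|]; intros m Hm; destruct (le_lt_eq_dec _ _ Hm) as [L'| ->]; [|lra].
    apply Rle_trans with (c l); [apply H; lia|lra].
Qed.

(** A tube lemma: a point near the circle is at distance [Rabs (Cmod (z - a) - s)] from its radial
    projection onto the circle. *)
Lemma circle_nbhd (P : C -> Prop) a s : 0 < s -> (forall b, Cmod (b - a) = s -> locally b P) ->
  exists e, 0 < e /\ forall z, Rabs (Cmod (z - a) - s) < e -> P z.
Proof.
intros Hs H.
destruct (compact_uniform (fun z => Cmod (z - a) = s) (s + Cmod a)
  (fun y e => forall z, Cmod (z - y) < e -> P z)) as [e [He Q]].
- intros z Hz; apply Cmod_bounded_disk; lra.
- apply Cclosed_circle.
- intros y e e' He Q z Hz; apply Q; lra.
- intros y Hy; destruct (proj1 (locally_CmodP _ _) (H y Hy)) as [d [Hd L]].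
  exists (d / 2); split; [lra|]; apply locally_CmodP; exists (d / 2); split; [lra|].
  intros y' Hy' _ z Hz; apply L.
  assert (T := Cmod_sub_triangle y' z y); lra.
- exists (Rmin e s); split; [apply Rmin_pos; assumption|]; intros z Hz.
  assert (E1 : Rmin e s <= e) by apply Rmin_l; assert (E2 : Rmin e s <= s) by apply Rmin_r.
  set (k := Cmod (z - a)) in *.
  assert (Hk : 0 < k) by (apply Rabs_def2 in Hz; lra).
  apply (Q (a + RtoC (s / k) * (z - a))%C).
  + replace (a + RtoC (s / k) * (z - a) - a)%C with (RtoC (s / k) * (z - a))%C by ring.
    rewrite Cmod_mult, Cmod_R, Rabs_right; [fold k; field; lra|].
    apply Rle_ge, Rle_mult_inv_pos; lra.
  + replace (z - (a + RtoC (s / k) * (z - a)))%C with (RtoC ((k - s) / k) * (z - a))%C.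
    * rewrite Cmod_mult, Cmod_R, Rabs_div, (Rabs_right k) by lra; fold k.
      replace (Rabs (k - s) / k * k) with (Rabs (k - s)) by (field; lra); lra.
    * replace ((k - s) / k) with (1 - s / k) by (field; lra); rewrite RtoC_minus; ring.
Qed.

Lemma Cclosed_unit : Cclosed (fun z => Cmod z <= 1).
Proof.
assert (E : forall y, Cmod (y - 0) = Cmod y) by (intros; f_equal; ring).
intros z Hz; assert (A := Cclosed_disk 0 1 z); cbv beta in A; rewrite E in A; generalize (A Hz); apply filter_imp.
intros y Hy; rewrite E in Hy; exact Hy.
Qed.

Lemma outward (z : C) c : 0 <= c -> exists z', Cmod z' = Cmod z + c /\ Cmod (z' - z) = c.
Proof.
intros Hc; destruct (polar z 0) as [t [_ E]].
replace (z - 0)%C with z in E by ring.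
assert (Hz := Cmod_ge_0 z).
exists (RtoC (Cmod z + c) * cis t)%C; split.
- rewrite Cmod_mult, Cmod_cis, Cmod_R, Rabs_right; lra.
- rewrite E at 2; replace (RtoC (Cmod z + c) * cis t - (0 + RtoC (Cmod z) * cis t))%C with (RtoC c * cis t)%C
    by (rewrite RtoC_plus; ring).
  rewrite Cmod_mult, Cmod_cis, Cmod_R, Rabs_right; lra.
Qed.

(** That is, [P] is relatively clopen in [D]; connectedness is used in this form throughout. *)
Definition locally_constant (D P : C -> Prop) : Prop :=
  forall z, D z -> locally z (fun y => D y -> (P y <-> P z)).

(** Modulus and angle are interpolated linearly, so the path stays in the annulus; along it the
    indicator of [P] would be continuous without ever taking the value [1 / 2]. *)
Lemma annulus_connected P a r R z z' : 0 <= r ->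
  locally_constant (fun z => r < Cmod (z - a) < R) P ->
  r < Cmod (z - a) < R -> r < Cmod (z' - a) < R -> P z -> P z'.
Proof.
intros Hr HP Hz Hz' Pz; apply NNPP; intros Pz'.
destruct (polar z a) as [t [_ Et]]; destruct (polar z' a) as [t' [_ Et']].
set (s := Cmod (z - a)) in *; set (s' := Cmod (z' - a)) in *.
(* Clamping the parameter to [[0, 1]] extends the path to the whole line, as [IVT_continuous]
   requires. *)
set (cl := fun x => Rmax 0 (Rmin 1 x)).
assert (Hcl : forall x, 0 <= cl x <= 1).
{ intros x; unfold cl; split; [apply Rmax_l|apply Rmax_lub; [lra|apply Rmin_l]]. }
assert (Ccl : forall x, continuous cl x).
{ intros x; apply continuous_RP; intros e He; exists (mkposreal e He); intros y Hy.
  unfold ball in Hy; simpl in Hy; unfold AbsRing_ball, abs, minus, plus, opp in Hy; simpl in Hy.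
  eapply Rle_lt_trans; [|exact Hy].
  unfold cl, Rmax, Rmin; repeat destruct Rle_dec; unfold Rabs; repeat destruct Rcase_abs; lra. }
set (p := fun x => (a + RtoC (s + cl x * (s' - s)) * cis (t + cl x * (t' - t)))%C).
assert (Aff : forall u v x, continuous (fun x => u + cl x * (v - u)) x).
{ intros u v x; apply (continuous_plus (V := R_NormedModule)); [apply continuous_const|].
  apply (continuous_mult (K := R_AbsRing)); [apply Ccl|apply continuous_const]. }
assert (Cp : forall x, continuous p x).
{ intros x; apply continuous_Cplus; [apply continuous_const|apply continuous_Cmult].
  - apply (continuous_RtoC (fun x => s + cl x * (s' - s))), Aff.
  - apply (continuous_comp (fun x => t + cl x * (t' - t)) cis); [apply Aff|apply continuous_cis]. }
assert (In : forall x, r < Cmod (p x - a) < R).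
{ intros x; assert (A := Hcl x).
  assert (B : r < s + cl x * (s' - s) < R).
  { destruct (Rle_lt_dec s s'); [assert (0 <= cl x * (s' - s) <= s' - s) by (split; nra)
     |assert (s' - s <= cl x * (s' - s) <= 0) by (split; nra)]; lra. }
  unfold p; rewrite Cmod_circle; lra. }
set (h := fun x => if excluded_middle_informative (P (p x)) then 1 else 0).
assert (Ch : forall x, continuous h x).
{ intros x; apply continuous_RP; intros e He.
  generalize (Cp x _ (HP (p x) (In x))); unfold filtermap; apply filter_imp.
  intros y Hy; specialize (Hy (In y)); unfold h.
  destruct (excluded_middle_informative (P (p y))), (excluded_middle_informative (P (p x)));
    try tauto; rewrite Rminus_diag, Rabs_R0; exact He. }
assert (c0 : cl 0 = 0) by (unfold cl; rewrite Rmin_right, Rmax_left; lra).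
assert (c1 : cl 1 = 1) by (unfold cl; rewrite Rmin_left, Rmax_right; lra).
assert (h0 : h 0 = 1).
{ unfold h; destruct (excluded_middle_informative (P (p 0))) as [_|N]; [reflexivity|].
  exfalso; apply N; unfold p; rewrite c0.
  replace (s + 0 * (s' - s)) with s by ring; replace (t + 0 * (t' - t)) with t by ring.
  rewrite <- Et; exact Pz. }
assert (h1 : h 1 = 0).
{ unfold h; destruct (excluded_middle_informative (P (p 1))) as [N|_]; [|reflexivity].
  exfalso; apply Pz'; unfold p in N; rewrite c1 in N.
  replace (s + 1 * (s' - s)) with s' in N by ring; replace (t + 1 * (t' - t)) with t' in N by ring.
  rewrite <- Et' in N; exact N. }
destruct (IVT_continuous h 0 1 (/ 2) Ch ltac:(lra)) as [x [_ Ex]].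
{ rewrite h0, h1, Rmin_right, Rmax_left by lra; lra. }
unfold h in Ex; destruct (excluded_middle_informative (P (p x))); lra.
Qed.

Section Domain.
Variables (g : nat) (q : nat -> C) (r : nat -> R).
Hypothesis HD : circular_domain g q r.

Let Om := Omega g q r.

Lemma radius_pos l : (l <= g)%nat -> 0 < r l.
Proof.
destruct HD as [_ [H0 [H _]]]; destruct l as [|l]; intros Hl; [lra|].
apply (H (S l)); lia.
Qed.

Lemma disk_inside l : (1 <= l <= g)%nat -> Cmod (q l) + r l < 1.
Proof.
intros Hl; destruct HD as [_ [_ [H _]]]; destruct (H l Hl) as [Hr Hin].
destruct (outward (q l) (r l)) as [z [Hz Hz']]; [lra|].
rewrite <- Hz; apply Hin; unfold closed_disk; lra.
Qed.

(** Otherwise the point dividing the segment of centres in the ratio of the radii would lie in both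
    discs. *)
Lemma disk_separated l m : (1 <= l <= g)%nat -> (1 <= m <= g)%nat -> l <> m ->
  r l + r m < Cmod (q m - q l).
Proof.
intros Hl Hm Hlm; destruct HD as [_ [_ [H Hdis]]].
assert (Rl := proj1 (H l Hl)); assert (Rm := proj1 (H m Hm)).
apply Rnot_le_lt; intros Hle.
apply (Hdis l m Hl Hm Hlm (q l + RtoC (r l / (r l + r m)) * (q m - q l))%C); unfold closed_disk.
assert (E : 0 <= r l / (r l + r m)) by (apply Rle_mult_inv_pos; lra).
assert (E' : 0 <= r m / (r l + r m)) by (apply Rle_mult_inv_pos; lra).
set (k := Cmod (q m - q l)) in *.
split.
- replace (q l + RtoC (r l / (r l + r m)) * (q m - q l) - q l)%C with (RtoC (r l / (r l + r m)) * (q m - q l))%C by ring.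
  rewrite Cmod_mult, Cmod_R, Rabs_right by lra; fold k.
  apply Rle_trans with (r l / (r l + r m) * (r l + r m)); [apply Rmult_le_compat_l; lra|apply Req_le; field; lra].
- replace (q l + RtoC (r l / (r l + r m)) * (q m - q l) - q m)%C with (- (RtoC (r m / (r l + r m)) * (q m - q l)))%C.
  + rewrite Cmod_opp, Cmod_mult, Cmod_R, Rabs_right by lra; fold k.
    apply Rle_trans with (r m / (r l + r m) * (r l + r m)); [apply Rmult_le_compat_l; lra|apply Req_le; field; lra].
  + replace (r m / (r l + r m)) with (1 - r l / (r l + r m)) by (field; lra); rewrite RtoC_minus; ring.
Qed.

Lemma inner_annulus l : (1 <= l <= g)%nat ->
  exists R, r l < R /\ forall z, r l < Cmod (z - q l) < R -> Om z.
Proof.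
intros Hl.
destruct (finite_uniform g (fun m e => forall z, r l < Cmod (z - q l) < r l + e ->
   unit_disk z /\ ((1 <= m)%nat -> ~ closed_disk q r m z))) as [e [He H]].
- intros m e e' He H z Hz; apply H; lra.
- intros m Hm.
  assert (DI := disk_inside l Hl); assert (Rl := radius_pos l ltac:(lia)).
  assert (U : forall z, Cmod (z - q l) < r l + (1 - (Cmod (q l) + r l)) -> unit_disk z).
  { intros z Hz; unfold unit_disk; assert (T := Cmod_le_sub (q l) z); lra. }
  destruct (Nat.eq_dec l m) as [<-|Hlm].
  + exists (1 - (Cmod (q l) + r l)); split; [lra|]; intros z Hz; split; [apply U; lra|].
    intros _; unfold closed_disk; lra.
  + destruct m as [|m].
    * exists (1 - (Cmod (q l) + r l)); split; [lra|]; intros z Hz; split; [apply U; lra|lia].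
    * assert (Sep := disk_separated l (S m) Hl ltac:(lia) Hlm).
      set (k := Rmin (1 - (Cmod (q l) + r l)) (Cmod (q (S m) - q l) - (r l + r (S m)))).
      assert (k <= 1 - (Cmod (q l) + r l)) by apply Rmin_l.
      assert (k <= Cmod (q (S m) - q l) - (r l + r (S m))) by apply Rmin_r.
      exists k; split; [apply Rmin_pos; lra|]; intros z Hz; split; [apply U; lra|].
      intros _; unfold closed_disk; intros Hc.
      assert (T := Cmod_sub_triangle z (q (S m)) (q l)).
      replace (q (S m) - z)%C with (- (z - q (S m)))%C in T by ring; rewrite Cmod_opp in T; lra.
- exists (r l + e); split; [lra|]; intros z Hz; split; [exact (proj1 (H 0%nat ltac:(lia) z Hz))|].
  intros m Hm; exact (proj2 (H m (proj2 Hm) z Hz) (proj1 Hm)).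
Qed.

Lemma outer_annulus : exists rho, 0 < rho < 1 /\ forall z, rho < Cmod z < 1 -> Om z.
Proof.
destruct (finite_uniform g (fun m e => forall z, 1 - e < Cmod z < 1 -> (1 <= m)%nat -> ~ closed_disk q r m z))
  as [e [He H]].
- intros m e e' He H z Hz; apply H; lra.
- intros m Hm; destruct m as [|m]; [exists 1; split; [lra|lia]|].
  assert (DI := disk_inside (S m) ltac:(lia)).
  exists (1 - (Cmod (q (S m)) + r (S m))); split; [lra|]; intros z Hz _ Hc; unfold closed_disk in Hc.
  assert (T := Cmod_le_sub (q (S m)) z); lra.
- set (rho := Rmax (1 - e) (/ 2)).
  assert (1 - e <= rho) by apply Rmax_l.
  exists rho; split.
  { split; [apply Rlt_le_trans with (/2); [lra|apply Rmax_r]|apply Rmax_lub_lt; lra]. }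
  intros z Hz; split; [apply Hz|]; intros m Hm; apply (H m); lia || lra.
Qed.

Lemma Omega_open z : Om z -> locally z Om.
Proof.
intros [Hz Hn].
destruct (finite_uniform g (fun m e => forall y, Cmod (y - z) < e -> unit_disk y /\ ((1 <= m)%nat -> ~ closed_disk q r m y)))
  as [e [He H]].
- intros m e e' He H y Hy; apply H; lra.
- intros m Hm; unfold unit_disk in Hz.
  assert (U : forall y, Cmod (y - z) < 1 - Cmod z -> unit_disk y).
  { intros y Hy; unfold unit_disk; assert (T := Cmod_le_sub z y); lra. }
  destruct m as [|m]; [exists (1 - Cmod z); split; [lra|]; intros y Hy; split; [apply U, Hy|lia]|].
  assert (A : r (S m) < Cmod (z - q (S m))) by (apply Rnot_le_lt, (Hn (S m)); lia).
  set (k := Rmin (1 - Cmod z) (Cmod (z - q (S m)) - r (S m))).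
  assert (k <= 1 - Cmod z) by apply Rmin_l.
  assert (k <= Cmod (z - q (S m)) - r (S m)) by apply Rmin_r.
  exists k; split; [apply Rmin_pos; lra|]; intros y Hy; split; [apply U; lra|].
  intros _; unfold closed_disk; intros Hc.
  assert (T := Cmod_sub_triangle y z (q (S m))).
  replace (z - y)%C with (- (y - z))%C in T by ring; rewrite Cmod_opp in T; lra.
- apply locally_CmodP; exists e; split; [exact He|]; intros y Hy.
  split; [exact (proj1 (H 0%nat ltac:(lia) y Hy))|].
  intros m Hm; exact (proj2 (H m (proj2 Hm) y Hy) (proj1 Hm)).
Qed.

(** Sorts the closed unit disc for compactness arguments: interior continuity serves the first kind
    of point, boundary limits the second, and near the third there is nothing to check. *)
Lemma Omega_trichotomy y : Cmod y <= 1 ->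
  Om y \/ (exists l, (l <= g)%nat /\ circle q r l y) \/ locally y (fun z => ~ Om z).
Proof.
intros Hy.
destruct (classic (Om y)) as [HO|HO]; [left; exact HO|right].
destruct (Req_dec (Cmod y) 1) as [E|E].
- left; exists 0%nat; split; [lia|]; unfold circle; destruct HD as [-> [-> _]].
  replace (y - 0)%C with y by ring; exact E.
- assert (Hex : exists l, (1 <= l <= g)%nat /\ closed_disk q r l y).
  { apply NNPP; intros N; apply HO; split; [unfold unit_disk; lra|].
    intros l Hl Hc; apply N; eauto. }
  destruct Hex as [l [Hl Hc]]; unfold closed_disk in Hc.
  destruct (Req_dec (Cmod (y - q l)) (r l)) as [El|El].
  + left; exists l; split; [lia|exact El].
  + right; generalize (locally_disk (q l) (r l) y ltac:(lra)); apply filter_imp.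
    intros z Hz [_ N]; apply (N l Hl); unfold closed_disk; lra.
Qed.

Lemma near_inner_circle l b R : (1 <= l <= g)%nat -> circle q r l b -> r l < R ->
  locally b (fun z => Om z -> r l < Cmod (z - q l) < R).
Proof.
intros Hl Hb HR; unfold circle in Hb.
generalize (locally_disk (q l) R b ltac:(lra)); apply filter_imp.
intros z Hz [_ N]; split; [|exact Hz].
apply Rnot_le_lt; intros Hc; apply (N l Hl); exact Hc.
Qed.

Lemma locally_constant_sub (D D' P : C -> Prop) : (forall z, D z -> D' z) ->
  locally_constant D' P -> locally_constant D P.
Proof.
intros Hs H z Hz; generalize (H z (Hs z Hz)); apply filter_imp; intros y Hy Dy; apply Hy, Hs, Dy.
Qed.

(* A relatively clopen subset of Omega that stays away from the unit circle could always be continued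
   outwards, around an inner circle if necessary, beyond its largest modulus. *)
Lemma clopen_reaches_outer (P : C -> Prop) : locally_constant Om P -> (exists z, Om z /\ P z) ->
  exists rho, 0 < rho < 1 /\ forall z, rho < Cmod z < 1 -> Om z /\ P z.
Proof.
intros HP [z0 [Hz0 Pz0]].
destruct outer_annulus as [rho [Hrho Hann]].
exists rho; split; [exact Hrho|].
destruct (classic (exists z, Om z /\ P z /\ rho < Cmod z)) as [[z1 [Hz1 [Pz1 Hm1]]]|Hno].
{ intros z Hz; split; [apply Hann, Hz|].
  apply (annulus_connected P 0 rho 1 z1 z); try lra; replace (z1 - 0)%C with z1 by ring; auto.
  - apply locally_constant_sub with Om; [|exact HP].
    intros y Hy; apply Hann; replace (y - 0)%C with y in Hy by ring; exact Hy.
  - split; [exact Hm1|apply Hz1].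
  - replace (z - 0)%C with z by ring; exact Hz. }
exfalso.
assert (Hle : forall z, Om z -> P z -> Cmod z <= rho).
{ intros z Hz Pz; apply Rnot_lt_le; intros L; apply Hno; eauto. }
destruct (completeness (fun x => exists z, Om z /\ P z /\ x = Cmod z)) as [Sup [HS1 HS2]].
{ exists rho; intros x [z [A [B ->]]]; auto. }
{ exists (Cmod z0); eauto. }
assert (HS : forall z, Om z -> P z -> Cmod z <= Sup) by (intros z A B; apply HS1; eauto).
(* A uniform gap below [Sup] is absurd, so it is enough to produce a local gap at every point of the
   closed disc. *)
destruct (compact_uniform (fun z => Cmod z <= 1) 1 (fun y e => Om y -> P y -> Cmod y <= Sup - e)) as [e [He Q]].
- auto.
- exact Cclosed_unit.
- intros y e e' He Q A B; specialize (Q A B); lra.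
- intros y Hy; destruct (Omega_trichotomy y Hy) as [HO|[[l [Hl Hc]]|HN]].
  + assert (L := filter_and (F := locally y) _ _ (Omega_open y HO) (HP y HO)).
    destruct (proj1 (locally_CmodP _ _) L) as [d [Hd Hd']].
    exists (d / 4); split; [lra|]; apply locally_CmodP; exists (d / 2); split; [lra|].
    intros y' Hy' _ HO' HP'.
    destruct (outward y' (d / 4)) as [y'' [E1 E2]]; [lra|].
    assert (Py : P y) by (apply (Hd' y'); [lra|exact HO'|exact HP']).
    assert (Hy'' : Cmod (y'' - y) < d).
    { assert (T := Cmod_sub_triangle y' y'' y); lra. }
    destruct (Hd' y'' Hy'') as [A B]; specialize (HS y'' A (proj2 (B A) Py)); lra.
  + destruct l as [|l].
    * exists 1; split; [lra|].
      unfold circle in Hc; destruct HD as [E0 [E1 _]]; rewrite E0, E1 in Hc.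
      generalize (locally_annulus 0 rho 2 y ltac:(lra)); apply filter_imp.
      intros z Hz _ A B; rewrite Cmod_sub_0 in Hz; specialize (Hle z A B); lra.
    * assert (Hl' : (1 <= S l <= g)%nat) by lia.
      destruct (inner_annulus _ Hl') as [R [HR HA]].
      exists ((R - r (S l)) / 4); split; [lra|].
      generalize (near_inner_circle (S l) y (r (S l) + (R - r (S l)) / 4) Hl' Hc ltac:(lra)); apply filter_imp.
      intros z Hz _ A B; specialize (Hz A).
      (* [w] is the point of modulus [Cmod (q (S l)) + (r (S l) + R) / 2] on a circle inside the
         collar. The collar is connected, so [P] passes from [z] to [w], and [w] has modulus larger
         than [z] by at least [(R - r (S l)) / 4]. *)
      destruct (outward (q (S l)) ((r (S l) + R) / 2)) as [w [W1 W2]].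
      { assert (Rl := radius_pos (S l) Hl); lra. }
      assert (Pw : P w).
      { apply (annulus_connected P (q (S l)) (r (S l)) R z w); try lra; auto.
        - left; apply radius_pos, Hl.
        - apply locally_constant_sub with Om; auto. }
      assert (Cw := HS w ltac:(apply HA; lra) Pw).
      assert (T := Cmod_le_sub (q (S l)) z); lra.
  + exists 1; split; [lra|]; revert HN; apply filter_imp; intros z Hz _ A; contradiction.
- assert (Hub : Sup <= Sup - e); [|lra].
  apply HS2; intros x [z [A [B ->]]]; apply Q; auto; left; apply A.
Qed.

(** The set where [H] takes the value [H z0] is relatively clopen by the local maximum principle,
    hence reaches the unit circle. Knowing [H] on an outer ring is enough afterwards, because the
    boundary value there is prescribed. *)
Lemma max_attained (H : C -> C) z0 : (forall z, Om z -> dif H z) -> Om z0 ->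
  (forall z, Om z -> Cmod (H z) <= Cmod (H z0)) ->
  exists rho, 0 < rho < 1 /\ forall z, rho < Cmod z < 1 -> Om z /\ H z = H z0.
Proof.
intros Hd Hz0 Hmax.
apply clopen_reaches_outer; [|eauto].
intros z Hz; destruct (Ceq_dec (H z) (H z0)) as [E|E].
- assert (L : locally z (fun y => H y = H z)).
  { apply max_modulus_locally.
    - generalize (Omega_open z Hz); apply filter_imp; exact Hd.
    - generalize (Omega_open z Hz); apply filter_imp; intros y Hy; rewrite E; auto. }
  revert L; apply filter_imp; intros y -> _; tauto.
- assert (L := locally_neq0 (fun y => H y - H z0)%C z
    (dif_continuous _ _ (dif_minus H (fun _ => H z0) z (Hd z Hz) (dif_const (H z0) z))) (Csub_neq _ _ E)).
  revert L; apply filter_imp; intros y Hy _; split; [|contradiction].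
  intros E'; exfalso; apply Hy; rewrite E'; ring.
Qed.

Lemma constant_of_unimodular (H : C -> C) : (forall z, Om z -> dif H z) -> (forall z, Om z -> Cmod (H z) = 1) ->
  forall z z', Om z -> Om z' -> H z = H z'.
Proof.
intros Hd H1 z z' Hz Hz'.
destruct (max_attained H z Hd Hz) as [rho [Hrho E]]; [intros y Hy; rewrite !H1; auto; lra|].
destruct (max_attained H z' Hd Hz') as [rho' [Hrho' E']]; [intros y Hy; rewrite !H1; auto; lra|].
set (x := (1 + Rmax rho rho') / 2).
assert (Rmax rho rho' < 1) by (apply Rmax_lub_lt; lra).
assert (rho <= Rmax rho rho') by apply Rmax_l; assert (rho' <= Rmax rho rho') by apply Rmax_r.
assert (Hx : Cmod (RtoC x) = x) by (rewrite Cmod_R, Rabs_right; unfold x; lra).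
rewrite <- (proj2 (E (RtoC x) ltac:(rewrite Hx; unfold x; lra))).
apply E'; rewrite Hx; unfold x; lra.
Qed.

Lemma one_on_outer_circle : circle q r 0 1.
Proof.
unfold circle; destruct HD as [-> [-> _]]; replace (1 - 0)%C with (RtoC 1) by ring; apply Cmod_1.
Qed.

Lemma outer_value_of_limit (h : C -> R) c v : (forall e, 0 < e -> locally (RtoC 1) (fun z => Om z -> Rabs (h z - c) < e)) ->
  (exists rho, 0 < rho < 1 /\ forall z, rho < Cmod z < 1 -> Om z /\ h z = v) -> v = c.
Proof.
intros Hl [rho [Hrho E]]; apply NNPP; intros N.
destruct (proj1 (locally_CmodP _ _) (Hl (Rabs (v - c)) (Rabs_pos_lt (v - c) (Rminus_eq_contra _ _ N)))) as [d [Hd L]].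
set (x := Rmax ((1 + rho) / 2) (1 - d / 2)).
assert ((1 + rho) / 2 <= x) by apply Rmax_l; assert (1 - d / 2 <= x) by apply Rmax_r.
assert (x < 1) by (apply Rmax_lub_lt; lra).
destruct (E (RtoC x)) as [A B]; [rewrite Cmod_R, Rabs_right; lra|].
assert (Z := L (RtoC x) ltac:(rewrite <- RtoC_minus, Cmod_R, Rabs_left; lra) A).
rewrite B in Z; lra.
Qed.

(** [Cmod (H z)] is bounded by compactness. A supremum above [M] could not be approached only at the
    boundary, so it would be attained, and [max_attained] would spread it to the unit circle,
    against the boundary estimate. *)
Lemma weak_max_principle (H : C -> C) M : (forall z, Om z -> dif H z) ->
  (forall l b e, (l <= g)%nat -> circle q r l b -> 0 < e -> locally b (fun z => Om z -> Cmod (H z) < M + e)) ->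
  forall z, Om z -> Cmod (H z) <= M.
Proof.
intros Hd Hb z1 Hz1.
assert (Hcl := Cclosed_unit).
destruct (compact_uniform (fun z => Cmod z <= 1) 1 (fun y e => Om y -> Cmod (H y) <= / e)) as [k [Hk HB]].
{ auto. } { exact Hcl. }
{ intros y e e' He Q A; eapply Rle_trans; [apply Q, A|]; apply Rinv_le_contravar; lra. }
{ intros y Hy; destruct (Omega_trichotomy y Hy) as [HO|[[l [Hl Hc]]|HN]].
  - set (m := Cmod (H y) + 1); assert (Hm : 0 < m) by (assert (A := Cmod_ge_0 (H y)); unfold m; lra).
    exists (/ m); split; [apply Rinv_0_lt_compat, Hm|].
    generalize (proj1 (continuous_CmodP _ _) (dif_continuous _ _ (Hd y HO)) 1 ltac:(lra)); apply filter_imp.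
    intros z Hz _ _; rewrite Rinv_inv; assert (A := Cmod_sub_le (H z) (H y)); apply Rabs_le_between in A; unfold m; lra.
  - set (m := Rabs M + 1); assert (Hm : 0 < m) by (assert (A := Rabs_pos M); unfold m; lra).
    exists (/ m); split; [apply Rinv_0_lt_compat, Hm|].
    generalize (Hb l y 1 Hl Hc ltac:(lra)); apply filter_imp.
    intros z Hz _ A; specialize (Hz A); rewrite Rinv_inv; assert (B := Rle_abs M); unfold m; lra.
  - exists 1; split; [lra|]; revert HN; apply filter_imp; intros z Hz _ A; contradiction. }
destruct (completeness (fun x => exists z, Om z /\ x = Cmod (H z))) as [Sup [HS1 HS2]].
{ exists (/ k); intros x [z [A ->]]; apply HB; [left; apply A|exact A]. }
{ eauto. }
assert (HS : forall z, Om z -> Cmod (H z) <= Sup) by (intros z A; apply HS1; eauto).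
apply Rnot_lt_le; intros HM.
assert (HSM : M < Sup) by (specialize (HS z1 Hz1); lra).
assert (Att : exists z, Om z /\ Cmod (H z) = Sup).
{ apply NNPP; intros N.
  destruct (compact_uniform (fun z => Cmod z <= 1) 1 (fun y e => Om y -> Cmod (H y) <= Sup - e)) as [e [He Q]].
  - auto.
  - exact Hcl.
  - intros y e e' He Q A; specialize (Q A); lra.
  - intros y Hy; destruct (Omega_trichotomy y Hy) as [HO|[[l [Hl Hc]]|HN]].
    + assert (Hlt : Cmod (H y) < Sup).
      { destruct (HS y HO) as [|E]; [assumption|]; exfalso; apply N; eauto. }
      set (e := (Sup - Cmod (H y)) / 2); exists e; split; [unfold e; lra|].
      generalize (proj1 (continuous_CmodP _ _) (dif_continuous _ _ (Hd y HO)) e ltac:(unfold e; lra)); apply filter_imp.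
      intros z Hz _ _; assert (A := Cmod_sub_le (H z) (H y)); apply Rabs_le_between in A; unfold e in *; lra.
    + exists ((Sup - M) / 2); split; [lra|].
      generalize (Hb l y ((Sup - M) / 2) Hl Hc ltac:(lra)); apply filter_imp.
      intros z Hz _ A; specialize (Hz A); lra.
    + exists 1; split; [lra|]; revert HN; apply filter_imp; intros z Hz _ A; contradiction.
  - assert (Hub : Sup <= Sup - e); [|lra].
    apply HS2; intros x [z [A ->]]; apply Q; [left; apply A|exact A]. }
destruct Att as [z [Hz Ez]].
destruct (max_attained H z Hd Hz) as [rho [Hrho E]]; [intros y Hy; rewrite Ez; auto|].
destruct (proj1 (locally_CmodP _ _) (Hb 0%nat (RtoC 1) (Sup - M) ltac:(lia) one_on_outer_circle ltac:(lra))) as [d [Hd0 L]].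
set (x := Rmax ((1 + rho) / 2) (1 - d / 2)).
assert ((1 + rho) / 2 <= x) by apply Rmax_l; assert (1 - d / 2 <= x) by apply Rmax_r.
assert (x < 1) by (apply Rmax_lub_lt; lra).
destruct (E (RtoC x)) as [A B]; [rewrite Cmod_R, Rabs_right; lra|].
assert (Z := L (RtoC x) ltac:(rewrite <- RtoC_minus, Cmod_R, Rabs_left; lra) A).
rewrite B, Ez in Z; lra.
Qed.

(* If the largest boundary value were attained on an inner circle, then, the flux vanishing, the means
   of [ln |H|] over concentric circles would be constant, hence equal to their supremum. *)
Lemma modulus_le_1 (H : C -> C) (c : nat -> R) : (forall z, Om z -> dif H z /\ H z <> 0%C) ->
  c 0%nat = 1 -> (forall l, (l <= g)%nat -> 0 < c l) ->
  (forall l b e, (l <= g)%nat -> circle q r l b -> 0 < e -> locally b (fun z => Om z -> Rabs (Cmod (H z) - c l) < e)) ->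
  (forall l, (1 <= l <= g)%nat -> exists R, r l < R /\ forall s, r l < s < R -> Re (flux H (q l) s) = 0) ->
  forall z, Om z -> Cmod (H z) <= 1.
Proof.
intros HH c0 cpos Hb Hflux.
destruct (finite_max g c) as [l [Hl Hmax]].
assert (Hd : forall z, Om z -> dif H z) by (intros z Hz; apply HH, Hz).
assert (HM : forall z, Om z -> Cmod (H z) <= c l).
{ apply weak_max_principle; [exact Hd|]; intros m b e Hm Hc He.
  generalize (Hb m b e Hm Hc He); apply filter_imp; intros z Hz A; specialize (Hz A).
  apply Rabs_def2 in Hz; assert (B := Hmax m Hm); lra. }
enough (Hcl : c l = 1) by (rewrite <- Hcl; exact HM).
destruct l as [|l]; [exact c0|].
set (k := S l) in *; assert (Hk : (1 <= k <= g)%nat) by (unfold k in *; lia).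
assert (Hr := radius_pos k Hl).
destruct (Hflux k Hk) as [R1 [HR1 Hfl]]; destruct (inner_annulus k Hk) as [R2 [HR2 Hann]].
set (R := Rmin R1 R2); assert (HR : r k < R) by (apply Rmin_glb_lt; assumption).
assert (R <= R1) by apply Rmin_l; assert (R <= R2) by apply Rmin_r.
assert (HK : forall z, r k < Cmod (z - q k) < R -> dif H z /\ H z <> 0%C) by (intros z Hz; apply HH, Hann; lra).
set (M := c k) in *; assert (HMp : 0 < M) by (apply cpos, Hl).
set (A := ln_mean H (q k) ((r k + R) / 2)).
assert (Const : forall s, r k < s < R -> ln_mean H (q k) s = A).
{ intros s Hs; apply (ln_mean_const H (q k) (r k) R ltac:(lra) HK); try lra; intros s' Hs'; apply Hfl; lra. }
assert (Cont : forall s, r k < s < R -> forall t, continuous (fun t => ln (Cmod (H (q k + RtoC s * cis t)%C))) t).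
{ intros s Hs t; apply (continuous_comp (fun t => Cmod (H (q k + RtoC s * cis t)%C)) ln).
  - apply continuous_Cmod, (circle_seg H (q k) s t t); [lra| |lra].
    intros z Hz; apply dif_continuous, HK; lra.
  - apply continuity_pt_filterlim, derivable_continuous_pt; exists (/ Cmod (H (q k + RtoC s * cis t)%C)).
    apply derivable_pt_lim_ln, Cmod_gt_0, HK; rewrite Cmod_circle; lra. }
assert (Low : 2 * PI * ln M <= A).
{ apply le_epsilon; intros e He; assert (HP := twoPI_pos).
  set (x := e / (2 * PI)); assert (Hx : 0 < x) by (apply Rdiv_lt_0_compat; lra).
  (* Chosen so that [M - m = M * exp (- x)]: a modulus within [m] of [M] has logarithm above
     [ln M - x], and [x] integrates to [e] over the circle. *)
  set (m := M * (1 - exp (- x))).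
  assert (Hex : exp (- x) < 1) by (rewrite <- exp_0; apply exp_increasing; lra).
  assert (Hm : 0 < m) by (apply Rmult_lt_0_compat; lra).
  destruct (circle_nbhd (fun z => Om z -> Rabs (Cmod (H z) - M) < m) (q k) (r k) Hr) as [d [Hd0 L]].
  { intros b Hcb; apply (Hb k b m Hl Hcb Hm). }
  set (s := Rmin (r k + d / 2) ((r k + R) / 2)).
  assert (s <= r k + d / 2) by apply Rmin_l; assert (s <= (r k + R) / 2) by apply Rmin_r.
  assert (Hs : r k < s < R) by (split; [apply Rmin_glb_lt; lra|lra]).
  rewrite <- (Const s Hs).
  assert (E : 2 * PI * ln M = RInt (fun _ => ln M - x) 0 (2 * PI) + e).
  { rewrite RInt_const; unfold scal; simpl; unfold mult; simpl; unfold x; field; lra. }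
  rewrite E; apply Rplus_le_compat_r; unfold ln_mean; apply RInt_le; [lra|apply ex_RInt_const| |].
  - apply ex_RInt_seg; [lra|intros t _; apply Cont, Hs].
  - intros t _; set (z := (q k + RtoC s * cis t)%C).
    assert (Hz : Cmod (z - q k) = s) by (apply Cmod_circle; lra).
    assert (B : Rabs (Cmod (H z) - M) < m).
    { apply L; [rewrite Hz, Rabs_right; lra|apply Hann; lra]. }
    apply Rabs_def2 in B.
    replace (ln M - x) with (ln (M * exp (- x))) by (rewrite ln_mult, ln_exp by (auto using exp_pos); ring).
    apply Rlt_le, ln_increasing; [apply Rmult_lt_0_compat; auto using exp_pos|unfold m in B; lra]. }
set (s := (r k + R) / 2); assert (Hs : r k < s < R) by (unfold s; lra).
set (h := fun t => ln M - ln (Cmod (H (q k + RtoC s * cis t)%C))).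
assert (Zero : h 0 = 0).
{ assert (HP := twoPI_pos); apply (RInt_nonneg_zero h 0 (2 * PI)); try lra.
  - intros t _; apply (continuous_minus (V := R_NormedModule)); [apply continuous_const|apply Cont, Hs].
  - intros t _; unfold h; set (z := (q k + RtoC s * cis t)%C).
    assert (Hz : Cmod (z - q k) = s) by (apply Cmod_circle; lra).
    assert (B := HM z ltac:(apply Hann; lra)).
    assert (B' : 0 < Cmod (H z)) by (apply Cmod_gt_0, HK; lra).
    destruct B as [B|B]; [apply ln_increasing in B; [lra|exact B']|rewrite B; lra].
  - assert (E : RInt h 0 (2 * PI) = 2 * PI * ln M - A).
    { unfold h; transitivity (RInt (fun _ => ln M) 0 (2 * PI) - ln_mean H (q k) s).
      - apply (RInt_minus (V := R_CompleteNormedModule) (fun _ => ln M)); [apply ex_RInt_const|].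
        apply ex_RInt_seg; [lra|intros t _; apply Cont, Hs].
      - rewrite RInt_const, (Const s Hs); unfold scal; simpl; unfold mult; simpl; ring. }
    lra. }
set (z0 := (q k + RtoC s * cis 0)%C) in *.
assert (Hz0 : Om z0) by (apply Hann; unfold z0; rewrite Cmod_circle; lra).
assert (Ez0 : Cmod (H z0) = M).
{ apply ln_inv; [apply Cmod_gt_0, HH, Hz0|exact HMp|unfold h in Zero; fold z0 in Zero; lra]. }
destruct (max_attained H z0 Hd Hz0) as [rho [Hrho E]]; [intros y Hy; rewrite Ez0; auto|].
rewrite <- c0; apply (outer_value_of_limit (fun z => Cmod (H z))).
- intros e He; apply (Hb 0%nat); [lia|apply one_on_outer_circle|exact He].
- exists rho; split; [exact Hrho|]; intros z Hz; destruct (E z Hz) as [B1 B2]; split; [exact B1|].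
  rewrite B2; exact Ez0.
Qed.

End Domain.

(** * Boundary behaviour of slit maps and proper maps *)

Lemma circle_nbhd_uniform (P : R -> C -> Prop) a s : 0 < s ->
  (forall z e e', 0 < e' <= e -> P e z -> P e' z) ->
  (forall b, Cmod (b - a) = s -> exists e, 0 < e /\ locally b (P e)) ->
  exists e, 0 < e /\ forall z, Rabs (Cmod (z - a) - s) < e -> P e z.
Proof.
intros Hs Hm H.
destruct (compact_uniform (fun z => Cmod (z - a) = s) (s + Cmod a)
  (fun y e => locally y (P e))) as [e [He Q]].
- intros z Hz; apply Cmod_bounded_disk; lra.
- apply Cclosed_circle.
- intros y e e' He; apply filter_imp; intros z; apply Hm, He.
- intros y Hy; destruct (H y Hy) as [e [He L]]; exists e; split; [exact He|].
  generalize (locally_locally y _ L); apply filter_imp; auto.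
- destruct (circle_nbhd (P e) a s Hs Q) as [d [Hd L]].
  assert (Hed : 0 < Rmin d e) by (apply Rmin_pos; assumption).
  exists (Rmin d e); split; [exact Hed|]; intros z Hz; apply Hm with e; [split; [exact Hed|apply Rmin_r]|].
  apply L; eapply Rlt_le_trans; [exact Hz|apply Rmin_l].
Qed.

Lemma arc_cis rho a b w : arc rho a b w <-> exists t, a <= t <= b /\ w = (RtoC rho * cis t)%C.
Proof.
assert (E : forall t, (RtoC rho * cis t)%C = (rho * cos t, rho * sin t)).
{ intros t; rewrite cisE; unfold Cmult, RtoC; simpl; f_equal; ring. }
split; intros [t [Ht Ew]]; exists t; (split; [exact Ht|]); rewrite Ew, E; reflexivity.
Qed.

Lemma arc_Cmod rho a b w : 0 <= rho -> arc rho a b w -> Cmod w = rho.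
Proof.
intros Hr Hw; apply arc_cis in Hw; destruct Hw as [t [_ ->]].
rewrite Cmod_mult, Cmod_cis, Cmod_R, Rabs_right; lra.
Qed.

Lemma arc_closed rho a b w : ~ arc rho a b w -> locally w (fun y => ~ arc rho a b y).
Proof.
intros Hw.
(* The parameter interval is embedded in the real axis of [C], so that compactness in the plane
   applies to the arc. *)
destruct (compact_away_zero (fun z => a <= Re z <= b /\ Im z = 0) (Rabs a + Rabs b)
  (fun z => RtoC rho * cis (Re z) - w)%C) as [m [Hm H]].
- intros z [H1 H2]; eapply Rle_trans; [apply Cmod_le_add|]; rewrite H2, Rabs_R0.
  unfold Rabs; repeat destruct Rcase_abs; lra.
- intros z Hz; apply not_and_or in Hz.
  assert (Hid : continuous (fun y : C => y) z) by apply continuous_id.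
  assert (C1 := continuous_Re _ _ Hid); assert (C2 := continuous_Im _ _ Hid).
  destruct Hz as [Hz|Hz].
  + assert (D : Re z < a \/ b < Re z) by (destruct (Rlt_le_dec (Re z) a); [left|right]; lra).
    destruct D as [D|D].
    * generalize (proj1 (continuous_RP _ _) C1 (a - Re z) ltac:(lra)); apply filter_imp.
      intros y Hy [A _]; apply Rabs_def2 in Hy; lra.
    * generalize (proj1 (continuous_RP _ _) C1 (Re z - b) ltac:(lra)); apply filter_imp.
      intros y Hy [A _]; apply Rabs_def2 in Hy; lra.
  + generalize (proj1 (continuous_RP _ _) C2 (Rabs (Im z)) (Rabs_pos_lt _ Hz)); apply filter_imp.
    intros y Hy [_ A]; rewrite A in Hy; rewrite <- Rabs_Ropp in Hy.
    replace (- (0 - Im z)) with (Im z) in Hy by ring; lra.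
- intros z _; apply continuous_Cminus; [|apply continuous_const].
  apply continuous_Cmult; [apply continuous_const|].
  apply (continuous_comp (fun z : C => Re z) cis); [apply continuous_Re, continuous_id|apply continuous_cis].
- intros z [Hz _]; apply Csub_neq; intros E; apply Hw; apply arc_cis; eauto.
- apply locally_CmodP; exists m; split; [exact Hm|]; intros y Hy Ha.
  apply arc_cis in Ha; destruct Ha as [t [Ht ->]].
  assert (B := H (RtoC t) (conj Ht eq_refl)); unfold Re, RtoC in B; simpl in B.
  fold (RtoC rho) in B; lra.
Qed.

Lemma avoid_finitely_many (rho : nat -> R) m a b : a < b ->
  exists a' b', a <= a' < b' /\ b' <= b /\ forall i, (i < m)%nat -> ~ (a' < rho i < b').
Proof.
intros Hab; induction m as [|m [a' [b' [H1 [H2 H3]]]]].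
- exists a, b; split; [lra|split; [lra|lia]].
- destruct (classic (a' < rho m < b')) as [H|H].
  + exists a', (rho m); split; [lra|split; [lra|]]; intros i Hi A.
    destruct (Nat.eq_dec i m) as [->|N]; [lra|apply (H3 i); [lia|lra]].
  + exists a', b'; split; [lra|split; [lra|]]; intros i Hi A.
    destruct (Nat.eq_dec i m) as [->|N]; [contradiction|apply (H3 i); [lia|exact A]].
Qed.

(** Radii of circles that meet no slit are dense; every limit of the modulus of a slit map is
    squeezed between such radii. *)
Lemma pick_avoiding (rho : nat -> R) m a b : a < b -> exists c, a < c < b /\ forall i, (i < m)%nat -> rho i <> c.
Proof.
intros Hab; destruct (avoid_finitely_many rho m a b Hab) as [a' [b' [H1 [H2 H3]]]].
exists ((a' + b') / 2); split; [lra|]; intros i Hi E; apply (H3 i Hi); lra.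
Qed.

Section SlitMap.
Variables (g : nat) (q : nat -> C) (r : nat -> R).
Hypothesis HD : circular_domain g q r.
Let Om := Omega g q r.
Variables (e : C -> C) (m : nat) (rho al be : nat -> R) (S : C -> Prop).
Hypotheses
  (Harc : forall i, (i < m)%nat -> 0 < rho i < 1 /\ al i < be i < al i + 2 * PI)
  (Hdisj : forall i j w, (i < m)%nat -> (j < m)%nat -> i <> j ->
     ~ (arc (rho i) (al i) (be i) w /\ arc (rho j) (al j) (be j) w))
  (HS : forall w, S w <-> unit_disk w /\ forall i, (i < m)%nat -> ~ arc (rho i) (al i) (be i) w)
  (Hconf : conformal_onto Om S e)
  (Hcirc : preserves_unit_circle Om e).

Lemma slit_dif z : Om z -> dif e z.
Proof.
intros Hz; apply ex_derive_dif; destruct Hconf as [H _]; exact (locally_singleton _ _ (H z Hz)).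
Qed.

Lemma slit_inj z z' : Om z -> Om z' -> e z = e z' -> z = z'.
Proof. apply Hconf. Qed.

Lemma slit_in z : Om z -> S (e z).
Proof. intros Hz; apply (proj2 (proj2 Hconf)); eauto. Qed.

Lemma slit_lt_1 z : Om z -> Cmod (e z) < 1.
Proof. intros Hz; apply slit_in, HS in Hz; apply Hz. Qed.

Lemma slit_open z0 d : Om z0 -> 0 < d ->
  exists k, 0 < k /\ forall w, Cmod (w - e z0) < k -> exists z, Om z /\ Cmod (z - z0) < d /\ e z = w.
Proof.
intros Hz0 Hd.
destruct (proj1 (locally_CmodP _ _) (Omega_open g q r z0 Hz0)) as [R [HR L]].
destruct (open_mapping_inj e z0 R d z0) as [k [Hk H]]; auto.
- intros z Hz; apply slit_dif, L, Hz.
- intros z z' Hz Hz'; apply slit_inj; apply L; assumption.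
- rewrite Cmod_center; exact HR.
- exists k; split; [exact Hk|]; intros w Hw; destruct (H w Hw) as [z [A [B E]]].
  exists z; repeat split; auto; apply L; exact B.
Qed.

Lemma slit_outer b k : Cmod b = 1 -> 0 < k -> locally b (fun z => Om z -> Rabs (Cmod (e z) - 1) < k).
Proof.
intros Hb Hk; destruct Hcirc as [F [HF1 [HF2 HF3]]].
assert (HFb : Cmod (F b) = 1) by (apply HF3; eauto).
assert (L := HF1 b (or_intror Hb)).
assert (L' := L (fun w => Cmod (w - F b) < k) (proj2 (locally_CmodP _ _) (ex_intro _ k (conj Hk (fun y H => H))))).
unfold filtermap, within in L'; revert L'; apply filter_imp; intros z Hz HO.
specialize (Hz (or_introl HO)); rewrite (HF2 z HO) in Hz.
eapply Rle_lt_trans; [|exact Hz]; rewrite <- HFb; apply Cmod_sub_le.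
Qed.

(** All values close to [w = e z0] are already taken near [z0]; by injectivity they are not taken
    near [b]. *)
Lemma slit_away w b : S w -> ~ Om b -> exists k, 0 < k /\ locally b (fun z => Om z -> k <= Cmod (e z - w)).
Proof.
intros Hw Hb; apply (proj2 (proj2 Hconf)) in Hw; destruct Hw as [z0 [Hz0 <-]].
assert (N : 0 < Cmod (z0 - b)) by (apply Cmod_gt_0, Csub_neq; intros ->; contradiction).
destruct (slit_open z0 (Cmod (z0 - b) / 2) Hz0 ltac:(lra)) as [k [Hk H]].
exists k; split; [exact Hk|]; apply locally_CmodP; exists (Cmod (z0 - b) / 2); split; [lra|].
intros z Hz HO; apply Rnot_lt_le; intros Hlt.
destruct (H _ Hlt) as [z' [A [B E]]].
assert (z' = z) by (apply slit_inj; auto); subst z'.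
assert (T := Cmod_sub_triangle z z0 b); rewrite (Cmod_sub_sym z0 z) in T; lra.
Qed.

Lemma slit_away_compact (K : C -> Prop) b : (forall w, K w -> Cmod w <= 1) -> Cclosed K -> (forall w, K w -> S w) ->
  ~ Om b -> exists k, 0 < k /\ locally b (fun z => Om z -> forall w, K w -> k <= Cmod (e z - w)).
Proof.
intros HB HK HKS Hb.
destruct (compact_uniform K 1 (fun w k => forall z, Cmod (z - b) < k -> Om z -> k <= Cmod (e z - w)) HB HK) as [k [Hk H]].
- intros w k k' Hk H z Hz HO; apply Rle_trans with k; [lra|]; apply H; [lra|exact HO].
- intros w Hw; destruct (slit_away w b (HKS w Hw) Hb) as [k [Hk L]].
  destruct (proj1 (locally_CmodP _ _) L) as [d [Hd L']].
  set (x := Rmin d (k / 2)); assert (x <= d) by apply Rmin_l; assert (x <= k / 2) by apply Rmin_r.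
  exists x; split; [apply Rmin_pos; lra|]; apply locally_CmodP; exists (k / 2); split; [lra|].
  intros w' Hw' _ z Hz HO; assert (A := L' z ltac:(lra) HO).
  assert (T := Cmod_sub_triangle w' (e z) w); lra.
- exists k; split; [exact Hk|]; apply locally_CmodP; exists k; split; [exact Hk|].
  intros z Hz HO w Hw; apply (H w Hw z Hz HO).
Qed.

Variable l : nat.
Hypothesis Hl : (1 <= l <= g)%nat.

(** Membership in Omega is part of the condition, so that the whole collar is known to lie in the
    domain. *)
Definition eventually_near (P : C -> Prop) : Prop :=
  exists t, r l < t /\ forall z, r l < Cmod (z - q l) < t -> Om z /\ P z.

Lemma eventually_and P Q : eventually_near P -> eventually_near Q -> eventually_near (fun z => P z /\ Q z).
Proof.
intros [t [Ht HP]] [t' [Ht' HQ]]; exists (Rmin t t'); split; [apply Rmin_glb_lt; assumption|].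
intros z Hz; assert (Rmin t t' <= t) by apply Rmin_l; assert (Rmin t t' <= t') by apply Rmin_r.
split; [apply HP; lra|split; [apply HP; lra|apply HQ; lra]].
Qed.

Lemma eventually_imp (P Q : C -> Prop) : (forall z, Om z -> P z -> Q z) -> eventually_near P -> eventually_near Q.
Proof. intros H [t [Ht HP]]; exists t; split; [exact Ht|]; intros z Hz; destruct (HP z Hz); auto. Qed.

Lemma eventually_ex P : eventually_near P -> exists z, Om z /\ P z.
Proof.
intros [t [Ht HP]]; assert (Hr := radius_pos g q r HD l ltac:(lia)).
exists (q l + RtoC ((r l + t) / 2) * cis 0)%C; apply HP; rewrite Cmod_circle; lra.
Qed.

Lemma circle_not_Omega b : Cmod (b - q l) = r l -> ~ Om b.
Proof. intros Hb [_ N]; apply (N l Hl); unfold closed_disk; lra. Qed.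

Lemma eventually_of_locally (P : R -> C -> Prop) : (forall z k k', 0 < k' <= k -> P k z -> P k' z) ->
  (forall b, Cmod (b - q l) = r l -> exists k, 0 < k /\ locally b (fun z => Om z -> P k z)) ->
  exists k, 0 < k /\ eventually_near (P k).
Proof.
intros Hm H; assert (Hr := radius_pos g q r HD l ltac:(lia)).
destruct (circle_nbhd_uniform (fun k z => Om z -> P k z) (q l) (r l) Hr) as [k [Hk L]]; [|exact H|].
{ intros z k k' Hk A B; apply Hm with k; auto. }
exists k; split; [exact Hk|].
destruct (inner_annulus g q r HD l Hl) as [R [HR HA]].
exists (Rmin R (r l + k)); split; [apply Rmin_glb_lt; lra|].
assert (Rmin R (r l + k) <= R) by apply Rmin_l; assert (Rmin R (r l + k) <= r l + k) by apply Rmin_r.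
intros z Hz; assert (HO : Om z) by (apply HA; lra); split; [exact HO|].
apply L; [rewrite Rabs_right; lra|exact HO].
Qed.

Lemma eventually_away (K : C -> Prop) : (forall w, K w -> Cmod w <= 1) -> Cclosed K -> (forall w, K w -> S w) ->
  exists k, 0 < k /\ eventually_near (fun z => forall w, K w -> k <= Cmod (e z - w)).
Proof.
intros HB HK HKS; apply (eventually_of_locally (fun k z => forall w, K w -> k <= Cmod (e z - w))).
- intros z k k' Hk H w Hw; specialize (H w Hw); lra.
- intros b Hb; apply slit_away_compact; auto; apply circle_not_Omega, Hb.
Qed.

(** The circle of radius [c] about 0 then lies in [S]; [c = 0] is allowed, the circle being the
    single point 0. *)
Definition good_radius (c : R) : Prop := 0 <= c < 1 /\ forall i, (i < m)%nat -> rho i <> c.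

Lemma good_radius_away c : good_radius c ->
  exists k, 0 < k /\ eventually_near (fun z => k <= Rabs (Cmod (e z) - c)).
Proof.
intros [Hc Hne].
destruct (eventually_away (fun w => Cmod (w - 0) = c)) as [k [Hk H]].
- intros w Hw; rewrite Cmod_sub_0 in Hw; lra.
- apply Cclosed_circle.
- intros w Hw; rewrite Cmod_sub_0 in Hw; apply HS; split; [unfold unit_disk; lra|].
  intros i Hi A; apply arc_Cmod in A; [|apply Rlt_le, Harc, Hi]; apply (Hne i Hi); congruence.
- exists k; split; [exact Hk|]; revert H; apply eventually_imp; intros z _ H.
  destruct (polar (e z) 0) as [t [_ E]]; rewrite Cmod_sub_0 in E.
  assert (A := H (0 + RtoC c * cis t)%C (Cmod_circle 0 c t ltac:(lra))).
  rewrite E in A at 1.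
  replace (0 + RtoC (Cmod (e z)) * cis t - (0 + RtoC c * cis t))%C with (RtoC (Cmod (e z) - c) * cis t)%C in A
    by (rewrite RtoC_minus; ring).
  rewrite Cmod_mult, Cmod_cis, Cmod_R, Rmult_1_r in A; exact A.
Qed.

(** Near [gamma_l] the modulus stays away from [c], and the collar is connected. *)
Lemma good_radius_dichotomy c : good_radius c ->
  eventually_near (fun z => c < Cmod (e z)) \/ eventually_near (fun z => Cmod (e z) < c).
Proof.
intros Hc; destruct (good_radius_away c Hc) as [k [Hk [t [Ht H]]]].
assert (Hr := radius_pos g q r HD l ltac:(lia)).
assert (Hne : forall z, r l < Cmod (z - q l) < t -> Cmod (e z) <> c).
{ intros z Hz E; destruct (H z Hz) as [_ B]; rewrite E, Rminus_diag, Rabs_R0 in B; lra. }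
assert (LC : locally_constant (fun z => r l < Cmod (z - q l) < t) (fun z => c < Cmod (e z))).
{ intros z Hz; destruct (H z Hz) as [HO B].
  generalize (proj1 (continuous_RP _ _) (continuous_Cmod e z (dif_continuous _ _ (slit_dif z HO))) k Hk).
  apply filter_imp; intros y Hy Hyz; apply Rabs_def2 in Hy.
  unfold Rabs in B; destruct (Rcase_abs (Cmod (e z) - c)); split; lra. }
destruct (classic (exists z, r l < Cmod (z - q l) < t /\ c < Cmod (e z))) as [[z0 [Hz0 A]]|N].
- left; exists t; split; [exact Ht|]; intros z Hz; split; [apply H, Hz|].
  exact (annulus_connected _ (q l) (r l) t z0 z ltac:(lra) LC Hz0 Hz A).
- right; exists t; split; [exact Ht|]; intros z Hz; split; [apply H, Hz|].
  destruct (Rtotal_order (Cmod (e z)) c) as [X|[X|X]]; [exact X| |]; exfalso;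
    [apply (Hne z Hz X)|apply N; eauto].
Qed.

(** [L] is the supremum of the good radii that eventually lie below the modulus; density of good
    radii squeezes the modulus to [L]. *)
Lemma slit_modulus_limit : exists L, 0 < L <= 1 /\
  forall k, 0 < k -> eventually_near (fun z => Rabs (Cmod (e z) - L) < k).
Proof.
assert (G0 : good_radius 0).
{ split; [lra|]; intros i Hi E; assert (A := proj1 (Harc i Hi)); lra. }
destruct (good_radius_away 0 G0) as [k0 [Hk0 H0]].
set (E := fun c => good_radius c /\ eventually_near (fun z => c < Cmod (e z))).
(* Radius 0 is good, so the modulus is at least [k0] near [gamma_l]; a good radius between 0 and
   [k0] makes [L] positive. *)
destruct (pick_avoiding rho m 0 (Rmin k0 1)) as [c0 [Hc0 Hc0']]; [apply Rmin_pos; lra|].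
assert (Rmin k0 1 <= k0) by apply Rmin_l; assert (Rmin k0 1 <= 1) by apply Rmin_r.
assert (E0 : E c0).
{ split; [split; [lra|exact Hc0']|]; revert H0; apply eventually_imp; intros z _ B.
  rewrite Rminus_0_r, Rabs_right in B by (apply Rle_ge, Cmod_ge_0); lra. }
destruct (completeness E) as [L [HL1 HL2]].
{ exists 1; intros c [[Hc _] _]; lra. }
{ exists c0; exact E0. }
assert (HL : 0 < L <= 1).
{ split; [assert (A := HL1 c0 E0); lra|]; apply HL2; intros c [[Hc _] _]; lra. }
exists L; split; [exact HL|]; intros k Hk.
assert (Low : eventually_near (fun z => L - k < Cmod (e z))).
{ apply NNPP; intros N.
  assert (Hub : L <= L - k); [|lra].
  apply HL2; intros c [Hc Hev]; apply Rnot_lt_le; intros Hlt; apply N.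
  revert Hev; apply eventually_imp; intros z _ B; lra. }
(* A good radius just above [L] is not in [E], so the dichotomy puts the modulus below it. For
   [L = 1] no such radius exists and [Cmod (e z) < 1] suffices. *)
assert (Up : eventually_near (fun z => Cmod (e z) < L + k)).
{ destruct (proj2 HL) as [Hlt|E1].
  - destruct (pick_avoiding rho m L (Rmin (L + k) 1)) as [c [Hc Hc']]; [apply Rmin_glb_lt; lra|].
    assert (Rmin (L + k) 1 <= L + k) by apply Rmin_l; assert (Rmin (L + k) 1 <= 1) by apply Rmin_r.
    assert (Gc : good_radius c) by (split; [lra|exact Hc']).
    destruct (good_radius_dichotomy c Gc) as [A|A].
    + exfalso; assert (B := HL1 c (conj Gc A)); lra.
    + revert A; apply eventually_imp; intros z _ B; lra.
  - destruct H0 as [t [Ht Hev]]; exists t; split; [exact Ht|]; intros z Hz.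
    destruct (Hev z Hz) as [HO _]; split; [exact HO|]; assert (B := slit_lt_1 z HO); lra. }
generalize (eventually_and _ _ Low Up); apply eventually_imp; intros z _ [A B]; apply Rabs_def1; lra.
Qed.

Lemma arcs_inside : exists ka, 0 < ka < 1 /\ forall i, (i < m)%nat -> rho i <= ka.
Proof.
clear Hdisj HS; induction m as [|m' IH]; [exists (/ 2); split; [lra|lia]|].
destruct IH as [ka [Hka H]]; [intros i Hi; apply Harc; lia|].
exists (Rmax ka (rho m')); assert (A := proj1 (Harc m' ltac:(lia))).
assert (ka <= Rmax ka (rho m')) by apply Rmax_l.
split; [split; [lra|apply Rmax_lub_lt; lra]|]; intros i Hi.
destruct (Nat.eq_dec i m') as [->|N]; [apply Rmax_r|].
apply Rle_trans with ka; [apply H; lia|assumption].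
Qed.

(* If [|e|] tended to 1 at an inner circle, the inside and the outside of a slightly larger circle would
   both fill, by connectedness, the same thin ring at the unit circle, contradicting injectivity. *)
Lemma slit_limit_neq_1 : ~ forall k, 0 < k -> eventually_near (fun z => Rabs (Cmod (e z) - 1) < k).
Proof.
intros Hlim; assert (Hr := radius_pos g q r HD l ltac:(lia)).
destruct (inner_annulus g q r HD l Hl) as [R [HR HA]].
set (s := (r l + R) / 2); assert (Hs : r l < s < R) by (unfold s; lra).
destruct (compact_uniform (fun z => Cmod (z - q l) = s) (s + Cmod (q l)) (fun z k => Cmod (e z) <= 1 - k)) as [k1 [Hk1 H1]].
{ intros z Hz; apply Cmod_bounded_disk; lra. }
{ apply Cclosed_circle. }
{ intros z k k' Hk A; lra. }
{ intros z Hz; assert (HO : Om z) by (apply HA; lra); assert (B := slit_lt_1 z HO).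
  exists ((1 - Cmod (e z)) / 2); split; [lra|].
  generalize (proj1 (continuous_RP _ _) (continuous_Cmod e z (dif_continuous _ _ (slit_dif z HO))) ((1 - Cmod (e z)) / 2) ltac:(lra)).
  apply filter_imp; intros y Hy _; apply Rabs_def2 in Hy; lra. }
destruct arcs_inside as [k2 [Hk2 H2]].
(* Beyond modulus [ka] there are neither slits nor values of [e] on the circle of radius [s]; the
   ring [T] is thus filled by values from both sides of that circle without crossing it. *)
set (ka := Rmax (1 - k1) k2).
assert (K1 : 1 - k1 <= ka) by apply Rmax_l; assert (K2 : k2 <= ka) by apply Rmax_r.
assert (K3 : ka < 1) by (apply Rmax_lub_lt; lra).
set (T := fun w : C => ka < Cmod (w - 0) < 1).
assert (TS : forall w, T w -> S w).
{ intros w Hw; unfold T in Hw; rewrite Cmod_sub_0 in Hw; apply HS; split; [apply Hw|].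
  intros i Hi A; apply arc_Cmod in A; [|apply Rlt_le, Harc, Hi]; assert (B := H2 i Hi); lra. }
set (P := fun w => exists z, Om z /\ Cmod (z - q l) < s /\ e z = w).
assert (LC : locally_constant T P).
{ intros w Hw; destruct (proj1 (proj2 (proj2 Hconf) w) (TS w Hw)) as [z0 [Hz0 E]].
  assert (Hne : Cmod (z0 - q l) <> s).
  { intros Es; assert (A := H1 z0 Es); unfold T in Hw; rewrite Cmod_sub_0, <- E in Hw; lra. }
  set (d := Rabs (Cmod (z0 - q l) - s)); assert (Hd : 0 < d) by (apply Rabs_pos_lt; lra).
  destruct (slit_open z0 d Hz0 Hd) as [k [Hk L]]; rewrite E in L.
  apply locally_CmodP; exists k; split; [exact Hk|]; intros w' Hw' _.
  destruct (L w' Hw') as [z' [Hz' [Hzz E']]].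
  assert (T1 := Cmod_sub_triangle z0 z' (q l)); assert (T2 := Cmod_sub_triangle z' z0 (q l)).
  rewrite (Cmod_sub_sym z0 z') in T2.
  assert (PW : forall x y, Om x -> e x = y -> (P y <-> Cmod (x - q l) < s)).
  { intros x y Hx Ex; split; [|intros; exists x; auto].
    intros [x' [A [B C0]]]; replace x with x'; [exact B|]; apply slit_inj; congruence. }
  rewrite (PW z0 w Hz0 E), (PW z' w' Hz' E').
  unfold d, Rabs in *; destruct Rcase_abs; split; lra. }
assert (EvS : eventually_near (fun z => Cmod (z - q l) < s)).
{ exists s; split; [lra|]; intros z Hz; split; [apply HA; lra|lra]. }
destruct (eventually_ex _ (eventually_and _ _ (Hlim (1 - ka) ltac:(lra)) EvS)) as [z1 [Hz1 [A1 B1]]].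
apply Rabs_def2 in A1; assert (C1 := slit_lt_1 z1 Hz1).
destruct (outer_annulus g q r HD) as [r0 [Hr0 HA0]].
destruct (proj1 (locally_CmodP _ _) (slit_outer 1 (1 - ka) Cmod_1 ltac:(lra))) as [d [Hd L]].
destruct (outward (q l) s) as [w [W1 W2]]; [lra|].
assert (Wd : Cmod w < 1).
{ assert (X : Om w) by (apply HA; lra); apply X. }
(* A real point close to 1: in Omega by the first term, with value in [T] by the second, and farther
   than [s] from [q l] by the third, because [Cmod w = Cmod (q l) + s]. *)
set (x := Rmax (Rmax ((1 + r0) / 2) (1 - d / 2)) ((1 + Cmod w) / 2)).
assert (X1 : Rmax ((1 + r0) / 2) (1 - d / 2) <= x) by apply Rmax_l.
assert (X2 : (1 + Cmod w) / 2 <= x) by apply Rmax_r.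
assert (X3 : (1 + r0) / 2 <= Rmax ((1 + r0) / 2) (1 - d / 2)) by apply Rmax_l.
assert (X4 : 1 - d / 2 <= Rmax ((1 + r0) / 2) (1 - d / 2)) by apply Rmax_r.
assert (X5 : x < 1) by (repeat apply Rmax_lub_lt; lra).
assert (Hx : Cmod (RtoC x) = x) by (rewrite Cmod_R, Rabs_right; lra).
assert (HOx : Om (RtoC x)) by (apply HA0; rewrite Hx; lra).
assert (A2 := L (RtoC x) ltac:(rewrite <- RtoC_minus, Cmod_R, Rabs_left; lra) HOx).
apply Rabs_def2 in A2; assert (C2 := slit_lt_1 _ HOx).
assert (PP : P (e (RtoC x))).
{ apply (annulus_connected P 0 ka 1 (e z1) (e (RtoC x))); try (rewrite Cmod_sub_0; lra); [lra|exact LC|].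
  exists z1; auto. }
destruct PP as [z2 [Hz2 [D2 E2]]].
assert (z2 = RtoC x) by (apply slit_inj; assumption); subst z2.
assert (Tx := Cmod_le_sub (q l) (RtoC x)); lra.
Qed.

(** [L] must be the radius of some arc, since otherwise it would be a good radius. Disjointness
    keeps the other arcs away from the endpoint of this one, so a point just beyond the endpoint
    lies in no slit. *)
Lemma slit_limit_gap L : 0 < L < 1 -> (forall k, 0 < k -> eventually_near (fun z => Rabs (Cmod (e z) - L) < k)) ->
  exists t, S (RtoC L * cis t)%C.
Proof.
intros HL Hlim.
assert (Hi : exists i, (i < m)%nat /\ rho i = L).
{ apply NNPP; intros N.
  destruct (good_radius_away L) as [k [Hk H]].
  - split; [lra|]; intros i Hi E; apply N; eauto.
  - destruct (eventually_ex _ (eventually_and _ _ H (Hlim k Hk))) as [z [_ [A B]]]; lra. }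
destruct Hi as [i [Hi Ei]]; destruct (Harc i Hi) as [_ Hab].
assert (Hend : forall j, (j < m)%nat -> j <> i -> ~ arc (rho j) (al j) (be j) (RtoC L * cis (be i))%C).
{ intros j Hj Hji A; apply (Hdisj i j (RtoC L * cis (be i))%C Hi Hj ltac:(lia)); split; [|exact A].
  apply arc_cis; exists (be i); split; [lra|rewrite Ei; reflexivity]. }
assert (Near : exists d, 0 < d /\ forall j, (j <= m)%nat -> (j < m)%nat -> j <> i -> forall t, Rabs (t - be i) < d ->
   ~ arc (rho j) (al j) (be j) (RtoC L * cis t)%C).
{ apply (finite_uniform m (fun j d => (j < m)%nat -> j <> i -> forall t, Rabs (t - be i) < d ->
   ~ arc (rho j) (al j) (be j) (RtoC L * cis t)%C)).
  - intros j d d' Hd H A B t Ht; apply H; auto; lra.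
  - intros j _; destruct (classic ((j < m)%nat /\ j <> i)) as [[A B]|N].
    + assert (Hc : continuous (fun t => RtoC L * cis t)%C (be i)).
      { apply continuous_Cmult; [apply continuous_const|apply continuous_cis]. }
      destruct (Hc _ (arc_closed _ _ _ _ (Hend j A B))) as [d Hd]; exists d; split; [apply cond_pos|].
      intros _ _ t Ht; apply Hd, Ht.
    + exists 1; split; [lra|]; intros A B; exfalso; apply N; auto. }
destruct Near as [d [Hd H]].
(* The step past [be i] must stay away from the other arcs and must not come round to the start
   [al i + 2 * PI] of the same arc. *)
set (x := Rmin d (al i + 2 * PI - be i)).
assert (Hx : 0 < x) by (apply Rmin_pos; lra).
assert (x <= d) by apply Rmin_l; assert (x <= al i + 2 * PI - be i) by apply Rmin_r.
exists (be i + x / 2); apply HS; split.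
{ unfold unit_disk; rewrite Cmod_mult, Cmod_cis, Cmod_R, Rabs_right; lra. }
intros j Hj; destruct (Nat.eq_dec j i) as [->|N].
- intros A; apply arc_cis in A; destruct A as [t [Ht E]]; rewrite Ei in E.
  assert (NL : RtoC L <> 0%C) by (intros E0; apply RtoC_inj in E0; lra).
  assert (E1 : cis (be i + x / 2) = cis t).
  { transitivity (/ RtoC L * (RtoC L * cis (be i + x / 2)))%C; [field; exact NL|]; rewrite E; field; exact NL. }
  assert (E2 : cis (be i + x / 2 - t) = 1%C).
  { unfold Rminus; rewrite cis_plus, E1, <- cis_plus, Rplus_opp_r, cisE, cos_0, sin_0; reflexivity. }
  destruct (cis_eq_1 _ E2) as [k Hk]; assert (HP := twoPI_pos).
  assert (0 < IZR k < 1) by nra.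
  destruct H2 as [B1 B2]; apply (lt_IZR 0) in B1; apply (lt_IZR _ 1) in B2; lia.
- apply (H j); auto; [lia|]; apply Rabs_def1; lra.
Qed.

(** Near [gamma_l] the modulus is close to [L] while the values keep a fixed distance from the gap
    point [L * cis t]; a value on the ray through the gap point with modulus close to [L] would come
    too near to it. *)
Lemma slit_boundary : exists L be0, 0 < L /\
  (forall k, 0 < k -> eventually_near (fun z => Rabs (Cmod (e z) - L) < k)) /\
  eventually_near (fun z => forall x, 0 < x -> e z <> (RtoC x * cis be0)%C).
Proof.
destruct slit_modulus_limit as [L [HL Hlim]].
assert (HL1 : L < 1).
{ destruct (proj2 HL) as [|E]; [assumption|]; exfalso; subst L; exact (slit_limit_neq_1 Hlim). }
destruct (slit_limit_gap L ltac:(lra) Hlim) as [t Ht].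
exists L, t; split; [lra|split; [exact Hlim|]].
destruct (eventually_away (fun w => w = RtoC L * cis t)%C) as [k [Hk H]].
- intros w ->; apply Rlt_le; apply HS in Ht; apply Ht.
- intros w Hw; apply locally_neq, Hw.
- intros w ->; exact Ht.
- generalize (eventually_and _ _ H (Hlim k Hk)); apply eventually_imp.
  intros z _ [A B] x Hx E; specialize (A _ eq_refl); rewrite E in A, B.
  rewrite Cmod_mult, Cmod_cis, Cmod_R, Rmult_1_r, (Rabs_right x) in B by lra.
  replace (RtoC x * cis t - RtoC L * cis t)%C with (RtoC (x - L) * cis t)%C in A by (rewrite RtoC_minus; ring).
  rewrite Cmod_mult, Cmod_cis, Cmod_R, Rmult_1_r in A; lra.
Qed.

Lemma slit_flux : exists R, r l < R /\ forall s, r l < s < R ->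
  (forall z, Cmod (z - q l) = s -> Om z /\ reg e z) /\ Re (flux e (q l) s) = 0.
Proof.
destruct slit_boundary as [L [be0 [HL [Hlim Hray]]]].
destruct (eventually_and _ _ (Hlim L HL) Hray) as [R [HR H]].
assert (Hr := radius_pos g q r HD l ltac:(lia)).
exists R; split; [exact HR|]; intros s Hs.
assert (Hreg : forall z, Cmod (z - q l) = s -> Om z /\ reg e z).
{ intros z Hz; destruct (H z ltac:(lra)) as [HO [A _]]; split; [exact HO|split].
  - generalize (Omega_open g q r z HO); apply filter_imp; exact slit_dif.
  - intros E; rewrite E, Cmod_0 in A; apply Rabs_def2 in A; lra. }
split; [exact Hreg|].
apply flux_avoiding_ray with be0; [lra|intros z Hz; apply Hreg, Hz|].
intros z x Hz Hx; apply (proj2 (proj2 (H z ltac:(lra)))), Hx.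
Qed.

End SlitMap.

(** The preimage of the closed disc of radius [1 - k] is compact and misses [b]. Covered by the sets
    [d < Cmod (z - b)] with [d > 0], it stays away from [b]; indices [d <= 0] give empty sets. *)
Lemma proper_boundary g q r f l b k : circular_domain g q r -> proper_onto_disk (Omega g q r) f -> (l <= g)%nat ->
  circle q r l b -> 0 < k -> locally b (fun z => Omega g q r z -> Rabs (Cmod (f z) - 1) < k).
Proof.
intros HD [_ [Hin [_ Hp]]] Hl Hb Hk.
assert (HN : ~ Omega g q r b).
{ intros [A B]; destruct l as [|l].
  - unfold circle in Hb; destruct HD as [E0 [E1 _]]; rewrite E0, E1, Cmod_sub_0 in Hb; unfold unit_disk in A; lra.
  - apply (B (S l)); [lia|]; unfold closed_disk; unfold circle in Hb; lra. }
set (K := fun w : C => Cmod (w - 0) <= 1 - k).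
assert (HK := Hp K (closed_bounded_compact K 1 ltac:(intros w Hw; unfold K in Hw; rewrite Cmod_sub_0 in Hw; lra)
   (Cclosed_disk 0 (1 - k))) ltac:(intros w Hw; unfold K in Hw; rewrite Cmod_sub_0 in Hw; unfold unit_disk; lra)).
destruct (HK R (fun d z => 0 < d < Cmod (z - b))) as [li Hli].
- intros d z [Hd0 Hd].
  generalize (proj1 (continuous_RP _ _) (continuous_Cmod (fun z => z - b)%C z (dif_continuous _ _ (dif_sub_const b z)))
     (Cmod (z - b) - d) ltac:(lra)); apply filter_imp; intros y Hy; apply Rabs_def2 in Hy; lra.
- intros z [HO _]; assert (N : 0 < Cmod (z - b)) by (apply Cmod_gt_0, Csub_neq; intros ->; contradiction).
  exists (Cmod (z - b) / 2); lra.
- assert (Hmin : exists d, 0 < d /\ forall x, In x li -> 0 < x -> d <= x).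
  { clear Hli; induction li as [|x li [d [Hd H]]]; [exists 1; split; [lra|intros x []]|].
    destruct (Rlt_le_dec 0 x) as [Hx|Hx].
    - exists (Rmin d x); split; [apply Rmin_pos; assumption|]; intros y [<-|Hy] Hy0; [apply Rmin_r|].
      apply Rle_trans with d; [apply Rmin_l|auto].
    - exists d; split; [exact Hd|]; intros y [<-|Hy] Hy0; [lra|auto]. }
  destruct Hmin as [d [Hd H]].
  apply locally_CmodP; exists d; split; [exact Hd|]; intros z Hz HO.
  assert (A : Cmod (f z) < 1) by (apply Hin, HO).
  destruct (Rle_lt_dec (Cmod (f z)) (1 - k)) as [B|B]; [exfalso|apply Rabs_def1; lra].
  destruct (Hli z) as [x [Hx Hx']]; [split; [exact HO|unfold K; rewrite Cmod_sub_0; exact B]|].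
  assert (D := H x Hx ltac:(lra)); lra.
Qed.

(** The degree determines the flux of the extension [F] on [gamma_l] itself; constancy of the flux
    moves it to slightly larger circles, which lie in Omega and where [F] is [f]. *)
Lemma proper_flux g q r f l d : circular_domain g q r -> proper_onto_disk (Omega g q r) f -> (1 <= l <= g)%nat ->
  boundary_degree g q r f l d ->
  exists R, r l < R /\ forall s, r l < s < R ->
    (forall z, Cmod (z - q l) = s -> reg f z) /\ Re (flux f (q l) s) = - (2 * PI * INR d).
Proof.
intros HD Hf Hl [F [HF1 [HF2 HF3]]].
assert (Hr := radius_pos g q r HD l ltac:(lia)).
destruct (inner_annulus g q r HD l Hl) as [R0 [HR0 HA]].
assert (Hd : forall b, Cmod (b - q l) = r l -> locally b (dif F)).
{ intros b Hb; assert (H := HF1 b (or_intror (ex_intro _ l (conj (proj2 Hl) Hb)))).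
  unfold holomorphic_at in H; revert H; apply filter_imp; intros y; apply ex_derive_dif. }
assert (H1 : forall b, Cmod (b - q l) = r l -> Cmod (F b) = 1).
{ intros b Hb; apply NNPP; intros N.
  set (k := Rabs (Cmod (F b) - 1) / 2).
  assert (Hk : 0 < k) by (assert (A := Rabs_pos_lt (Cmod (F b) - 1) ltac:(lra)); unfold k; lra).
  assert (L1 := proj1 (continuous_RP _ _) (continuous_Cmod F b (dif_continuous _ _ (locally_singleton _ _ (Hd b Hb)))) k Hk).
  assert (L2 := proper_boundary g q r f l b k HD Hf (proj2 Hl) Hb Hk).
  destruct (proj1 (locally_CmodP _ _) (filter_and (F := locally b) _ _ L1 L2)) as [x [Hx L]].
  (* The radial distance from [b] to a point of Omega, small enough for both the continuity of [F]
     and the limit of [Cmod (f z)] to apply. *)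
  set (t := Rmin (x / 2) ((R0 - r l) / 2)).
  assert (Ht : 0 < t) by (apply Rmin_pos; lra).
  assert (t <= x / 2) by apply Rmin_l; assert (t <= (R0 - r l) / 2) by apply Rmin_r.
  destruct (polar b (q l)) as [th [_ E]]; rewrite Hb in E.
  set (z := (q l + RtoC (r l + t) * cis th)%C).
  assert (Hz : Omega g q r z) by (apply HA; unfold z; rewrite Cmod_circle; lra).
  destruct (L z) as [A1 A2].
  - unfold z; rewrite E.
    replace (q l + RtoC (r l + t) * cis th - (q l + RtoC (r l) * cis th))%C with (RtoC t * cis th)%C
      by (rewrite RtoC_plus; ring).
    rewrite Cmod_mult, Cmod_cis, Cmod_R, Rabs_right; lra.
  - specialize (A2 Hz); rewrite <- (HF2 z Hz) in A2.
    unfold k, Rabs in *; repeat destruct Rcase_abs; lra. }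
assert (Hreg : forall b, Cmod (b - q l) = r l -> reg F b /\ Cmod (F b) = 1).
{ intros b Hb; split; [|auto]; split; [auto|]; apply Cmod_gt_0; rewrite H1 by exact Hb; lra. }
assert (Hflux : Re (flux F (q l) (r l)) = - (2 * PI * INR d)).
{ apply degree_flux with (e := R0 - r l); auto; [lra|].
  intros z Hz; assert (HO : Omega g q r z) by (apply HA; lra).
  rewrite (HF2 z HO); left; apply Hf, HO. }
destruct (circle_nbhd (reg F) (q l) (r l) Hr) as [k [Hk L]]; [intros b Hb; apply reg_locally, Hreg, Hb|].
set (k' := Rmin k (r l)); assert (Hk' : 0 < k') by (apply Rmin_pos; assumption).
assert (k' <= k) by apply Rmin_l; assert (k' <= r l) by apply Rmin_r.
exists (Rmin R0 (r l + k')); split; [apply Rmin_glb_lt; lra|]; intros s Hs.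
assert (Rmin R0 (r l + k') <= R0) by apply Rmin_l.
assert (Rmin R0 (r l + k') <= r l + k') by apply Rmin_r.
assert (HFr : forall z, r l - k' < Cmod (z - q l) < r l + k' -> reg F z).
{ intros z Hz; apply L; apply Rabs_def1; lra. }
assert (HFf : forall z, Cmod (z - q l) = s -> locally z (fun y => F y = f y)).
{ intros z Hz; assert (HO : Omega g q r z) by (apply HA; lra).
  generalize (Omega_open g q r z HO); apply filter_imp; exact HF2. }
split.
- intros z Hz; destruct (HFr z ltac:(lra)) as [A B]; split.
  + assert (A2 := locally_locally z _ (HFf z Hz)).
    generalize (filter_and (F := locally z) _ _ A A2); apply filter_imp; intros y [D E].
    exact (dif_ext_loc F f y E D).
  + rewrite <- (locally_singleton _ _ (HFf z Hz)); exact B.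
- rewrite <- (flux_ext F f (q l) s) by
    (first [lra|intros z Hz; split; [apply reg_dif, HFr; lra|apply HFf, Hz]]).
  rewrite (flux_const F (q l) (r l - k') (r l + k') s (r l)); try lra.
  intros z Hz; split; [apply reg_dif, HFr, Hz|apply HFr, Hz].
Qed.

(** * The multiplier built from the integrals of the first kind *)

Lemma Csum_0 (a : nat -> C) : sum_n_m a 1 0 = RtoC 0.
Proof. apply (sum_n_m_zero a); lia. Qed.

Lemma Csum_S (a : nat -> C) m : sum_n_m a 1 (S m) = (sum_n_m a 1 m + a (S m))%C.
Proof. apply (sum_n_Sm a); lia. Qed.

Lemma Cprod_0 (a : nat -> C) : Cprod_n_m a 1 0 = RtoC 1.
Proof. reflexivity. Qed.

Lemma Cprod_S (a : nat -> C) m : Cprod_n_m a 1 (S m) = (Cprod_n_m a 1 m * a (S m))%C.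
Proof.
unfold Cprod_n_m; rewrite (Iter.iter_nat_Chasles Cmult (RtoC 1)) with (m := m); try lia.
- rewrite Iter.iter_nat_point; [reflexivity|intros; ring].
- intros; ring.
- intros; ring.
Qed.

Lemma reg_ext_loc K L z : locally z (fun y => K y = L y) -> reg K z -> reg L z.
Proof.
intros H [A B]; split.
- generalize (filter_and (F := locally z) _ _ A (locally_locally z _ H)); apply filter_imp.
  intros y [D E]; exact (dif_ext_loc K L y E D).
- rewrite <- (locally_singleton _ _ H); exact B.
Qed.

Lemma has_card_unique {T : Type} (A : T -> Prop) m m' : has_card A m -> has_card A m' -> m = m'.
Proof.
intros [l [N [<- H]]] [l' [N' [<- H']]]; apply Nat.le_antisymm; apply NoDup_incl_length; auto;
  intros x Hx; [apply H', H|apply H, H']; exact Hx.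
Qed.

Lemma eq_mod_Z_Im a b : eq_mod_Z a b -> Im a = Im b.
Proof.
intros [k E]; apply (f_equal Im) in E; unfold Im, RtoC in *; simpl in E; lra.
Qed.

Lemma eq_mod_Z_scal_nat (N : nat) a b : eq_mod_Z a b -> eq_mod_Z (RtoC (INR N) * a) (RtoC (INR N) * b).
Proof.
intros [k E]; exists (Z.of_nat N * k)%Z.
rewrite mult_IZR, <- INR_IZR_INZ, RtoC_mult, <- E; ring.
Qed.

Lemma eq_mod_Z_plus a b a' b' : eq_mod_Z a b -> eq_mod_Z a' b' -> eq_mod_Z (a + a') (b + b').
Proof. intros [k E] [k' E']; exists (k + k')%Z; rewrite plus_IZR, RtoC_plus, <- E, <- E'; ring. Qed.

Lemma Cexp_eq_mod_Z a b : eq_mod_Z a b ->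
  Cexp (- (RtoC 2 * RtoC PI * Ci) * a) = Cexp (- (RtoC 2 * RtoC PI * Ci) * b).
Proof.
intros [k E]; replace a with (b + RtoC (IZR k))%C by (rewrite <- E; ring).
rewrite Cmult_plus_distr_l, Cexp_plus.
replace (- (RtoC 2 * RtoC PI * Ci) * RtoC (IZR k))%C with (Ci * RtoC (2 * PI * IZR (- k)))%C.
- rewrite Cexp_periodic_Z; ring.
- rewrite opp_IZR, !RtoC_mult, RtoC_opp; ring.
Qed.

Lemma Im_plus_scal (a b : C) x : Im (a + RtoC x * b) = Im a + x * Im b.
Proof. destruct a, b; unfold Cplus, Cmult, RtoC, Im; simpl; ring. Qed.

Section Integrals.
Variables (g : nat) (q : nat -> C) (r : nat -> R).
Variables (v : nat -> sphere -> C) (dv : nat -> C -> C) (tau : nat -> nat -> C) (d : nat -> nat).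
Hypothesis HD : circular_domain g q r.
Hypothesis HI : integrals_of_first_kind g q r v dv tau.

Definition vsum (m : nat) (z : C) : C := sum_n_m (fun j => RtoC (INR (d j)) * v j (Some z))%C 1 m.
Definition dvsum (m : nat) (z : C) : C := sum_n_m (fun j => RtoC (INR (d j)) * dv j z)%C 1 m.
(** The choice [v] may jump by integers, and so may [vsum], its weights being natural numbers; the
    factor [2 * PI * i] makes the exponential insensitive to these jumps. *)
Definition exp_vsum (z : C) : C := Cexp (- (RtoC 2 * RtoC PI * Ci) * vsum g z).

Lemma Omega_bar_star z : Omega_bar g q r z -> Omega_star_bar g q r (Some z).
Proof. intros H; exists z; auto. Qed.

Lemma vsum_local z m : Omega_bar g q r z -> (m <= g)%nat ->
  exists h, locally z (fun y => cder h y (dvsum m y) /\ eq_mod_Z (vsum m y) (h y)).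
Proof.
intros Hz; induction m as [|m IH]; intros Hm.
- exists (fun _ => RtoC 0); apply filter_forall; intros y; unfold dvsum, vsum; rewrite !Csum_0; split.
  + apply cder_const.
  + exists 0%Z; ring.
- destruct IH as [h Hh]; [lia|].
  destruct (proj1 (ifk_analytic _ _ _ _ _ _ HI (S m) ltac:(lia)) z (Omega_bar_star z Hz)) as [k Hk].
  exists (fun y => h y + RtoC (INR (d (S m))) * k y)%C.
  generalize (filter_and (F := locally z) _ _ Hh Hk); apply filter_imp; intros y [[A B] [A' B']].
  unfold dvsum, vsum in *; rewrite !Csum_S; split.
  + apply cder_plus; [exact A|apply cder_scal, is_derive_cder, A'].
  + apply eq_mod_Z_plus; [exact B|apply eq_mod_Z_scal_nat, B'].
Qed.

Lemma exp_vsum_local z : Omega_bar g q r z ->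
  locally z (fun y => cder exp_vsum y (exp_vsum y * (- (RtoC 2 * RtoC PI * Ci) * dvsum g y))%C).
Proof.
intros Hz; destruct (vsum_local z g Hz (le_n _)) as [h Hh].
generalize (filter_and (F := locally z) _ _ Hh (locally_locally z _ Hh)); apply filter_imp.
intros y [[A B] L].
apply cder_ext_loc with (fun y => Cexp (- (RtoC 2 * RtoC PI * Ci) * h y)).
- revert L; apply filter_imp; intros x [_ E]; symmetry; apply Cexp_eq_mod_Z, E.
- unfold exp_vsum at 1; rewrite (Cexp_eq_mod_Z _ _ B).
  apply (cder_comp Cexp (fun y => - (RtoC 2 * RtoC PI * Ci) * h y)%C); [apply cder_scal, A|apply cder_Cexp].
Qed.

Lemma exp_vsum_reg z : Omega_bar g q r z -> reg exp_vsum z.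
Proof.
intros Hz; split; [|apply Cexp_neq_0].
generalize (exp_vsum_local z Hz); apply filter_imp; intros y H; eexists; exact H.
Qed.

Lemma vsum_Im z z' m : (forall j, (1 <= j <= m)%nat -> Im (v j (Some z)) = Im (v j (Some z'))) ->
  Im (vsum m z) = Im (vsum m z').
Proof.
unfold vsum; induction m as [|m IH]; intros H; [rewrite !Csum_0; reflexivity|].
rewrite !Csum_S, !Im_plus_scal, IH by (intros j Hj; apply H; lia); rewrite (H (S m)) by lia; reflexivity.
Qed.

Lemma vsum_Im_0 z m : (forall j, (1 <= j <= m)%nat -> Im (v j (Some z)) = 0) -> Im (vsum m z) = 0.
Proof.
unfold vsum; induction m as [|m IH]; intros H; [rewrite !Csum_0; reflexivity|].
rewrite !Csum_S, !Im_plus_scal, IH by (intros j Hj; apply H; lia); rewrite (H (S m)) by lia; ring.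
Qed.

Lemma exp_vsum_Cmod z : Cmod (exp_vsum z) = exp (2 * PI * Im (vsum g z)).
Proof.
unfold exp_vsum; rewrite Cmod_Cexp; f_equal; destruct (vsum g z) as [a b].
unfold Copp, Cmult, RtoC, Ci, Re, Im; simpl; ring.
Qed.

Lemma circle_Omega_bar l z : (l <= g)%nat -> circle q r l z -> Omega_bar g q r z.
Proof. intros Hl Hz; right; eauto. Qed.

Lemma phi_fixed l z : (l <= g)%nat -> circle q r l z -> phi q r l (Some z) = Some z.
Proof.
intros Hl Hz; assert (Hr := radius_pos g q r HD l Hl); unfold circle in Hz.
assert (Hne : z <> q l) by (intros ->; rewrite Cmod_center in Hz; lra).
unfold phi; destruct (Ceq_dec z (q l)) as [|_]; [contradiction|]; f_equal.
assert (N : Cconj (z - q l) <> 0%C) by (apply Cmod_gt_0; rewrite Cmod_conj; lra).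
replace (Cconj z - Cconj (q l))%C with (Cconj (z - q l)) by
  (unfold Cconj, Cminus, Cplus, Copp; simpl; f_equal; ring).
rewrite <- Hz, Cmod2_conj; field; exact N.
Qed.

Lemma phi_0_involutive z : phi q r 0 (phi q r 0 (Some z)) = Some z.
Proof.
destruct HD as [E0 [E1 _]]; unfold phi at 2; rewrite E0, E1.
destruct (Ceq_dec z 0) as [->|Hz]; [simpl; rewrite E0; reflexivity|].
assert (N : Cconj z <> 0%C) by (apply Cmod_gt_0; rewrite Cmod_conj; apply Cmod_gt_0, Hz).
assert (C0 : Cconj 0 = 0%C) by (unfold Cconj, RtoC; simpl; f_equal; ring).
replace (0 + RtoC (1 ^ 2) / (Cconj z - Cconj 0))%C with (/ Cconj z)%C
  by (rewrite C0; replace (1 ^ 2) with 1 by ring; field; exact N).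
unfold phi; rewrite E0, E1; destruct (Ceq_dec (/ Cconj z) 0) as [E|_].
{ exfalso; apply C1_nz; rewrite <- (Cinv_r _ N), E; ring. }
f_equal; rewrite C0; replace (1 ^ 2) with 1 by ring.
assert (E : Cconj (/ Cconj z) = (/ z)%C).
{ assert (A : (Cconj (/ Cconj z) * z = 1)%C).
  { rewrite <- (Cconj_conj z) at 2; rewrite <- Cmult_conj, Cinv_l by exact N.
    unfold Cconj, RtoC; simpl; f_equal; ring. }
  rewrite <- (Cmult_1_l (/ z)), <- A; field; exact Hz. }
rewrite E; replace (/ z - 0)%C with (/ z)%C by ring; field; exact Hz.
Qed.

Lemma Im_v_outer j z : (1 <= j <= g)%nat -> circle q r 0 z -> Im (v j (Some z)) = 0.
Proof.
intros Hj Hz; assert (Hb := Omega_bar_star z (circle_Omega_bar 0 z ltac:(lia) Hz)).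
assert (E := eq_mod_Z_Im _ _ (ifk_reflection _ _ _ _ _ _ HI j (Some z) Hj Hb)).
rewrite phi_fixed in E by (lia || exact Hz); unfold Cconj, Im in *; simpl in E; lra.
Qed.

(** On [gamma_l], [theta_l (phi_0 z) = phi_l z = z]. So [v_j z - v_j (phi_0 z)] is [tau_lj] modulo
    integers, while [v_j (phi_0 z)] is the conjugate of [v_j z] modulo integers; integers do not
    affect imaginary parts. *)
Lemma Im_v_inner l j z : (1 <= l <= g)%nat -> (1 <= j <= g)%nat -> circle q r l z ->
  Im (v j (Some z)) = Im (tau l j) / 2.
Proof.
intros Hl Hj Hz; assert (Hb := Omega_bar_star z (circle_Omega_bar l z ltac:(lia) Hz)).
assert (E := eq_mod_Z_Im _ _ (ifk_reflection _ _ _ _ _ _ HI j (Some z) Hj Hb)).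
assert (Th := ifk_theta _ _ _ _ _ _ HI l j z Hl Hj Hz).
(* A neighbourhood contains its centre, also at infinity, where the chart sends 0 to [None]. *)
assert (Sing : forall P A, sphere_locally P A -> A P).
{ intros [y|] A H; simpl in H; [exact (locally_singleton y _ H)|].
  apply locally_singleton in H; unfold at_infinity in H; destruct (Ceq_dec 0 0); [exact H|congruence]. }
apply Sing in Th; unfold theta in Th; rewrite phi_0_involutive, phi_fixed in Th by (lia || exact Hz).
apply eq_mod_Z_Im in Th; unfold Cconj, Cminus, Cplus, Copp, Im in *; simpl in *; lra.
Qed.

Lemma exp_vsum_boundary l : (l <= g)%nat -> exists c, 0 < c /\ (l = 0%nat -> c = 1) /\
  forall b, circle q r l b -> Cmod (exp_vsum b) = c.
Proof.
intros Hl; destruct l as [|l].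
- exists 1; split; [lra|split; [auto|]]; intros b Hb.
  rewrite exp_vsum_Cmod, vsum_Im_0, Rmult_0_r; [apply exp_0|].
  intros j Hj; apply Im_v_outer; assumption.
- assert (Hr := radius_pos g q r HD (S l) Hl).
  set (b0 := (q (S l) + RtoC (r (S l)) * cis 0)%C).
  assert (Hb0 : circle q r (S l) b0) by (apply Cmod_circle; lra).
  exists (Cmod (exp_vsum b0)); split; [rewrite exp_vsum_Cmod; apply exp_pos|split; [lia|]].
  intros b Hb; rewrite !exp_vsum_Cmod; do 2 f_equal; apply vsum_Im.
  intros j Hj; rewrite !(Im_v_inner (S l) j) by (assumption || lia); reflexivity.
Qed.

(** The case distinction is for the induction on [m]: the period over [gamma_l] sees only the term
    of index [l], which enters once [m] reaches [l]. *)
Lemma dvsum_period l m : (1 <= l <= g)%nat -> (m <= g)%nat ->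
  is_RInt (V := C_R_NormedModule) (fun t : R =>
    (dvsum m (q l + RtoC (r l) * cis t) * (Ci * RtoC (r l) * cis t))%C) 0 (2 * PI)
    (RtoC (if le_lt_dec l m then INR (d l) else 0)).
Proof.
intros Hl; induction m as [|m IH]; intros Hm.
- destruct (le_lt_dec l 0) as [|_]; [lia|].
  apply (is_RInt_ext (V := C_R_NormedModule) (fun _ => RtoC 0)).
  { intros t _; unfold dvsum; rewrite Csum_0; symmetry; apply Cmult_0_l. }
  evar_last; [apply is_RInt_const|].
  unfold scal; simpl; unfold prod_scal, scal, RtoC; simpl; unfold mult; simpl; f_equal; ring.
- assert (P := ifk_periods _ _ _ _ _ _ HI l (S m) Hl ltac:(lia)).
  apply (is_RInt_scal (V := C_R_NormedModule) _ _ _ (INR (d (S m)))) in P.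
  assert (Q := is_RInt_plus (V := C_R_NormedModule) _ _ _ _ _ _ (IH ltac:(lia)) P).
  evar_last; [eapply is_RInt_ext; [|exact Q]|].
  + intros t _; unfold dvsum; rewrite Csum_S; fold (cis t).
    match goal with |- plus ?a (scal ?b ?c) = _ => change (plus a (scal b c)) with (a + ((b * fst c)%R, (b * snd c)%R))%C end.
    unfold Cplus, Cmult, RtoC; simpl; f_equal; ring.
  + unfold plus, scal; simpl; unfold prod_plus, prod_scal, plus, scal, RtoC; simpl; unfold mult; simpl.
    destruct (le_lt_dec l m), (le_lt_dec l (S m)), (Nat.eq_dec l (S m)); try lia; subst; f_equal; ring.
Qed.

(** On [gamma_l] the integrand of the flux is [- 2 * PI] times that of the period of the weighted
    sum of the [dv_j], which equals [d l]; constancy of the flux then moves the result into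
    Omega. *)
Lemma exp_vsum_flux l : (1 <= l <= g)%nat -> exists R, r l < R /\ forall s, r l < s < R ->
  (forall z, Cmod (z - q l) = s -> reg exp_vsum z) /\ Re (flux exp_vsum (q l) s) = - (2 * PI * INR (d l)).
Proof.
intros Hl; assert (Hr := radius_pos g q r HD l ltac:(lia)).
assert (Hb : forall b, Cmod (b - q l) = r l -> Omega_bar g q r b).
{ intros b Hb; apply (circle_Omega_bar l); [lia|exact Hb]. }
destruct (circle_nbhd (reg exp_vsum) (q l) (r l) Hr) as [k [Hk L]].
{ intros b Hc; apply reg_locally, exp_vsum_reg, Hb, Hc. }
set (k' := Rmin k (r l)); assert (Hk' : 0 < k') by (apply Rmin_pos; assumption).
assert (k' <= k) by apply Rmin_l; assert (k' <= r l) by apply Rmin_r.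
assert (HW : forall z, r l - k' < Cmod (z - q l) < r l + k' -> reg exp_vsum z).
{ intros z Hz; apply L; apply Rabs_def1; lra. }
exists (r l + k'); split; [lra|]; intros s Hs; split; [intros z Hz; apply HW; lra|].
rewrite (flux_const exp_vsum (q l) (r l - k') (r l + k') s (r l)); try lra.
2:{ intros z Hz; split; [apply reg_dif, HW, Hz|apply HW, Hz]. }
assert (P := dvsum_period l g Hl (le_n _)).
destruct (le_lt_dec l g) as [_|]; [|lia].
apply (is_RInt_scal (V := C_R_NormedModule) _ _ _ (- (2 * PI))) in P.
apply (is_RInt_fct_extend_fst (U := R_NormedModule) (V := R_NormedModule)) in P.
apply (is_RInt_unique (V := R_CompleteNormedModule)) in P.
etransitivity; [|etransitivity; [exact P|]].
2:{ unfold scal; simpl; unfold scal; simpl; unfold mult; simpl; ring. }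
refine (RInt_ext (V := R_CompleteNormedModule) (fun t => Re (let z := (q l + RtoC (r l) * cis t)%C in
  (z - q l) * (Der exp_vsum z / exp_vsum z))%C) _ 0 (2 * PI) _); intros t _; cbv zeta.
set (z := (q l + RtoC (r l) * cis t)%C).
assert (Hz : Omega_bar g q r z) by (apply Hb, Cmod_circle; lra).
rewrite (Der_eq _ _ _ (locally_singleton _ _ (exp_vsum_local z Hz))).
replace ((z - q l) * (exp_vsum z * (- (RtoC 2 * RtoC PI * Ci) * dvsum g z) / exp_vsum z))%C
  with (RtoC (- (2 * PI)) * (dvsum g z * (Ci * RtoC (r l) * cis t)))%C.
- transitivity (- (2 * PI) * fst (dvsum g z * (Ci * RtoC (r l) * cis t))%C); [|reflexivity].
  generalize (dvsum g z * (Ci * RtoC (r l) * cis t))%C; intros w; unfold Re, Cmult, RtoC; simpl; ring.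
- rewrite RtoC_opp, RtoC_mult; unfold z at 2; field; apply Cexp_neq_0.
Qed.

End Integrals.

(* The quotient of [f] by [G], extended over the zeros of [G]. *)
Lemma glue_quotient (D : C -> Prop) (f G : C -> C) : (forall z, D z -> locally z D) ->
  (forall z, D z -> exists K, reg K z /\ locally z (fun y => f y = (K y * G y)%C) /\
     locally z (fun y => y <> z -> G y <> 0%C)) ->
  exists H, forall z, D z -> reg H z /\ f z = (H z * G z)%C.
Proof.
intros HO HK.
assert (Ch : forall z, exists K, D z -> reg K z /\ locally z (fun y => f y = (K y * G y)%C) /\
     locally z (fun y => y <> z -> G y <> 0%C)).
{ intros z; destruct (classic (D z)) as [Hz|Hz].
  - destruct (HK z Hz) as [K H]; exists K; auto.
  - exists (fun _ => RtoC 0); contradiction. }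
set (K := fun z => proj1_sig (constructive_indefinite_description _ (Ch z))).
assert (HKz : forall z, D z -> reg (K z) z /\ locally z (fun y => f y = (K z y * G y)%C) /\
     locally z (fun y => y <> z -> G y <> 0%C))
  by (intros z; exact (proj2_sig (constructive_indefinite_description _ (Ch z)))).
(* Each local quotient is taken at its own centre; near [z] it agrees with the others because [G]
   has no zero there except possibly [z]. *)
exists (fun z => K z z); intros z Hz; destruct (HKz z Hz) as [R1 [R2 R3]].
split; [|exact (locally_singleton _ _ R2)].
apply reg_ext_loc with (K z); [|exact R1].
generalize (filter_and (F := locally z) _ _ (HO z Hz) (filter_and (F := locally z) _ _ R2 R3)).
apply filter_imp; intros y [Dy [E N]].
destruct (Ceq_dec y z) as [->|Hn]; [reflexivity|].
specialize (N Hn); assert (E' := locally_singleton _ _ (proj1 (proj2 (HKz y Dy)))).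
cbv beta in E'; rewrite E in E'.
change (K z y = K y y :> C).
transitivity (K z y * G y / G y)%C; [field; exact N|rewrite E'; field; exact N].
Qed.

(** * Products of slit maps *)

Section Product.
Variables (g : nat) (q : nat -> C) (r : nat -> R).
Hypothesis HD : circular_domain g q r.
Let Om := Omega g q r.

Definition boundary_limit (l : nat) (h : C -> R) (c : R) : Prop :=
  forall b, circle q r l b -> filterlim h (within Om (locally b)) (locally c).

Lemma boundary_limitP l h c : boundary_limit l h c <->
  forall b k, circle q r l b -> 0 < k -> locally b (fun z => Om z -> Rabs (h z - c) < k).
Proof.
split.
- intros H b k Hb Hk; exact (H b Hb (fun x => Rabs (x - c) < k) (locally_ball c (mkposreal k Hk))).
- intros H b Hb P [k Hk]; generalize (H b k Hb (cond_pos k)); unfold filtermap, within.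
  apply filter_imp; intros z Hz HO; apply Hk, Hz, HO.
Qed.

Lemma boundary_limit_mult l h h' c c' : boundary_limit l h c -> boundary_limit l h' c' ->
  boundary_limit l (fun z => h z * h' z) (c * c').
Proof.
intros H H' b Hb.
apply (filterlim_comp_2 h h' Rmult (H b Hb) (H' b Hb)).
exact (filterlim_mult (K := R_AbsRing) c c').
Qed.

Lemma boundary_limit_inv l h c : c <> 0 -> boundary_limit l h c -> boundary_limit l (fun z => / h z) (/ c).
Proof.
intros Hc H b Hb; apply (filterlim_comp _ _ _ h Rinv _ _ _ (H b Hb)).
apply continuity_pt_filterlim; apply (continuity_pt_inv (fun x => x)); [apply continuity_pt_id|exact Hc].
Qed.

Lemma slit_map_facts a e : Om a -> slit_disk_map Om a e ->
  e a = 0%C /\ (forall z, Om z -> dif e z) /\ (forall z z', Om z -> Om z' -> e z = e z' -> z = z') /\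
  (forall l, (1 <= l <= g)%nat -> exists R, r l < R /\ forall s, r l < s < R ->
     (forall z, Cmod (z - q l) = s -> Om z /\ reg e z) /\ Re (flux e (q l) s) = 0) /\
  (forall l, (l <= g)%nat -> exists c, 0 < c /\ (l = 0%nat -> c = 1) /\ boundary_limit l (fun z => Cmod (e z)) c).
Proof.
intros Ha [[Sl [[m [rho [al [be [H1 [H2 H3]]]]]] Hconf]] [H0 Hcirc]].
split; [exact H0|split; [|split; [|split]]].
- intros z Hz; eapply slit_dif; eassumption.
- apply Hconf.
- intros l Hl; eapply slit_flux; eassumption.
- intros l Hl; destruct l as [|l].
  + exists 1; split; [lra|split; [auto|]]; apply boundary_limitP; intros b k Hb Hk.
    eapply slit_outer; [exact Hcirc| |exact Hk].
    unfold circle in Hb; destruct HD as [E0 [E1 _]]; rewrite E0, E1, Cmod_sub_0 in Hb; exact Hb.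
  + assert (Hl' : (1 <= S l <= g)%nat) by lia.
    assert (B : exists L be0, 0 < L /\
      (forall k, 0 < k -> eventually_near g q r (S l) (fun z => Rabs (Cmod (e z) - L) < k)) /\
      eventually_near g q r (S l) (fun z => forall x, 0 < x -> e z <> (RtoC x * cis be0)%C))
      by (eapply slit_boundary; eassumption).
    destruct B as [L [_ [HL [Hlim _]]]].
    exists L; split; [exact HL|split; [lia|]]; apply boundary_limitP; intros b k Hb Hk.
    destruct (Hlim k Hk) as [t [Ht H]].
    generalize (near_inner_circle g q r (S l) b t Hl' Hb Ht); apply filter_imp.
    intros z Hz HO; apply (proj2 (H z (Hz HO))).
Qed.

Variables (eta : C -> C -> C) (p : nat -> C) (n : nat).
Hypothesis Heta : forall a, Om a -> slit_disk_map Om a (fun z => eta z a).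
Hypothesis Hp : forall k, (1 <= k <= n)%nat -> Om (p k).

Let prod (m : nat) (z : C) : C := Cprod_n_m (fun k => eta z (p k)) 1 m.

(** Each factor with [p k = z] is injective and vanishes at [z], so its zero is simple; the other
    factors do not vanish at [z]. The order is therefore the number of such indices. *)
Lemma slit_product_order z m : Om z -> (m <= n)%nat -> exists N h,
  has_card (fun k => (1 <= k <= m)%nat /\ p k = z) N /\ reg h z /\
  locally z (fun y => prod m y = ((y - z) ^ N * h y)%C).
Proof.
intros Hz; induction m as [|m IH]; intros Hm.
- exists 0%nat, (fun _ => RtoC 1); split; [|split; [split; [apply filter_forall; intros; apply dif_const|apply C1_nz]|]].
  + exists nil; split; [constructor|split; [reflexivity|]]; intros k; split; [intros []|lia].
  + apply filter_forall; intros y; unfold prod; rewrite Cprod_0; simpl; symmetry; apply Cmult_1_l.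
- destruct IH as [N [h [[ls [ND [Hls Hin]]] [Hh HE]]]]; [lia|].
  assert (Ha : Om (p (S m))) by (apply Hp; lia).
  destruct (slit_map_facts _ _ Ha (Heta _ Ha)) as [E0 [Ed [Ei _]]].
  destruct (Ceq_dec (p (S m)) z) as [Ez|Ez].
  + rewrite Ez in *.
    destruct (proj1 (locally_CmodP _ _) (Omega_open g q r z Hz)) as [R [HR L]].
    destruct (factor_root (fun y => eta y z) z R) as [k [Hk Ek]]; auto; [intros y Hy; apply Ed, L, Hy|].
    exists (S N), (fun y => h y * k y)%C; split; [|split].
    * exists (S m :: ls); split; [constructor; [|exact ND]|split; [simpl; lia|]].
      { intros A; apply Hin in A; lia. }
      intros j; simpl; rewrite Hin; split.
      -- intros [<-|[A B]]; [split; [lia|exact Ez]|split; [lia|exact B]].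
      -- intros [A B]; destruct (Nat.eq_dec j (S m)) as [->|Nj]; [left; reflexivity|right; split; [lia|exact B]].
    * apply reg_mult; [exact Hh|split].
      { apply (dif_on_disk_locally k z R); [exact Hk|rewrite Cmod_center; exact HR]. }
      (* The value of the cofactor [k] at [z] is the derivative of the slit map there. *)
      intros Kz; apply (injective_Der_neq0 (fun y => eta y z) z R HR).
      { intros y Hy; apply Ed, L, Hy. }
      { intros y y' Hy Hy'; apply Ei; apply L; assumption. }
      apply Der_eq; exists k; split; [apply dif_continuous, Hk; rewrite Cmod_center; exact HR|split; [exact Kz|]].
      intros y; rewrite (Ek y), (Ek z); ring.
    * revert HE; apply filter_imp; intros y HE; unfold prod in *; rewrite Cprod_S, HE, Ez, (Ek y).
      change ((y - z) ^ N * h y * ((y - z) * k y) = (y - z) ^ S N * (h y * k y) :> C)%C; simpl; ring.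
  + exists N, (fun y => h y * eta y (p (S m)))%C; split; [|split].
    * exists ls; split; [exact ND|split; [exact Hls|]]; intros j; rewrite Hin; split.
      { intros [A B]; split; [lia|exact B]. }
      intros [A B]; destruct (Nat.eq_dec j (S m)) as [->|Nj]; [contradiction|split; [lia|exact B]].
    * apply (reg_mult h (fun y => eta y (p (S m)))); [exact Hh|split].
      { generalize (Omega_open g q r z Hz); apply filter_imp; exact Ed. }
      intros Kz; apply Ez, Ei; auto; congruence.
    * revert HE; apply filter_imp; intros y HE; unfold prod in *; rewrite Cprod_S, HE.
      change ((y - z) ^ N * h y * eta y (p (S m)) = (y - z) ^ N * (h y * eta y (p (S m))) :> C)%C; ring.
Qed.

Lemma slit_product_limit l m : (l <= g)%nat -> (m <= n)%nat ->
  exists c, 0 < c /\ (l = 0%nat -> c = 1) /\ boundary_limit l (fun z => Cmod (prod m z)) c.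
Proof.
intros Hl; induction m as [|m IH]; intros Hm.
- exists 1; split; [lra|split; [auto|]]; apply boundary_limitP; intros b k Hb Hk.
  apply filter_forall; intros z _; unfold prod; rewrite Cprod_0, Cmod_1, Rminus_diag, Rabs_R0; exact Hk.
- destruct IH as [c [Hc [Hc0 H]]]; [lia|].
  assert (Ha : Om (p (S m))) by (apply Hp; lia).
  destruct (slit_map_facts _ _ Ha (Heta _ Ha)) as [_ [_ [_ [_ F]]]].
  destruct (F l Hl) as [c' [Hc' [Hc0' H']]].
  exists (c * c'); split; [apply Rmult_lt_0_compat; assumption|split].
  + intros E; rewrite Hc0, Hc0' by exact E; ring.
  + assert (Q := boundary_limit_mult l _ _ _ _ H H'); intros b Hb; generalize (Q b Hb); apply filterlim_ext.
    intros z; unfold prod; rewrite Cprod_S, Cmod_mult; reflexivity.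
Qed.

Lemma slit_product_flux l m : (1 <= l <= g)%nat -> (m <= n)%nat ->
  exists R, r l < R /\ forall s, r l < s < R ->
    (forall z, Cmod (z - q l) = s -> reg (prod m) z) /\ Re (flux (prod m) (q l) s) = 0.
Proof.
intros Hl; assert (Hr := radius_pos g q r HD l ltac:(lia)); induction m as [|m IH]; intros Hm.
- exists (r l + 1); split; [lra|]; intros s Hs.
  change (prod 0) with (fun _ : C => RtoC 1); split.
  + intros z _; split; [apply filter_forall; intros; apply dif_const|apply C1_nz].
  + rewrite flux_const_fun by apply C1_nz; reflexivity.
- destruct IH as [R [HR H]]; [lia|].
  assert (Ha : Om (p (S m))) by (apply Hp; lia).
  destruct (slit_map_facts _ _ Ha (Heta _ Ha)) as [_ [_ [_ [F _]]]].
  destruct (F l Hl) as [R' [HR' H']].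
  exists (Rmin R R'); split; [apply Rmin_glb_lt; assumption|]; intros s Hs.
  assert (Rmin R R' <= R) by apply Rmin_l; assert (Rmin R R' <= R') by apply Rmin_r.
  destruct (H s ltac:(lra)) as [A B]; destruct (H' s ltac:(lra)) as [A' B'].
  set (e := fun z => eta z (p (S m))) in *.
  assert (E : forall z, (prod m z * e z)%C = prod (S m) z) by (intros z; unfold prod; rewrite Cprod_S; reflexivity).
  assert (Rg : forall z, Cmod (z - q l) = s -> reg (fun z => prod m z * e z)%C z).
  { intros z Hz; apply reg_mult; [apply A, Hz|apply A', Hz]. }
  split.
  + intros z Hz; apply (reg_ext_loc (fun z => prod m z * e z)%C); [apply filter_forall; exact E|apply Rg, Hz].
  + rewrite <- (flux_ext (fun z => prod m z * e z)%C); [|lra|].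
    * rewrite flux_mult; [|lra|exact A|intros z Hz; apply A', Hz].
      change (Re (flux (prod m) (q l) s + flux e (q l) s)) with
        (Re (flux (prod m) (q l) s) + Re (flux e (q l) s)); lra.
    * intros z Hz; split; [apply reg_dif, Rg, Hz|apply filter_forall; exact E].
Qed.

End Product.

(** * The quotient of [f] by the explicit product *)

Theorem theorem1p3
    (g : nat) (q : nat -> C) (r : nat -> R)
    (u : nat -> C -> R) (eta : C -> C -> C)
    (v : nat -> sphere -> C) (dv : nat -> C -> C) (tau : nat -> nat -> C)
    (n : nat) (p : nat -> C) (d : nat -> nat) :
  (1 <= g)%nat ->
  circular_domain g q r ->
  harmonic_measures g q r u ->
  (forall a, Omega g q r a ->
     slit_disk_map (Omega g q r) a (fun z => eta z a)) ->
  integrals_of_first_kind g q r v dv tau ->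
  (forall k, (1 <= k <= n)%nat -> Omega g q r (p k)) ->
  (forall j, (1 <= j <= g)%nat -> (0 < d j)%nat) ->
  (forall j, (1 <= j <= g)%nat ->
     sum_n_m (fun k => u j (p k)) 1 n = INR (d j)) ->
  forall f : C -> C,
    proper_onto_disk (Omega g q r) f ->
    zero_list (Omega g q r) f n p ->
    (forall j, (1 <= j <= g)%nat -> boundary_degree g q r f j (d j)) ->
    exists! c : C,
      (exists t : R, c = Cexp (Ci * RtoC t)) /\
      forall z, Omega g q r z ->
        f z = (c *
          (Cexp (- (RtoC 2 * RtoC PI * Ci)
                 * sum_n_m (fun j => RtoC (INR (d j)) * v j (Some z)) 1 g)
           * Cprod_n_m (fun k => eta z (p k)) 1 n))%C.
Proof.
intros _ HD _ Heta HI Hp _ _ f Hf Hzero Hdeg.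
set (Om := Omega g q r) in *.
set (W := exp_vsum g v d).
set (E := fun z => Cprod_n_m (fun k => eta z (p k)) 1 n).
set (G := fun z => (W z * E z)%C).
assert (HO : forall z, Om z -> locally z Om) by (intros z; apply Omega_open).
assert (HW : forall z, Om z -> reg W z) by (intros z Hz; eapply exp_vsum_reg; [exact HI|left; exact Hz]).
destruct (glue_quotient Om f G HO) as [H HH].
{ intros z Hz.
  destruct (slit_product_order g q r HD eta p n Heta Hp z n Hz (le_n _)) as [N [h [HN [Hh HE]]]].
  destruct (Hzero z Hz) as [N' [HN' [k [Hk [Hkz Hkf]]]]].
  (* The orders of [f] and of the product at [z] count the same indices, so the powers of [y - z]
     cancel in the quotient. *)
  assert (N' = N) by (eapply has_card_unique; eassumption); subst N'.
  assert (Rk : reg k z).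
  { split; [|exact Hkz]; unfold holomorphic_at in Hk; revert Hk; apply filter_imp; intros y; apply ex_derive_dif. }
  assert (Rd : reg (fun y => h y * W y)%C z) by (apply reg_mult; auto).
  exists (fun y => k y / (h y * W y))%C; split; [apply reg_div; assumption|].
  assert (L := filter_and (F := locally z) _ _ HE (reg_locally _ z Rd)); split.
  - generalize (filter_and (F := locally z) _ _ L Hkf); apply filter_imp; intros y [[A [_ B]] D].
    change (f y = (k y / (h y * W y)) * (W y * E y) :> C)%C.
    unfold E; rewrite A, D; field.
    split; intros X; apply B; rewrite X; ring.
  - revert L; apply filter_imp; intros y [A [_ B]] Hn; unfold G, E; rewrite A.
    apply Cmult_neq_0; [intros X; apply B; rewrite X; ring|].
    apply Cmult_neq_0; [apply Cpow_nz, Csub_neq, Hn|intros X; apply B; rewrite X; ring]. }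
assert (Hreg : forall z, Om z -> dif H z /\ H z <> 0%C).
{ intros z Hz; split; [apply reg_dif, HH, Hz|apply HH, Hz]. }
(* The existential stands outside the implication so that one total function [c] can be chosen. *)
assert (Lim : forall l, exists c, (l <= g)%nat -> 0 < c /\ (l = 0%nat -> c = 1) /\
  boundary_limit g q r l (fun z => Cmod (H z)) c).
{ intros l; destruct (le_lt_dec l g) as [Hl|Hl]; [|exists 1; lia].
  destruct (exp_vsum_boundary g q r v dv tau d HD HI l Hl) as [cW [PW [W0 BW]]].
  destruct (slit_product_limit g q r HD eta p n Heta Hp l n Hl (le_n _)) as [cE [PE [E0 BE]]].
  assert (PG : 0 < cW * cE) by (apply Rmult_lt_0_compat; assumption).
  (* The limit 1 of [Cmod (f z)] divided by that of [Cmod (G z)], written in the form which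
     [boundary_limit_mult] produces. *)
  exists (1 * / (cW * cE)); intros _; split; [|split].
  - rewrite Rmult_1_l; apply Rinv_0_lt_compat, PG.
  - intros El; rewrite W0, E0 by exact El; field.
  - assert (LW : boundary_limit g q r l (fun z => Cmod (W z)) cW).
    { apply boundary_limitP; intros b k Hb Hk.
      assert (Rb : reg W b) by (eapply exp_vsum_reg; [exact HI|apply (circle_Omega_bar g q r l); assumption]).
      generalize (proj1 (continuous_RP _ _) (continuous_Cmod W b (dif_continuous _ _ (reg_dif _ _ Rb))) k Hk).
      unfold W at 2; rewrite (BW b Hb); apply filter_imp; intros z Hz _; exact Hz. }
    assert (LG : boundary_limit g q r l (fun z => Cmod (G z)) (cW * cE)).
    { assert (Q := boundary_limit_mult g q r l _ _ _ _ LW BE); intros b Hb; generalize (Q b Hb); apply filterlim_ext.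
      intros z; unfold G; rewrite Cmod_mult; reflexivity. }
    assert (Lf : boundary_limit g q r l (fun z => Cmod (f z)) 1).
    { apply boundary_limitP; intros b k Hb Hk; apply (proper_boundary g q r f l); assumption. }
    assert (Q := boundary_limit_mult g q r l _ _ _ _ Lf
      (boundary_limit_inv g q r l _ _ (Rgt_not_eq _ _ PG) LG)).
    intros b Hb; generalize (Q b Hb); apply filterlim_ext_loc.
    generalize (proj1 (boundary_limitP g q r l _ _) LG b (cW * cE) Hb PG); unfold within; apply filter_imp.
    intros z Hz HOz; specialize (Hz HOz).
    change (Cmod (f z) * / Cmod (G z) = Cmod (H z) :> R).
    rewrite (proj2 (HH z HOz)), Cmod_mult.
    assert (0 < Cmod (G z)) by (apply Rabs_def2 in Hz; lra); field; lra. }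
set (c := fun l => proj1_sig (constructive_indefinite_description _ (Lim l))).
assert (Hc : forall l, (l <= g)%nat -> 0 < c l /\ (l = 0%nat -> c l = 1) /\ boundary_limit g q r l (fun z => Cmod (H z)) (c l))
  by (intros l; exact (proj2_sig (constructive_indefinite_description _ (Lim l)))).
assert (Flux : forall l, (1 <= l <= g)%nat -> exists R, r l < R /\ forall s, r l < s < R ->
  (forall z, Cmod (z - q l) = s -> reg H z) /\ Re (flux H (q l) s) = 0).
{ intros l Hl; assert (Hr := radius_pos g q r HD l ltac:(lia)).
  destruct (inner_annulus g q r HD l Hl) as [R0 [HR0 HA]].
  destruct (proper_flux g q r f l (d l) HD Hf Hl (Hdeg l Hl)) as [R1 [HR1 H1]].
  destruct (exp_vsum_flux g q r v dv tau d HD HI l Hl) as [R2 [HR2 H2]].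
  destruct (slit_product_flux g q r HD eta p n Heta Hp l n Hl (le_n _)) as [R3 [HR3 H3]].
  set (R := Rmin (Rmin R0 R1) (Rmin R2 R3)).
  assert (A1 : R <= Rmin R0 R1) by apply Rmin_l; assert (A2 : R <= Rmin R2 R3) by apply Rmin_r.
  assert (A3 : Rmin R0 R1 <= R0) by apply Rmin_l; assert (A4 : Rmin R0 R1 <= R1) by apply Rmin_r.
  assert (A5 : Rmin R2 R3 <= R2) by apply Rmin_l; assert (A6 : Rmin R2 R3 <= R3) by apply Rmin_r.
  exists R; split; [repeat apply Rmin_glb_lt; assumption|]; intros s Hs.
  destruct (H1 s ltac:(lra)) as [B1 C1]; destruct (H2 s ltac:(lra)) as [B2 C2]; destruct (H3 s ltac:(lra)) as [B3 C3].
  split; [intros z Hz; apply HH, HA; lra|].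
  assert (RG : forall z, Cmod (z - q l) = s -> reg G z) by (intros z Hz; apply reg_mult; auto).
  rewrite <- (flux_ext (fun z => f z / G z)%C); [|lra|].
  - rewrite flux_div; [|lra|exact B1|exact RG].
    unfold G; rewrite (flux_mult W E) by (lra || assumption).
    change (Re (flux f (q l) s) - (Re (flux W (q l) s) + Re (flux E (q l) s)) = 0).
    unfold W, E; rewrite C1, C2, C3; ring.
  - intros z Hz; split; [apply reg_dif, reg_div; auto|].
    assert (HOz : Om z) by (apply HA; lra).
    generalize (filter_and (F := locally z) _ _ (HO z HOz) (reg_locally G z (RG z Hz))); apply filter_imp.
    intros y [Y1 [_ Y2]]; rewrite (proj2 (HH y Y1)).
    change (H y * G y / G y = H y :> C)%C; field; exact Y2. }
assert (Up : forall z, Om z -> Cmod (H z) <= 1).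
{ apply (modulus_le_1 g q r HD H c Hreg).
  - apply Hc; [lia|reflexivity].
  - intros l Hl; apply Hc, Hl.
  - intros l b k Hl Hb Hk; apply (proj1 (boundary_limitP g q r l _ _) (proj2 (proj2 (Hc l Hl))) b k Hb Hk).
  - intros l Hl; destruct (Flux l Hl) as [R [HR F]]; exists R; split; [exact HR|]; intros s Hs; apply F, Hs. }
assert (Low : forall z, Om z -> Cmod (1 / H z)%C <= 1).
{ apply (modulus_le_1 g q r HD (fun z => 1 / H z)%C (fun l => / c l)).
  - intros z Hz; destruct (Hreg z Hz) as [A B]; split; [apply dif_div; auto using dif_const|].
    intros X; apply C1_nz; transitivity (1 / H z * H z)%C; [field; exact B|rewrite X; ring].
  - rewrite (proj1 (proj2 (Hc 0%nat ltac:(lia)))) by reflexivity; apply Rinv_1.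
  - intros l Hl; apply Rinv_0_lt_compat, Hc, Hl.
  - intros l b k Hl Hb Hk; destruct (Hc l Hl) as [A [_ B]].
    assert (Q := boundary_limit_inv g q r l _ _ (Rgt_not_eq _ _ A) B).
    generalize (filter_and (F := locally b) _ _ (proj1 (boundary_limitP g q r l _ _) Q b k Hb Hk)
      (filter_forall (F := locally b) (fun z => forall (HOz : Om z), H z <> 0%C) (fun z HOz => proj2 (Hreg z HOz)))).
    apply filter_imp; intros z [X Y] HOz; specialize (X HOz).
    rewrite Cmod_div, Cmod_1 by (apply Y, HOz); unfold Rdiv; rewrite Rmult_1_l; exact X.
  - intros l Hl; destruct (Flux l Hl) as [R [HR F]]; exists R; split; [exact HR|]; intros s Hs.
    destruct (F s Hs) as [A B]; assert (Hr := radius_pos g q r HD l ltac:(lia)).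
    rewrite (flux_div (fun _ => RtoC 1) H); [|lra| |exact A].
    + rewrite flux_const_fun by apply C1_nz.
      change (0 - Re (flux H (q l) s) = 0); lra.
    + intros z _; split; [apply filter_forall; intros; apply dif_const|apply C1_nz]. }
assert (One : forall z, Om z -> Cmod (H z) = 1).
{ intros z Hz; apply Rle_antisym; [apply Up, Hz|].
  assert (B := Low z Hz); destruct (Hreg z Hz) as [_ N]; rewrite Cmod_div, Cmod_1 in B by exact N.
  apply Cmod_gt_0 in N; apply Rmult_le_reg_l with (/ Cmod (H z)); [apply Rinv_0_lt_compat, N|].
  rewrite Rinv_l by lra; lra. }
(* Surjectivity provides a point where [f], and hence [G], does not vanish; dividing by [G z0]
   determines the constant. *)
destruct (proj1 (proj2 (proj2 Hf)) (RtoC (/ 2))) as [z0 [Hz0 Ez0]].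
{ unfold unit_disk; rewrite Cmod_R, Rabs_right; lra. }
assert (Const : forall z, Om z -> f z = (H z0 * G z)%C).
{ intros z Hz; rewrite (proj2 (HH z Hz)).
  rewrite (constant_of_unimodular g q r HD H (fun z Hz => proj1 (Hreg z Hz)) One z z0 Hz Hz0); reflexivity. }
exists (H z0); split.
- split; [|exact Const].
  destruct (cis_surj (H z0) (One z0 Hz0)) as [t [_ Et]]; exists t; exact Et.
- intros c' [_ Hc']; specialize (Hc' z0 Hz0); change (f z0 = (c' * G z0)%C) in Hc'.
  assert (A := Const z0 Hz0); rewrite Hc' in A.
  assert (NG : G z0 <> 0%C).
  { intros X; rewrite X, Cmult_0_r in Hc'; rewrite Hc' in Ez0; apply RtoC_inj in Ez0; lra. }
  transitivity (H z0 * G z0 / G z0)%C; [field; exact NG|rewrite <- A; field; exact NG].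
Qed.
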